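(* Let $\lambda>1$ be given by $\log \lambda = \cosh^{-1}(\cot\frac{\pi}{8})$ and let $\Gamma_2$ be the subgroup of $\mathrm{SL}(3,\mathbb R)$ generated by the four matrices $$ \begin{bmatrix} \cos \theta & 0 & \sin \theta \\ 0 & 1 & 0 \\ -\sin \theta & 0 & \cos \theta \end{bmatrix} \begin{bmatrix} \lambda & 0 & 0 \\ 0 & 1 & 0 \\ 0 & 0 & \lambda^{-1} \end{bmatrix} \begin{bmatrix} \cos \theta & 0 & -\sin \theta \\ 0 & 1 & 0 \\ \sin \theta & 0 & \cos \theta \end{bmatrix},\qquad \theta \in \left\{0,\tfrac{\pi}{8},\tfrac{\pi}{4},\tfrac{3\pi}{8}\right\} $$ (a group isomorphic to the fundamental group of a closed surface of genus $2$). Let $S'=\{\gamma\in\Gamma_2 : d(p,\gamma p)\le 9.5\}$, where $p$ is the point stabilized by $\mathrm{SO}(3)$ in the symmetric space of $\mathrm{SL}(3,\mathbb R)$. If $\rho\colon\Gamma_2\to \mathrm{SL}(3,\mathbb R)$ is a representation satisfying $|\rho(s)-s|_{Fr}\le 10^{-3698433}$ for all $s\in S'$, then $\rho$ is Anosov.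
   Context: $|A|_{Fr}=\sqrt{\mathrm{trace}(A^TA)}$ is the Frobenius norm. The symmetric space $\mathbb X=\mathrm{SL}(3,\mathbb R)/\mathrm{SO}(3)$ is identified with the real symmetric positive definite $3\times3$ matrices of determinant $1$, with the Riemannian metric induced by the Killing form (so at the basepoint $p=\mathrm{id}$ it is $6$ times the Frobenius inner product on traceless symmetric matrices). Hence $d(p,\gamma p)=\sqrt6\,\big|\log (\gamma\gamma^T)^{1/2}\big|_{Fr}$. Anosov: here Anosov is with respect to the minimal parabolic subgroup (Borel subgroup) of $\mathrm{SL}(3,\mathbb R)$. The characterization used is that of Kapovich--Leeb--Porti (Morse actions): a representation $\rho:\Gamma\to\mathrm{SL}(3,\mathbb R)$ of a word hyperbolic group is Anosov if, for a finite generating set of $\Gamma$, there are constants such that the orbit map $\gamma\mapsto \rho(\gamma) p$ into $\mathbb X$ sends every (discrete) geodesic of the Cayley graph to a uniform Morse quasigeodesic, i.e. a sequence $(x_n)$ for which there are uniform constants $c_1,c_2,c_3,c_4,D,\alpha_0>0$ with $\frac1{c_1}|N|-c_2\le d(x_n,x_{n+N})\le c_3|N|+c_4$ and such that for all $n\le m$ there is a diamond $\diamondsuit_{\alpha_0}(a,b)$ with $d(a,x_n),d(b,x_m)\le D$ and $d(x_i,\diamondsuit_{\alpha_0}(a,b))\le D$ for $n\le i\le m$. Here $\diamondsuit_{\alpha_0}(a,b)=V(a,\sigma_{ab},\alpha_0)\cap V(b,\sigma_{ba},\alpha_0)$, where $V(a,\sigma_{ab},\alpha_0)$ is the set of points on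 geodesic rays from $a$ with asymptotic direction in the ideal Weyl chamber $\sigma_{ab}$ determined by the regular segment $ab$ and on which all simple roots are at least $\alpha_0$ times the length. This is equivalent to the standard singular value gap definition: there are $C,c>0$ with $\log\frac{\sigma_i(\rho(\gamma))}{\sigma_{i+1}(\rho(\gamma))}\ge C\,|\gamma|-c$ for $i=1,2$ and all $\gamma\in\Gamma$, where $\sigma_1\ge\sigma_2\ge\sigma_3$ are singular values and $|\gamma|$ is word length. *)

(* Defs.v *)
From HB Require Import structures.
From mathcomp Require Import all_boot all_order all_algebra.
From mathcomp Require Import all_classical all_reals all_analysis.

Set Implicit Arguments.
Unset Strict Implicit.
Unset Printing Implicit Defensive.

Import Order.TTheory GRing.Theory Num.Theory.
Import numFieldNormedType.Exports.

Local Open Scope classical_set_scope.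
Local Open Scope ring_scope.

Section RealFunctions.
Variable R : realType.

Definition cosh (x : R) : R := (expR x + expR (- x)) / 2.

Definition acosh (x : R) : R := xget 0 [set y | 0 <= y /\ cosh y = x].

Definition cot (x : R) : R := cos x / sin x.

End RealFunctions.

Section Matrices.
Variable R : realType.
Implicit Types A P : 'M[R]_3.

Definition mx3 (a b c d e f g h i : R) : 'M[R]_3 :=
  \matrix_(k < 3, l < 3) nth 0 (nth [::] [:: [:: a; b; c];
                                             [:: d; e; f];
                                             [:: g; h; i]] k) l.

Definition SL3 : set 'M[R]_3 := [set A | \det A = 1].

Definition frobenius A : R := Num.sqrt (\tr (A^T *m A)).

Definition expmx A : 'M[R]_3 :=
  lim (series (fun k : nat => (k`!%:R)^-1 *: A ^+ k) @ \oo).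

Definition symmetric_mx : set 'M[R]_3 := [set A | A^T = A].

Definition posdef_mx : set 'M[R]_3 :=
  [set P | symmetric_mx P /\
           forall v : 'cV[R]_3, v != 0 -> 0 < (v^T *m P *m v) ord0 ord0].

(* On positive definite matrices, the unique positive definite square root and
   the unique symmetric logarithm. *)
Definition sqrtmx P : 'M[R]_3 := xget 0 [set Q | posdef_mx Q /\ Q *m Q = P].

Definition logmx P : 'M[R]_3 := xget 0 [set L | symmetric_mx L /\ expmx L = P].

End Matrices.

Arguments SL3 {R}.
Arguments symmetric_mx {R}.
Arguments posdef_mx {R}.

Section SymmetricSpace.
Variable R : realType.
Implicit Types (g h x y a b q : 'M[R]_3) (s : 'rV[R]_3).

Definition symspace : set 'M[R]_3 := [set x | posdef_mx x /\ \det x = 1].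

Definition basept : 'M[R]_3 := 1%:M.

Definition act g x : 'M[R]_3 := g *m x *m g^T.

(* The SL(3,R)-invariant extension of
   d(p, g p) = sqrt 6 * |log (g g^T)^{1/2}|_Fr: the isometry x^{-1/2} carries
   x to p and y to x^{-1/2} y x^{-1/2}. *)
Definition dist x y : R :=
  Num.sqrt 6 * frobenius (logmx (sqrtmx (act (invmx (sqrtmx x)) y))).

(* A row vector s of sum 0 stands for the element diag(s) of the maximal
   abelian subspace of traceless diagonal matrices. *)
Definition simple_root (i : 'I_2) s : R :=
  s ord0 (widen_ord (leqnSn 2) i) - s ord0 (lift ord0 i).

Definition weyl_chamber : set 'rV[R]_3 :=
  [set s : 'rV[R]_3 | \sum_(j < 3) s ord0 j = 0 /\
                      forall i, 0 <= simple_root i s].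

Definition regular_chamber : set 'rV[R]_3 :=
  [set s : 'rV[R]_3 | \sum_(j < 3) s ord0 j = 0 /\
                      forall i, 0 < simple_root i s].

(* Length of the tangent vector diag(s) at the basepoint. *)
Definition killing_norm s : R := Num.sqrt 6 * frobenius (diag_mx s).

(* t |-> h exp(t diag(s)) p: a geodesic issued from h p, of speed
   killing_norm s. *)
Definition chamber_ray h s (t : R) : 'M[R]_3 :=
  act (h *m expmx (t *: diag_mx s)) basept.

(* Every unit speed geodesic ray from a has this form: by the Cartan
   decomposition its direction can be conjugated into the closed Weyl
   chamber. *)
Definition unit_ray a h s : Prop :=
  [/\ SL3 h, act h basept = a, weyl_chamber s & killing_norm s = 1].

Definition asymptotic (c c' : R -> 'M[R]_3) : Prop :=
  exists C : R, forall t : R, 0 <= t -> dist (c t) (c' t) <= C.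

(* [in_ideal_chamber a b c]: the segment ab is regular and the unit speed ray c
   is asymptotic to a ray from a in the Euclidean Weyl chamber with tip a
   containing b, i.e. the ideal point of c lies in sigma_ab. *)
Definition in_ideal_chamber a b (c : R -> 'M[R]_3) : Prop :=
  exists h (beta s : 'rV[R]_3),
    [/\ regular_chamber beta, b = chamber_ray h beta 1,
        unit_ray a h s & asymptotic c (chamber_ray h s)].

(* V(a, sigma_ab, alpha0); the ray has unit speed, so the condition on its type
   s says that the simple roots are at least alpha0 times the length. *)
Definition weyl_cone (alpha0 : R) a b : set 'M[R]_3 :=
  [set q | exists h s (t : R),
    [/\ unit_ray a h s, in_ideal_chamber a b (chamber_ray h s),
        forall i, alpha0 <= simple_root i s, 0 <= t & q = chamber_ray h s t]].

Definition diamond (alpha0 : R) a b : set 'M[R]_3 :=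
  weyl_cone alpha0 a b `&` weyl_cone alpha0 b a.

Definition int_interval (I : set int) : Prop :=
  forall i j k : int, I i -> I k -> i <= j <= k -> I j.

Definition morse_quasigeodesic (c1 c2 c3 c4 D alpha0 : R) (I : set int)
    (x : int -> 'M[R]_3) : Prop :=
  (forall n N : int, I n -> I (n + N) ->
     c1^-1 * `|N|%:~R - c2 <= dist (x n) (x (n + N)) <= c3 * `|N|%:~R + c4) /\
  (forall n m : int, I n -> I m -> n <= m ->
     exists a b, [/\ symspace a, symspace b,
       dist a (x n) <= D, dist b (x m) <= D &
       forall i : int, n <= i <= m ->
         exists2 q, diamond alpha0 a b q & dist (x i) q <= D]).

End SymmetricSpace.

Section LinearGroups.
Variable R : realType.
Implicit Types (G : set 'M[R]_3) (S : seq 'M[R]_3) (rho : 'M[R]_3 -> 'M[R]_3).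

Definition is_subgroup G : Prop :=
  [/\ G `<=` SL3, G 1%:M,
      forall g h, G g -> G h -> G (g *m h) & forall g, G g -> G (invmx g)].

(* The subgroup of SL(3,R) generated by A, for A contained in SL(3,R). *)
Definition generated (A : set 'M[R]_3) : set 'M[R]_3 := smallest is_subgroup A.

Definition generates S G : Prop := [set` S] `<=` SL3 /\ generated [set` S] = G.

Definition is_word S (w : seq 'M[R]_3) (g : 'M[R]_3) : Prop :=
  (forall x, x \in w -> x \in S \/ invmx x \in S) /\
  g = \big[mulmx/1%:M]_(x <- w) x.

(* [word_length S g n]: the word length of g with respect to S is n. *)
Definition word_length S (g : 'M[R]_3) (n : nat) : Prop :=
  (exists2 w, is_word S w g & size w = n) /\
  (forall w, is_word S w g -> (n <= size w)%N).

(* Distance in the Cayley graph with edges g -- g s; it is invariant under left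
   multiplication. *)
Definition word_dist S (g h : 'M[R]_3) (n : nat) : Prop :=
  word_length S (invmx g *m h) n.

(* Gromov's four-point condition for the word metric. *)
Definition gromov_hyperbolic S G : Prop :=
  exists delta : nat, forall x y z w : 'M[R]_3, G x -> G y -> G z -> G w ->
    forall dxy dzw dxz dyw dxw dyz : nat,
      word_dist S x y dxy -> word_dist S z w dzw ->
      word_dist S x z dxz -> word_dist S y w dyw ->
      word_dist S x w dxw -> word_dist S y z dyz ->
      (dxy + dzw <= maxn (dxz + dyw) (dxw + dyz) + delta)%N.

Definition word_hyperbolic G : Prop :=
  exists2 S, generates S G & gromov_hyperbolic S G.

Definition cayley_geodesic S G (I : set int) (c : int -> 'M[R]_3) : Prop :=
  [/\ int_interval I, forall n, I n -> G (c n) &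
      forall n m, I n -> I m -> word_dist S (c n) (c m) `|n - m|%N].

(* A representation of G is given by a function on all matrices, of which only
   the restriction to G is used. *)
Definition representation G rho : Prop :=
  (forall g, G g -> SL3 (rho g)) /\
  (forall g h, G g -> G h -> rho (g *m h) = rho g *m rho h).

(* Finite, infinite and bi-infinite Cayley geodesics are all considered, with
   uniform constants. *)
Definition anosov G rho : Prop :=
  word_hyperbolic G /\
  exists2 S, generates S G &
    exists c1 c2 c3 c4 D alpha0 : R,
      [/\ 0 < c1, 0 < c2, 0 < c3 & 0 < c4] /\ 0 < D /\ 0 < alpha0 /\
      forall I c, cayley_geodesic S G I c ->
        morse_quasigeodesic c1 c2 c3 c4 D alpha0 I
          (fun n => act (rho (c n)) (basept R)).

End LinearGroups.

Section GenusTwo.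
Variable R : realType.

Definition gen_mx (lambda theta : R) : 'M[R]_3 :=
  mx3 (cos theta) 0 (sin theta)
      0 1 0
      (- sin theta) 0 (cos theta) *m
  mx3 lambda 0 0
      0 1 0
      0 0 lambda^-1 *m
  mx3 (cos theta) 0 (- sin theta)
      0 1 0
      (sin theta) 0 (cos theta).

Definition Gamma2 (lambda : R) : set 'M[R]_3 :=
  generated [set gen_mx lambda theta |
             theta in [set 0; pi / 8; pi / 4; 3 * pi / 8]].

Definition S' (lambda : R) : set 'M[R]_3 :=
  [set g | Gamma2 lambda g /\
           dist (basept R) (act g (basept R)) <= 95 / 10].

End GenusTwo.

(* Main.v *)
(* Gamma_2 lies in a copy of SL(2,R), acting on the coordinates 1 and 3, and
   preserves a hyperbolic plane. The four generators carry that plane around a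
   regular octagon, so that any element of large norm is shortened by a definite
   factor by one of the eight side pairings; and Gamma_2 is discrete, because its
   matrices have entries built from Z[sqrt 2], with the Galois conjugates bounded
   by the compact conjugate form. Hence a finite ball S generates Gamma_2, word
   length is comparable with the logarithm of the norm, and the four-point
   inequality of the norm makes Gamma_2 word hyperbolic.

   Along a geodesic of the Cayley graph over the large set S, consecutive blocks
   of length two are matrices g of norm at least 200 whose products do not
   cancel. Each block diag(g, 1) expands the cone around the plane of coordinates
   1 and 3 in a suitable orbit by a factor 100, contracts another one, and fixes
   the middle coordinate. These cone estimates survive a small perturbation, so
   that the perturbed product has a frame of three vector orbits growing at rates
   at least 50, about 1, and at most 1/50. Normalised to determinant 1, the frame
   is a matrix h, and the logarithms of the lengths of the three orbits are the
   coordinates of points in the flat h exp(a) p, which shadow the orbit and lie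
   in a diamond of that flat.

   The perturbation is controlled on S alone: by the shortening step an element
   of S is a product of at most 1568 elements of S', and the error grows at most
   by a factor 20 per factor. *)

Require Import Defs.
From mathcomp Require Import all_boot all_order all_algebra.
From mathcomp Require Import complex.
From mathcomp Require Import all_classical all_reals all_analysis.
From mathcomp Require Import ring lra zify.

Set Implicit Arguments.
Unset Strict Implicit.
Unset Printing Implicit Defensive.

Import Order.TTheory GRing.Theory Num.Theory.
Import numFieldNormedType.Exports.

Local Open Scope classical_set_scope.
Local Open Scope ring_scope.

(** Closeness of [rho] to the inclusion is known only on bounded elements, and errors of long
    products cannot be controlled; a cone turns closeness of each block into growth of the whole
    product. The middle line is neither the most expanded nor the most contracted one, so no cone
    finds it: it is obtained as the cross product of two orbits of the inverse transposed chain. One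
    letter, of norm at most [Lam], shortens a longer element by the factor [Lam / 140]. Hence two
    steps of a geodesic have norm above [Lam] (and at most K = Lam^2), four steps have norm above
    Lam^3 / 140^2, and Lam >= 140^2 * 400 makes the latter exceed 200 K. A slope and a perturbation
    of 1 / (400 K) are then admissible for the cones. Word length is comparable to the logarithm of
    the norm only up to a factor, which does not preserve a four-point inequality. So geodesic words
    are shown to be thin for the norm; two of them that join the farthest pairs pass near each
    other, and exchanging their tails there gives the inequality for words. *)

Section Frobenius.
Variable R : realType.

(** Lagrange's identity: the double sum of squared minors is twice the difference of the two
    sides. *)
Lemma sum_cauchy_schwarz (I : finType) (a b : I -> R) :
  (\sum_i a i * b i) ^+ 2 <= (\sum_i a i ^+ 2) * (\sum_i b i ^+ 2).
Proof.
have h : 0 <= \sum_i \sum_j (a i * b j - a j * b i) ^+ 2.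
  by apply: sumr_ge0 => i _; apply: sumr_ge0 => j _; exact: sqr_ge0.
have e : \sum_i \sum_j (a i * b j - a j * b i) ^+ 2 =
   ((\sum_i a i ^+ 2) * (\sum_i b i ^+ 2) - (\sum_i a i * b i) ^+ 2) *+ 2.
  under eq_bigr => i _.
    under eq_bigr => j _.
      rewrite (_ : _ ^+ 2 = a i ^+ 2 * b j ^+ 2 + a j ^+ 2 * b i ^+ 2
                            - 2 * (a i * b i) * (a j * b j)); last by ring.
      over.
    rewrite big_split big_split /= -mulr_sumr -mulr_suml sumrN -mulr_sumr.
    over.
  rewrite big_split big_split /= -mulr_suml -mulr_sumr sumrN -mulr_suml.
  rewrite -mulr_sumr; ring.
move: h; rewrite e pmulrn_lge0 // => h; lra.
Qed.

(** Agrees with [frobenius] on 3x3 matrices ([frobeniusE]), but also measures vectors and 2x2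
    blocks. *)
Definition fro m n (A : 'M[R]_(m, n)) : R :=
  Num.sqrt (\sum_i \sum_j A i j ^+ 2).

Lemma fro_sqr m n (A : 'M[R]_(m, n)) : fro A ^+ 2 = \sum_i \sum_j A i j ^+ 2.
Proof.
rewrite /fro sqr_sqrtr //.
by apply: sumr_ge0 => i _; apply: sumr_ge0 => j _; exact: sqr_ge0.
Qed.

Lemma fro_ge0 m n (A : 'M[R]_(m, n)) : 0 <= fro A.
Proof. exact: sqrtr_ge0. Qed.

Lemma frobeniusE (A : 'M[R]_3) : frobenius A = fro A.
Proof.
rewrite /frobenius /fro /mxtrace; congr Num.sqrt.
rewrite exchange_big; apply: eq_bigr => i _; rewrite mxE.
by apply: eq_bigr => j _; rewrite mxE expr2.
Qed.

Lemma fro_trmx m n (A : 'M[R]_(m, n)) : fro A^T = fro A.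
Proof.
rewrite /fro exchange_big; congr Num.sqrt.
by apply: eq_bigr => i _; apply: eq_bigr => j _; rewrite mxE.
Qed.

Lemma mxtrace_mul_tr m n (A : 'M[R]_(m, n)) : \tr (A *m A^T) = fro A ^+ 2.
Proof.
rewrite fro_sqr /mxtrace; apply: eq_bigr => i _; rewrite mxE.
by apply: eq_bigr => j _; rewrite mxE expr2.
Qed.

Lemma froZ m n a (A : 'M[R]_(m, n)) : fro (a *: A) = `|a| * fro A.
Proof.
rewrite -[LHS]ger0_norm ?fro_ge0 // -[X in _ * X]ger0_norm ?fro_ge0 // -normrM.
apply/eqP; rewrite -(@eqrXn2 _ 2) ?mulr_ge0 ?normr_ge0 // !real_normK ?num_real // exprMn.
rewrite !fro_sqr mulr_sumr; apply/eqP/eq_bigr => i _.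
by rewrite mulr_sumr; apply: eq_bigr => j _; rewrite mxE exprMn.
Qed.

Lemma froN m n (A : 'M[R]_(m, n)) : fro (- A) = fro A.
Proof. by rewrite -scaleN1r froZ normrN normr1 mul1r. Qed.

Lemma fro0 m n : fro (0 : 'M[R]_(m, n)) = 0.
Proof. by rewrite -(scale0r (0 : 'M[R]_(m, n))) froZ normr0 mul0r. Qed.

Lemma fro_entry m n (A : 'M[R]_(m, n)) i j : `|A i j| <= fro A.
Proof.
rewrite -ler_sqr ?nnegrE ?fro_ge0 // real_normK ?num_real // fro_sqr.
rewrite (bigD1 i) //= (bigD1 j) //= -addrA lerDl addr_ge0 //.
  by apply: sumr_ge0 => k _; exact: sqr_ge0.
by apply: sumr_ge0 => k _; apply: sumr_ge0 => l _; exact: sqr_ge0.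
Qed.

Lemma fro_eq0 m n (A : 'M[R]_(m, n)) : fro A = 0 -> A = 0.
Proof.
move=> A0; apply/matrixP => i j; rewrite mxE; apply/eqP.
by rewrite -normr_le0 -A0 fro_entry.
Qed.

Lemma fro_gt0 m n (A : 'M[R]_(m, n)) : A != 0 -> 0 < fro A.
Proof.
move=> A0; rewrite lt_def fro_ge0 andbT.
by apply: contra_neq A0 => /fro_eq0.
Qed.

Lemma fro_dot m n (A B : 'M[R]_(m, n)) :
  `|\sum_i \sum_j A i j * B i j| <= fro A * fro B.
Proof.
rewrite -ler_sqr ?nnegrE ?mulr_ge0 ?fro_ge0 // real_normK ?num_real //.
by rewrite exprMn !fro_sqr !pair_big /= sum_cauchy_schwarz.
Qed.

Lemma fro_add m n (A B : 'M[R]_(m, n)) : fro (A + B) <= fro A + fro B.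
Proof.
rewrite -ler_sqr ?nnegrE ?addr_ge0 ?fro_ge0 // sqrrD !fro_sqr.
have -> : \sum_i \sum_j (A + B) i j ^+ 2 = \sum_i \sum_j A i j ^+ 2 +
   (\sum_i \sum_j A i j * B i j) *+ 2 + \sum_i \sum_j B i j ^+ 2.
  rewrite -sumrMnl -!big_split /=; apply: eq_bigr => i _.
  by rewrite -sumrMnl -!big_split /=; apply: eq_bigr => j _; rewrite mxE sqrrD.
by rewrite lerD2r lerD2l lerMn2r orbC (le_trans (ler_norm _) (fro_dot _ _)).
Qed.

Lemma fro_sub m n (A B : 'M[R]_(m, n)) : fro A - fro B <= fro (A - B).
Proof. by have := fro_add (A - B) B; rewrite subrK; lra. Qed.

Lemma fro_mul m n p (A : 'M[R]_(m, n)) (B : 'M[R]_(n, p)) :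
  fro (A *m B) <= fro A * fro B.
Proof.
rewrite -ler_sqr ?nnegrE ?mulr_ge0 ?fro_ge0 // exprMn !fro_sqr.
rewrite mulr_suml; apply: ler_sum => i _.
rewrite [X in _ * X]exchange_big mulr_sumr; apply: ler_sum => j _.
by rewrite mxE sum_cauchy_schwarz.
Qed.

Lemma fro_le_sum m n (A : 'M[R]_(m, n)) : fro A <= \sum_i \sum_j `|A i j|.
Proof.
rewrite -ler_sqr ?nnegrE ?fro_ge0 //; last first.
  by apply: sumr_ge0 => i _; apply: sumr_ge0.
rewrite fro_sqr !pair_big /=.
suff : 0 <= \sum_p `|A p.1 p.2| /\
    \sum_p A p.1 p.2 ^+ 2 <= (\sum_p `|A p.1 p.2|) ^+ 2 by case.
elim/big_ind2 : _ => [|x a y b [a0 xa] [b0 yb]|i _].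
- by rewrite expr0n.
- by split; [exact: addr_ge0 | nra].
- by rewrite real_normK ?num_real.
Qed.

Lemma fro_mulmx_tr p m n (U : 'M[R]_(p, m)) (A : 'M[R]_(m, n)) :
  U^T *m U = 1%:M -> fro (U *m A) = fro A.
Proof.
move=> UU; apply/eqP; rewrite -(@eqrXn2 _ 2) ?fro_ge0 // -!mxtrace_mul_tr.
by rewrite trmx_mul -mulmxA mxtrace_mulC -!mulmxA UU mulmx1.
Qed.

End Frobenius.

(** * The spectral theorem for real symmetric matrices *)

Section Spectral.
Variable R : realType.

Lemma ReM_real (w : R[i]) (r : R) :
  complex.Re (w * (real_complex R r)) = complex.Re w * r.
Proof. by case: w => p q /=; ring. Qed.

Lemma ImM_real (w : R[i]) (r : R) :
  complex.Im (w * (real_complex R r)) = complex.Im w * r.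
Proof. by case: w => p q /=; ring. Qed.

Lemma ReM_complex (z w : R[i]) : complex.Re (z * w) =
  complex.Re z * complex.Re w - complex.Im z * complex.Im w.
Proof. by case: z; case: w. Qed.

Lemma ImM_complex (z w : R[i]) : complex.Im (z * w) =
  complex.Re z * complex.Im w + complex.Im z * complex.Re w.
Proof. by case: z => a b; case: w => p q /=; ring. Qed.

Lemma Re_sum n (F : 'I_n -> R[i]) :
  complex.Re (\sum_j F j) = \sum_j complex.Re (F j).
Proof. by apply: (big_morph (@complex.Re R)) => // -[? ?] [? ?]. Qed.

Lemma Im_sum n (F : 'I_n -> R[i]) :
  complex.Im (\sum_j F j) = \sum_j complex.Im (F j).
Proof. by apply: (big_morph (@complex.Im R)) => // -[? ?] [? ?]. Qed.

Lemma real_poly_complex_eigenvalue n (A : 'M[R]_n.+1) :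
  exists2 z, root (map_poly (real_complex R) (char_poly A)) z &
  eigenvalue (map_mx (real_complex R) A) z.
Proof.
have [z rz] : exists z, root (char_poly (map_mx (real_complex R) A)) z.
  by apply/closed_rootP; rewrite size_char_poly.
by exists z; rewrite ?eigenvalue_root_char // map_char_poly.
Qed.

(** If x + iy is a complex eigenvector for a + ib, computing x^T A y in two ways by symmetry gives b
    (|x|^2 + |y|^2) = 0, so the eigenvalue is real. *)
Lemma symmetric_eigenvalue n (A : 'M[R]_n.+1) :
  A^T = A -> exists a, eigenvalue A a.
Proof.
move=> sA; have [z rz /eigenvalueP [v vA v0]] := real_poly_complex_eigenvalue A.
have key k : \sum_j v ord0 j * (real_complex R (A j k)) = z * v ord0 k.
  move/matrixP: vA => /(_ ord0 k); rewrite !mxE => <-.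
  by apply: eq_bigr => j _; rewrite !mxE.
pose x i := complex.Re (v ord0 i); pose y i := complex.Im (v ord0 i).
pose a := complex.Re z; pose b := complex.Im z.
have kx k : \sum_j x j * A j k = a * x k - b * y k.
  rewrite /x /y -ReM_complex -key Re_sum; apply: eq_bigr => j _.
  by rewrite ReM_real.
have ky k : \sum_j y j * A j k = a * y k + b * x k.
  rewrite /x /y -ImM_complex -key Im_sum; apply: eq_bigr => j _.
  by rewrite ImM_real.
have e : \sum_k (\sum_j x j * A j k) * y k = \sum_k (\sum_j y j * A j k) * x k.
  under eq_bigr do rewrite mulr_suml.
  rewrite exchange_big; apply: eq_bigr => k _; rewrite mulr_suml.
  apply: eq_bigr => j _.
  have -> : A k j = A j k by rewrite -[in LHS]sA mxE.
  move: (A j k) (x j) (y j) (x k) (y k) => p1 p2 p3 p4 p5; ring.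
have {}e : b * \sum_k (x k ^+ 2 + y k ^+ 2) = 0.
  rewrite mulr_sumr.
  rewrite (_ : \sum_k _ = \sum_k ((\sum_j y j * A j k) * x k) -
      \sum_k ((\sum_j x j * A j k) * y k)); last first.
    rewrite -sumrB; apply: eq_bigr => k _; rewrite kx ky.
    have h4 (p q r t : R) :
        t * (p ^+ 2 + q ^+ 2) = (r * q + t * p) * p - (r * p - t * q) * q by ring.
    exact: h4.
  by rewrite e subrr.
have b0 : b = 0.
  move/eqP: e; rewrite mulf_eq0 => /orP [/eqP //|].
  rewrite psumr_eq0 => [|k _]; last by rewrite addr_ge0 // sqr_ge0.
  move=> /allP h; case/negP: v0; apply/eqP/rowP => k; rewrite mxE.
  have := h k; rewrite mem_index_enum => /(_ isT).
  rewrite implyTb paddr_eq0 ?sqr_ge0 // !sqrf_eq0 => /andP [/eqP h1 /eqP h2].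
  by apply/eqP; rewrite eq_complex /= -/(x k) -/(y k) h1 h2 eqxx.
exists a; rewrite eigenvalue_root_char -(fmorph_root (real_complex R)).
suff h : z = real_complex R a by move: rz; rewrite h.
by apply/eqP; rewrite eq_complex /= -/a -/b b0 !eqxx.
Qed.

(* A Householder reflection carries the first basis vector to [v]. *)
Lemma orthogonal_first_row n (v : 'rV[R]_n.+1) : v *m v^T = 1%:M ->
  exists2 U : 'M[R]_n.+1, U *m U^T = 1%:M & row 0 U = v.
Proof.
move=> v1; pose e : 'rV[R]_n.+1 := delta_mx 0 0.
have [ve|ve] := eqVneq v e.
  exists 1%:M; first by rewrite trmx1 mulmx1.
  by rewrite row1 ve.
have ee : e *m e^T = 1%:M.
  apply/matrixP => i j; rewrite !ord1 mxE (bigD1 0) //= big1 => [|k k0].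
    by rewrite !mxE /= mulr1 addr0.
  by rewrite !mxE (negPf k0) andbF mulr0.
pose w := v - e.
have [c vec] : exists c, v *m e^T = c%:M.
  by exists ((v *m e^T) 0 0); rewrite [LHS]mx11_scalar.
have evc : e *m v^T = c%:M.
  by rewrite -[LHS]trmxK trmx_mul trmxK vec tr_scalar_mx.
have ww : w *m w^T = (2 - 2 * c)%:M.
  rewrite /w linearB /= mulmxBl !mulmxBr v1 ee vec evc.
  by rewrite -!raddfB /=; congr _%:M; ring.
have d0 : 2 - 2 * c != 0.
  apply: contra_neq ve => d0; apply/eqP; rewrite -subr_eq0; apply/eqP.
  apply: fro_eq0; apply/eqP; rewrite -sqrf_eq0 -mxtrace_mul_tr.
  by rewrite -/w ww d0 mxtrace_scalar mul0rn.
have c1 : c - 1 = - (2 - 2 * c) / 2 by field.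
pose U : 'M[R]_n.+1 := 1%:M - (2 / (2 - 2 * c)) *: (w^T *m w).
have Os : U^T = U.
  by rewrite /U linearB /= trmx1 linearZ /= trmx_mul trmxK.
exists U.
  have WW : (w^T *m w) *m (w^T *m w) = (2 - 2 * c) *: (w^T *m w).
    by rewrite mulmxA -(mulmxA _ w) ww mul_mx_scalar scalemxAl.
  rewrite Os /U mulmxBr mulmx1 mulmxBl mul1mx -scalemxAl -scalemxAr WW !scalerA.
  rewrite -scalerBl -[LHS]addrA -opprD -scalerDl -[RHS]subr0; congr (_ - _).
  by rewrite -[RHS](scale0r (w^T *m w)); congr (_ *: _); field.
rewrite rowE -/e /U mulmxBr mulmx1 -scalemxAr mulmxA.
have -> : e *m w^T = (c - 1)%:M.
  by rewrite /w linearB /= mulmxBr evc ee raddfB.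
rewrite mul_scalar_mx scalerA c1.
have -> : 2 / (2 - 2 * c) * (- (2 - 2 * c) / 2) = -1 by field.
by rewrite scaleN1r opprK /w addrC subrK.
Qed.

(** An orthogonal matrix whose first row is a unit eigenvector splits off a 1x1 block; symmetry
    clears the rest of the first row and column. *)
Lemma symmetric_diagonalizable n (A : 'M[R]_n) : A^T = A ->
  exists (U : 'M[R]_n) (d : 'rV[R]_n),
    U^T *m U = 1%:M /\ A = U *m diag_mx d *m U^T.
Proof.
elim: n A => [A _|n IH A sA].
  by exists 1%:M, 0; split; apply/matrixP => -[].
have [a /eigenvalueP [v0 v0A v00]] := symmetric_eigenvalue sA.
pose v := (fro v0)^-1 *: v0.
have vA : v *m A = a *: v by rewrite /v -scalemxAl v0A !scalerA mulrC.
have v1 : v *m v^T = 1%:M.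
  rewrite [LHS]mx11_scalar; congr _%:M.
  rewrite -[LHS]mulr1n -[LHS]mxtrace_scalar -mx11_scalar mxtrace_mul_tr.
  by rewrite /v froZ ger0_norm ?invr_ge0 ?fro_ge0 // mulVf ?expr1n // gt_eqF ?fro_gt0.
have [U HO Ov] := orthogonal_first_row v1.
have OtO : U^T *m U = 1%:M by apply: mulmx1C.
have [B BE] : exists B : 'M[R]_(1 + n), B = U *m A *m U^T by eexists.
have sB : B^T = B by rewrite BE !trmx_mul trmxK sA mulmxA.
have B0 : row 0 B = a *: delta_mx 0 0.
  rewrite BE !row_mul Ov vA -scalemxAl -Ov; congr (_ *: _).
  by rewrite -row_mul HO row1.
have {}B0 k : B 0 k = a * (k == 0)%:R.
  by move/rowP: B0 => /(_ k); rewrite !mxE eqxx.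
have Bul : ulsubmx B = a%:M.
  apply/matrixP => i j; rewrite !ord1 !mxE /= mulr1n -[RHS]mulr1.
  by rewrite -(B0 0); congr (B _ _); apply/val_inj.
have Bur : ursubmx B = 0.
  apply/matrixP => i j; rewrite !ord1 !mxE /= -[RHS](mulr0 a).
  by rewrite -(B0 (rshift 1 j)); congr (B _ _); apply/val_inj.
have Bdl : dlsubmx B = 0.
  by rewrite -[B]sB -trmx_ursub Bur trmx0.
have [|U1 [d [HO1 Bdr]]] := IH (drsubmx B).
  by rewrite trmx_drsub sB.
pose P : 'M[R]_(1 + n) := block_mx 1%:M 0 0 U1.
have HP : P^T *m P = 1%:M.
  rewrite /P tr_block_mx mulmx_block !trmx0 trmx1 !(mul0mx, mulmx0, mulmx1).
  by rewrite addr0 !add0r HO1 -scalar_mx_block.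
have key : B = P *m diag_mx (row_mx a%:M d) *m P^T.
  rewrite -[LHS]submxK Bul Bur Bdl Bdr /P.
  rewrite diag_mx_row tr_block_mx !mulmx_block !trmx0 trmx1.
  rewrite !(mul0mx, mulmx0, mulmx1, mul1mx, addr0, add0r).
  by congr block_mx; apply/matrixP => i j; rewrite !ord1 !mxE eqxx.
exists (U^T *m P), (row_mx a%:M d); split.
  by rewrite trmx_mul trmxK mulmxA -(mulmxA P^T) HO mulmx1.
have -> : A = U^T *m B *m U.
  by rewrite BE !mulmxA OtO mul1mx -mulmxA OtO mulmx1.
by rewrite key trmx_mul trmxK !mulmxA.
Qed.

End Spectral.

(** * Distances and flats in the symmetric space *)

Section ExpLog.
Variable R : realType.

Lemma cvg_mx_entries m n (f : nat -> 'M[R]_(m, n)) (M : 'M[R]_(m, n)) :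
  (forall i j, f k i j @[k --> \oo] --> M i j) -> f @ \oo --> M.
Proof.
move=> fM A [P MP PA].
have : \forall k \near \oo, forall i j, P i j (f k i j).
  by apply: filter_forall => i; apply: filter_forall => j; exact: fM.
by apply: filterS => k; exact: PA.
Qed.

Lemma cvg_sum_ord n (f : 'I_n -> nat -> R) (a : 'I_n -> R) :
  (forall l, f l k @[k --> \oo] --> a l) ->
  (\sum_l f l k) @[k --> \oo] --> \sum_l a l.
Proof.
elim: n f a => [|n IH] f a fa.
  by under eq_fun do rewrite big_ord0; rewrite big_ord0; exact: cvg_cst.
under eq_fun do rewrite big_ord_recl; rewrite big_ord_recl.
by apply: cvgD; [exact: fa | exact: IH].
Qed.

Lemma conj_diag_exp (U : 'M[R]_3) (d : 'rV[R]_3) k :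
  U^T *m U = 1%:M -> (U *m diag_mx d *m U^T) ^+ k =
  U *m diag_mx (map_mx (fun x => x ^+ k) d) *m U^T.
Proof.
move=> UU; elim: k => [|k IH].
  rewrite expr0 (_ : diag_mx _ = 1%:M) ?mulmx1 ?(mulmx1C UU) //.
  by apply/matrixP => i j; rewrite !mxE expr0.
rewrite exprS IH -[LHS]/(_ *m _) !mulmxA -(mulmxA _ U^T) UU mulmx1.
rewrite -(mulmxA U) mulmx_diag; congr (_ *m diag_mx _ *m _).
by apply/rowP => j; rewrite !mxE exprS.
Qed.

Lemma expmx_conj_diag (U : 'M[R]_3) (d : 'rV[R]_3) : U^T *m U = 1%:M ->
  expmx (U *m diag_mx d *m U^T) = U *m diag_mx (map_mx expR d) *m U^T.
Proof.
move=> UU; apply: cvg_lim; first exact: norm_hausdorff.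
apply: cvg_mx_entries => i j.
have -> : (fun k => series (fun k0 : nat =>
    (k0`!%:R)^-1 *: (U *m diag_mx d *m U^T) ^+ k0) k i j) =
    (fun k => \sum_l U i l * series (exp_coeff (d 0 l)) k * U j l).
  apply/funext => k; rewrite /series /= summxE.
  under [LHS]eq_bigr => q _.
    rewrite !mxE conj_diag_exp // !mxE.
    under eq_bigr => l _ do rewrite mul_mx_diag !mxE.
    rewrite mulr_sumr; over.
  rewrite exchange_big; apply: eq_bigr => l _.
  rewrite mulr_sumr mulr_suml; apply: eq_bigr => q _.
  by rewrite exp_coeffE /=; ring.
rewrite !mxE; apply: cvg_sum_ord => l; rewrite mul_mx_diag !mxE.
apply: cvgM; last exact: cvg_cst.
by apply: cvgM; [exact: cvg_cst | exact: is_cvg_series_exp_coeff].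
Qed.

Lemma expmx_diag (d : 'rV[R]_3) : expmx (diag_mx d) = diag_mx (map_mx expR d).
Proof.
have := @expmx_conj_diag 1%:M d; rewrite trmx1 !mulmx1 !mul1mx; exact.
Qed.

Lemma posdef_conj_diag (U : 'M[R]_3) (d : 'rV[R]_3) : U^T *m U = 1%:M ->
  (forall i, 0 < d 0 i) -> posdef_mx (U *m diag_mx d *m U^T).
Proof.
move=> UU d0; split=> [|v v0].
  by rewrite /symmetric_mx /= !trmx_mul trmxK tr_diag_mx mulmxA.
have [w wE] : exists w, w = U^T *m v by eexists.
have w0 : w != 0.
  apply: contra_neq v0 => w0.
  by rewrite -[v]mul1mx -(mulmx1C UU) -mulmxA -wE w0 mulmx0.
rewrite (_ : _ *m v = w^T *m diag_mx d *m w); last first.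
  by rewrite wE trmx_mul trmxK !mulmxA.
rewrite mul_mx_diag mxE.
have ge i : 0 <= (\matrix_(i, j) (w^T i j * d 0 j)) 0 i * w i 0.
  by rewrite !mxE mulrAC mulr_ge0 ?(ltW (d0 i)) // -expr2 sqr_ge0.
rewrite lt_def sumr_ge0 ?andbT // psumr_eq0 //.
apply: contra w0 => /allP h; apply/eqP/colP => i.
have := h i; rewrite mem_index_enum => /(_ isT) /=.
rewrite !mxE !mulf_eq0 (gt_eqF (d0 i)) orbF orbb => /eqP ->.
by [].
Qed.

Lemma posdef_diagonalize (P : 'M[R]_3) : posdef_mx P ->
  exists (U : 'M[R]_3) (d : 'rV[R]_3),
  [/\ U^T *m U = 1%:M, forall i, 0 < d 0 i & P = U *m diag_mx d *m U^T].
Proof.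
move=> [sP pP]; have [U [d [UU PE]]] := symmetric_diagonalizable sP.
exists U, d; split=> // i.
have e0 : U *m delta_mx i 0 != 0 :> 'cV[R]_3.
  apply: contraTneq isT => e0.
  have : U^T *m (U *m delta_mx i 0) = 0 :> 'cV[R]_3 by rewrite e0 mulmx0.
  rewrite mulmxA UU mul1mx => /colP /(_ i); rewrite !mxE !eqxx /= => /eqP.
  by rewrite oner_eq0.
have := pP _ e0.
rewrite PE trmx_mul !mulmxA -(mulmxA _ U^T U) UU mulmx1 -(mulmxA _ U^T U) UU mulmx1.
by rewrite trmx_delta -rowE row_diag_mx -scalemxAl mul_delta_mx mxE mxE !eqxx mulr1.
Qed.

Lemma sqrtmxP (P : 'M[R]_3) : posdef_mx P ->
  posdef_mx (sqrtmx P) /\ sqrtmx P *m sqrtmx P = P.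
Proof.
move=> /posdef_diagonalize [U [d [UU d0 PE]]].
suff : exists Q, posdef_mx Q /\ Q *m Q = P by move/xgetPex; exact.
exists (U *m diag_mx (map_mx Num.sqrt d) *m U^T); split.
  by apply: posdef_conj_diag => // i; rewrite mxE sqrtr_gt0.
rewrite !mulmxA -(mulmxA _ U^T) UU mulmx1 -(mulmxA U) mulmx_diag PE.
congr (_ *m diag_mx _ *m _); apply/rowP => j.
by rewrite !mxE -expr2 sqr_sqrtr // ltW.
Qed.

Lemma logmxP (Q : 'M[R]_3) : posdef_mx Q ->
  symmetric_mx (logmx Q) /\ expmx (logmx Q) = Q.
Proof.
move=> /posdef_diagonalize [U [d [UU d0 QE]]].
suff : exists L, symmetric_mx L /\ expmx L = Q by move/xgetPex; exact.
exists (U *m diag_mx (map_mx (@ln R) d) *m U^T); split.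
  by rewrite /symmetric_mx /= !trmx_mul trmxK tr_diag_mx mulmxA.
rewrite expmx_conj_diag // QE; congr (_ *m diag_mx _ *m _).
by apply/rowP => j; rewrite !mxE lnK // posrE.
Qed.

Lemma mulmx1_invmx n (A B : 'M[R]_n) : A *m B = 1%:M -> invmx A = B.
Proof.
by move=> AB; have [uA _] := mulmx1_unit AB; rewrite -[B](mulKmx uA) AB mulmx1.
Qed.

Lemma invmxM n (A B : 'M[R]_n) : A \in unitmx -> B \in unitmx ->
  invmx (A *m B) = invmx B *m invmx A.
Proof.
move=> uA uB; apply: mulmx1_invmx.
by rewrite mulmxA -(mulmxA A) mulmxV // mulmx1 mulmxV.
Qed.

Lemma SL3_unit (A : 'M[R]_3) : SL3 A -> A \in unitmx.
Proof. by move=> dA; rewrite unitmxE dA unitr1. Qed.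

Lemma SL3_mul (A B : 'M[R]_3) : SL3 A -> SL3 B -> SL3 (A *m B).
Proof. by rewrite /SL3 /= det_mulmx => -> ->; rewrite mulr1. Qed.

Lemma SL3_inv (A : 'M[R]_3) : SL3 A -> SL3 (invmx A).
Proof. by rewrite /SL3 /= det_inv => ->; rewrite invr1. Qed.

Lemma posdef_mul_tr (A : 'M[R]_3) : A \in unitmx -> posdef_mx (A *m A^T).
Proof.
move=> uA; split=> [|v v0]; first by rewrite /symmetric_mx /= trmx_mul trmxK.
have w0 : v^T *m A != 0.
  apply: contra_neq v0 => w0.
  by rewrite -[v]trmxK -[v^T](mulmxK uA) w0 mul0mx trmx0.
rewrite (_ : _ *m v = (v^T *m A) *m (v^T *m A)^T); last first.
  by rewrite trmx_mul trmxK !mulmxA.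
rewrite -[X in 0 < X]mulr1n -[X in 0 < X](@mxtrace_scalar _ 1) -mx11_scalar.
by rewrite mxtrace_mul_tr exprn_gt0 // fro_gt0.
Qed.

Lemma act1 (A : 'M[R]_3) : act A (basept R) = A *m A^T.
Proof. by rewrite /act /basept mulmx1. Qed.

Lemma symspace_act (A : 'M[R]_3) : SL3 A -> symspace (act A (basept R)).
Proof.
move=> sA; rewrite act1; split; first exact/posdef_mul_tr/SL3_unit.
by rewrite det_mulmx det_tr sA mulr1.
Qed.

(* The [l i] are the logarithms of the singular values of [A^-1 C]. *)
Lemma dist_singular_values (A C : 'M[R]_3) : SL3 A -> SL3 C ->
  exists l : 'I_3 -> R,
  [/\ dist (act A (basept R)) (act C (basept R)) =
        Num.sqrt 6 * Num.sqrt (\sum_i l i ^+ 2),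
      fro (invmx A *m C) ^+ 2 = \sum_i expR (2 * l i),
      fro (invmx C *m A) ^+ 2 = \sum_i expR (- (2 * l i)) &
      \sum_i l i = 0].
Proof.
move=> sA sC; have uA := SL3_unit sA; have uC := SL3_unit sC.
rewrite /dist !act1.
move: (sqrtmxP (posdef_mul_tr uA)); move: (sqrtmx (A *m A^T)) => X [[sX _] XX].
have dX : \det X ^+ 2 = 1.
  by rewrite expr2 -det_mulmx XX det_mulmx det_tr sA mulr1.
have uX : X \in unitmx.
  rewrite unitmxE unitfE; apply/eqP => d0; move: dX; rewrite d0 expr0n => /eqP.
  by rewrite eq_sym oner_eq0.
pose Z := invmx X *m C.
have uZ : Z \in unitmx by rewrite unitmx_mul unitmx_inv uX.
have -> : act (invmx X) (C *m C^T) = Z *m Z^T.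
  by rewrite /act /Z trmx_mul !mulmxA.
move: (sqrtmxP (posdef_mul_tr uZ)); move: (sqrtmx (Z *m Z^T)) => Q [pQ QQ].
move: (logmxP pQ); move: (logmx Q) => L [sL expL].
have [U [d [UU LE]]] := symmetric_diagonalizable sL.
have UU1 := mulmx1C UU.
move: expL; rewrite LE expmx_conj_diag // => QE.
have ZE : Z *m Z^T = U *m diag_mx (map_mx (fun x => expR (2 * x)) d) *m U^T.
  rewrite -QQ -QE !mulmxA -(mulmxA _ U^T) UU mulmx1 -(mulmxA U) mulmx_diag.
  congr (_ *m diag_mx _ *m _); apply/rowP => j.
  by rewrite !mxE -expRD; congr expR; ring.
have invXX : invmx X *m invmx X = (invmx A)^T *m invmx A.
  by rewrite -invmxM // XX invmxM ?unitmx_tr // trmx_inv.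
exists (fun i => d 0 i); split.
- rewrite frobeniusE -mulmxA fro_mulmx_tr // -fro_trmx trmx_mul trmxK.
  rewrite fro_mulmx_tr // fro_trmx /fro; congr (_ * Num.sqrt _).
  apply: eq_bigr => i _; rewrite (bigD1 i) //= big1 ?addr0 => [|j ji].
    by rewrite mxE eqxx mulr1n.
  by rewrite mxE eq_sym (negPf ji) mulr0n expr0n.
- have -> : fro (invmx A *m C) ^+ 2 = \tr (Z *m Z^T).
    rewrite -mxtrace_mul_tr /Z !trmx_mul !trmx_inv sX -!mulmxA.
    rewrite [LHS]mxtrace_mulC [RHS]mxtrace_mulC -!mulmxA.
    by rewrite invXX trmx_inv.
  rewrite ZE mxtrace_mulC mulmxA UU mul1mx mxtrace_diag.
  by apply: eq_bigr => i _; rewrite mxE.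
- pose Y := U *m diag_mx (map_mx (fun x => expR (- (2 * x))) d) *m U^T.
  have ZY : Z *m Z^T *m Y = 1%:M.
    rewrite ZE /Y !mulmxA -(mulmxA _ U^T) UU mulmx1 -(mulmxA U) mulmx_diag.
    rewrite (_ : diag_mx _ = 1%:M) ?mulmx1 //.
    by apply/matrixP => i j; rewrite !mxE -expRD subrr expR0.
  have YE : Y = (invmx Z)^T *m invmx Z.
    rewrite trmx_inv -invmxM ?unitmx_tr //.
    by rewrite -[LHS](mulKmx (_ : Z *m Z^T \in unitmx)) ?ZY ?mulmx1 // unitmx_mul unitmx_tr uZ.
  have -> : fro (invmx C *m A) ^+ 2 = \tr Y.
    rewrite YE mxtrace_mulC -mxtrace_mul_tr.
    rewrite /Z invmxM ?unitmx_inv // invmxK !trmx_mul sX.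
    by rewrite -!mulmxA (mulmxA X X) XX !mulmxA.
  rewrite /Y mxtrace_mulC mulmxA UU mul1mx mxtrace_diag.
  by apply: eq_bigr => i _; rewrite mxE.
- have : \det (Z *m Z^T) = 1.
    rewrite det_mulmx det_tr /Z det_mulmx det_inv sC mulr1.
    by rewrite -invfM -expr2 dX invr1.
  have dU : \det U * \det U = 1 by rewrite -{1}det_tr -det_mulmx UU det1.
  rewrite ZE !det_mulmx det_tr mulrAC dU mul1r det_diag.
  under eq_bigr do rewrite mxE.
  rewrite -expR_sum -mulr_sumr -[in RHS]expR0 => /expR_inj /eqP.
  by rewrite mulf_eq0 pnatr_eq0 /= => /eqP.
Qed.

End ExpLog.

Section Distances.
Variable R : realType.

(** Both norm bounds confine every [l i] to [- ln M, ln M], so their Euclidean norm is at most sqrt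
    3 * ln M, and sqrt 6 * sqrt 3 = sqrt 18. *)
Lemma dist_le (A C : 'M[R]_3) M : SL3 A -> SL3 C -> 1 <= M ->
  fro (invmx A *m C) <= M -> fro (invmx C *m A) <= M ->
  dist (act A (basept R)) (act C (basept R)) <= Num.sqrt 18 * ln M.
Proof.
move=> sA sC M1 h1 h2.
have [l [-> e1 e2 _]] := dist_singular_values sA sC.
have M0 : 0 < M by lra.
have ME : M ^+ 2 = expR (2 * ln M) by rewrite expRM_natl lnK.
have bound (f : 'I_3 -> R) i x : 0 <= x <= M -> x ^+ 2 = \sum_i expR (f i) ->
    f i <= 2 * ln M.
  move=> /andP [x0 xM] xE; rewrite -ler_expR -ME.
  apply: (@le_trans _ _ (x ^+ 2)); last by nra.
  rewrite xE (bigD1 i) //= lerDl; apply: sumr_ge0 => j _; exact: expR_ge0.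
have l1 i : l i <= ln M.
  have := bound _ i _ _ e1; rewrite fro_ge0 h1 => /(_ isT); lra.
have l2 i : - l i <= ln M.
  have := bound _ i _ _ e2; rewrite fro_ge0 h2 => /(_ isT); lra.
have m0 : 0 <= ln M by rewrite ln_ge0.
have -> : Num.sqrt 18 = Num.sqrt 6 * Num.sqrt 3 :> R.
  by rewrite -sqrtrM //; congr Num.sqrt; ring.
rewrite -mulrA ler_pM2l ?sqrtr_gt0 //.
rewrite -[X in _ * X](ger0_norm m0) -sqrtr_sqr -sqrtrM //; apply: ler_wsqrtr.
rewrite !big_ord_recl big_ord0.
have sq i : l i ^+ 2 <= ln M ^+ 2 by have := l1 i; have := l2 i; nra.
have := sq ord0; have := sq (lift ord0 ord0).
have := sq (lift ord0 (lift ord0 ord0)); lra.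
Qed.

(** The three squared singular values add up to the squared norm, so the largest is at least a third
    of it, more than a quarter: this is the loss of ln 2. *)
Lemma dist_ge (A C : 'M[R]_3) : SL3 A -> SL3 C ->
  Num.sqrt 6 * (ln (fro (invmx A *m C)) - ln 2) <=
    dist (act A (basept R)) (act C (basept R)) /\
  Num.sqrt 6 * (ln (fro (invmx C *m A)) - ln 2) <=
    dist (act A (basept R)) (act C (basept R)).
Proof.
move=> sA sC.
have [l [-> e1 e2 _]] := dist_singular_values sA sC.
have main (f : 'I_3 -> R) x : 0 <= x -> x ^+ 2 = \sum_i expR (2 * f i) ->
    exists i, ln x - ln 2 <= f i.
  move=> x0 xE; apply: contrapT => /forallNP h.
  have xp : 0 < x.
    rewrite lt_def x0 andbT; apply/eqP => x00; move: xE; rewrite x00 expr0n /=.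
    rewrite !big_ord_recl big_ord0.
    have := expR_gt0 (2 * f ord0); have := expR_gt0 (2 * f (lift ord0 ord0)).
    have := expR_gt0 (2 * f (lift ord0 (lift ord0 ord0))); lra.
  have lt i : expR (2 * f i) < (x / 2) ^+ 2.
    rewrite -[x / 2]lnK ?posrE ?divr_gt0 // -expRM_natl ltr_expR.
    rewrite ln_div ?posrE //.
    by have /negP := h i; rewrite -ltNge; lra.
  move: xE; rewrite !big_ord_recl big_ord0.
  have := lt ord0; have := lt (lift ord0 ord0).
  have := lt (lift ord0 (lift ord0 ord0)); nra.
have le i : `|l i| <= Num.sqrt (\sum_i l i ^+ 2).
  rewrite -sqrtr_sqr; apply: ler_wsqrtr; rewrite (bigD1 i) //= lerDl.
  by apply: sumr_ge0 => j _; exact: sqr_ge0.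
split.
  have [i hi] := main _ _ (fro_ge0 _) e1.
  rewrite ler_pM2l ?sqrtr_gt0 //; apply: le_trans hi (le_trans _ (le i)).
  exact: ler_norm.
have e3 : fro (invmx C *m A) ^+ 2 = \sum_i expR (2 * - l i).
  by rewrite e2; apply: eq_bigr => i _; congr expR; ring.
have [i hi] := main (fun i => - l i) _ (fro_ge0 _) e3.
rewrite ler_pM2l ?sqrtr_gt0 //; apply: le_trans hi (le_trans _ (le i)).
by rewrite -normrN; exact: ler_norm.
Qed.

Lemma fro_scalar1 : fro (1%:M : 'M[R]_3) <= 2.
Proof.
rewrite -ler_sqr ?nnegrE ?fro_ge0 // -mxtrace_mul_tr trmx1 mulmx1 mxtrace1; lra.
Qed.

(** The distance is 0, but a bound suffices for a ray to be [asymptotic] to itself and avoids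
    computing the logarithm of the identity. *)
Lemma dist_self (A : 'M[R]_3) : SL3 A ->
  dist (act A (basept R)) (act A (basept R)) <= Num.sqrt 18 * ln 2.
Proof.
by move=> sA; apply: dist_le => //; rewrite ?ler1n // mulVmx ?SL3_unit //;
  exact: fro_scalar1.
Qed.

Definition expd (s : 'rV[R]_3) : 'M[R]_3 := diag_mx (map_mx expR s).

Lemma expd_add (s t : 'rV[R]_3) : expd (s + t) = expd s *m expd t.
Proof.
by rewrite /expd mulmx_diag; congr diag_mx; apply/rowP => j; rewrite !mxE expRD.
Qed.

Lemma det_expd (s : 'rV[R]_3) : \sum_j s 0 j = 0 -> \det (expd s) = 1.
Proof.
move=> s0; rewrite /expd det_diag; under eq_bigr do rewrite mxE.
by rewrite -expR_sum s0 expR0.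
Qed.

Lemma chamber_rayE (h : 'M[R]_3) (s : 'rV[R]_3) t :
  chamber_ray h s t = act (h *m expd (t *: s)) (basept R).
Proof.
rewrite /chamber_ray (_ : t *: diag_mx s = diag_mx (t *: s)) ?expmx_diag //.
by apply/matrixP => i j; rewrite !mxE mulrnAr.
Qed.

Lemma killing_normE (s : 'rV[R]_3) : killing_norm s = Num.sqrt 6 * fro s.
Proof.
rewrite /killing_norm frobeniusE; congr (_ * _).
rewrite /fro big_ord1; congr Num.sqrt; apply: eq_bigr => i _.
rewrite (bigD1 i) //= big1 ?addr0 => [|j ji]; first by rewrite mxE eqxx mulr1n.
by rewrite mxE eq_sym (negPf ji) mulr0n expr0n.
Qed.

Lemma simple_rootZ i a (s : 'rV[R]_3) :
  simple_root i (a *: s) = a * simple_root i s.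
Proof. by rewrite /simple_root !mxE mulrBr. Qed.

Lemma simple_rootB i (s t : 'rV[R]_3) :
  simple_root i (s - t) = simple_root i s - simple_root i t.
Proof. by rewrite /simple_root !mxE; ring. Qed.

Lemma simple_rootD i (s t : 'rV[R]_3) :
  simple_root i (s + t) = simple_root i s + simple_root i t.
Proof. by rewrite /simple_root !mxE; ring. Qed.

Definition flat_point (h : 'M[R]_3) (s : 'rV[R]_3) := act (h *m expd s) (basept R).

(** In the flat of [h] the geodesic from the point [s] to the point [q] is a chamber ray with frame
    [h *m expd s] and direction [q - s]. It is its own witness of asymptoticity, and the regular
    segment towards [t] lies in the same chamber, so only root inequalities remain. *)
Lemma weyl_cone_flat alpha0 h (s t q : 'rV[R]_3) : SL3 h -> 0 < alpha0 ->
  \sum_j s 0 j = 0 -> \sum_j t 0 j = 0 -> \sum_j q 0 j = 0 ->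
  (forall i, 0 < simple_root i (t - s)) ->
  (forall i, 0 < simple_root i (q - s)) ->
  (forall i, alpha0 * killing_norm (q - s) <= simple_root i (q - s)) ->
  weyl_cone alpha0 (flat_point h s) (flat_point h t) (flat_point h q).
Proof.
move=> sh a0 s0 t0 q0 rts rqs aqs.
have k0 : 0 < killing_norm (q - s).
  rewrite killing_normE; apply: mulr_gt0; first by rewrite sqrtr_gt0.
  apply: fro_gt0.
  apply: contraTneq (rqs 0) => ->.
  by rewrite /simple_root !mxE subrr ltxx.
have kn0 := lt0r_neq0 k0.
have shs : SL3 (h *m expd s) by apply: SL3_mul => //; exact: det_expd.
have ray : unit_ray (flat_point h s) (h *m expd s)
    ((killing_norm (q - s))^-1 *: (q - s)).
  split=> //.
    split.
      under eq_bigr do rewrite !mxE.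
      by rewrite -mulr_sumr big_split /= sumrN q0 s0 subrr mulr0.
    move=> i; rewrite simple_rootZ mulr_ge0 ?invr_ge0 ?(ltW k0) //.
    exact: ltW.
  rewrite [LHS]killing_normE froZ ger0_norm ?invr_ge0 ?(ltW k0) //.
  by rewrite mulrCA -killing_normE mulVf.
exists (h *m expd s), ((killing_norm (q - s))^-1 *: (q - s)),
  (killing_norm (q - s)); split=> //.
- exists (h *m expd s), (t - s), ((killing_norm (q - s))^-1 *: (q - s)); split=> //.
  + split=> //; under eq_bigr do rewrite !mxE.
    by rewrite big_split /= sumrN t0 s0 subrr.
  + by rewrite chamber_rayE scale1r -mulmxA -expd_add addrC subrK.
  exists (Num.sqrt 18 * ln 2) => x _; rewrite chamber_rayE; apply: dist_self.
  apply: SL3_mul => //; apply: det_expd; under eq_bigr do rewrite !mxE.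
  by rewrite -!mulr_sumr big_split /= sumrN q0 s0 subrr !mulr0.
- by move=> i; rewrite simple_rootZ -(ler_pM2l k0) mulrA mulfV // mul1r mulrC.
- exact: ltW.
rewrite chamber_rayE scalerA mulfV // scale1r -mulmxA -expd_add.
by rewrite addrC subrK.
Qed.

Definition rev_row (s : 'rV[R]_3) : 'rV[R]_3 := \row_j s 0 (rev_ord j).

(* The longest element of the Weyl group, lifted to SO(3). *)
Definition longest_mx : 'M[R]_3 := mx3 0 0 1 0 (-1) 0 1 0 0.

Lemma det_mx22 (A : 'M[R]_2) :
  \det A = A ord0 ord0 * A ord_max ord_max - A ord0 ord_max * A ord_max ord0.
Proof.
rewrite (expand_det_row _ ord0) !big_ord_recl big_ord0 /cofactor !det_mx11 !mxE.
have -> : lift ord0 ord0 = ord_max :> 'I_2 by apply/val_inj.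
have -> : lift ord_max ord0 = ord0 :> 'I_2 by apply/val_inj.
by rewrite /=; ring.
Qed.

Lemma det_mx3 (a b c d e f g h i : R) : \det (mx3 a b c d e f g h i) =
  a * (e * i - f * h) - b * (d * i - f * g) + c * (d * h - e * g).
Proof.
rewrite (expand_det_row _ 0) !big_ord_recl big_ord0 /cofactor !det_mx22 !mxE /=.
by rewrite /bump /= ; ring.
Qed.

(** The lifted longest element reverses the coordinates of the flat, so that a direction in the
    negative chamber becomes dominant; this gives the cone at the far tip of a diamond. *)
Lemma flat_point_rev h (s : 'rV[R]_3) :
  flat_point h s = flat_point (h *m longest_mx) (rev_row s).
Proof.
have ww : longest_mx *m longest_mx^T = 1%:M.
  apply/matrixP => -[[|[|[|//]]] ?] [[|[|[|//]]] ?];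
  rewrite !mxE !big_ord_recl big_ord0 !mxE /=; ring.
have sw : longest_mx *m expd (rev_row s) = expd s *m longest_mx.
  apply/matrixP => -[[|[|[|//]]] ?] [[|[|[|//]]] ?];
  rewrite /expd mul_mx_diag mul_diag_mx !mxE /= ?mulr0 ?mul0r //=;
  rewrite ?mulr1 ?mul1r ?mulrN1 ?mulN1r //; congr expR || (congr (- expR _));
  by rewrite ?mxE; congr (s _ _); apply/val_inj.
rewrite /flat_point -(mulmxA h) sw !act1 !trmx_mul !mulmxA.
by rewrite -(mulmxA _ longest_mx) ww mulmx1.
Qed.

Lemma simple_root_rev i (s : 'rV[R]_3) :
  simple_root i (rev_row s) = - simple_root (rev_ord i) s.
Proof.
rewrite /simple_root !mxE opprB; case: i => [[|[|//]] ?];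
by congr (s _ _ - s _ _); apply/val_inj.
Qed.

Lemma rev_rowB (s t : 'rV[R]_3) : rev_row s - rev_row t = rev_row (s - t).
Proof. by apply/rowP => j; rewrite !mxE. Qed.

Lemma sum_rev_row (s : 'rV[R]_3) : \sum_j rev_row s 0 j = \sum_j s 0 j.
Proof.
under eq_bigr do rewrite mxE.
by rewrite [RHS](reindex_inj rev_ord_inj).
Qed.

Lemma killing_norm_rev (s : 'rV[R]_3) : killing_norm (rev_row s) = killing_norm s.
Proof.
rewrite !killing_normE; congr (_ * _); rewrite /fro !big_ord1; congr Num.sqrt.
under eq_bigr do rewrite mxE.
by rewrite [RHS](reindex_inj rev_ord_inj).
Qed.

Lemma killing_normN (s : 'rV[R]_3) : killing_norm (- s) = killing_norm s.
Proof. by rewrite !killing_normE froN. Qed.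

Lemma diamond_flat alpha0 h (s t q : 'rV[R]_3) : SL3 h -> 0 < alpha0 ->
  \sum_j s 0 j = 0 -> \sum_j t 0 j = 0 -> \sum_j q 0 j = 0 ->
  (forall i, 0 < simple_root i (q - s)) ->
  (forall i, 0 < simple_root i (t - q)) ->
  (forall i, alpha0 * killing_norm (q - s) <= simple_root i (q - s)) ->
  (forall i, alpha0 * killing_norm (t - q) <= simple_root i (t - q)) ->
  diamond alpha0 (flat_point h s) (flat_point h t) (flat_point h q).
Proof.
move=> sh a0 s0 t0 q0 rqs rtq aqs atq.
have rts i : 0 < simple_root i (t - s).
  by have := rqs i; have := rtq i; rewrite !simple_rootB; lra.
have neg i x y : simple_root i (x - y) = - simple_root i (y - x) :> R.
  by rewrite !simple_rootB; ring.
split; first exact: weyl_cone_flat.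
rewrite ![flat_point h _]flat_point_rev; apply: weyl_cone_flat => //.
- apply: SL3_mul => //; rewrite /SL3 /= /longest_mx det_mx3; ring.
- by rewrite sum_rev_row.
- by rewrite sum_rev_row.
- by rewrite sum_rev_row.
- by move=> i; rewrite rev_rowB simple_root_rev neg opprK.
- by move=> i; rewrite rev_rowB simple_root_rev neg opprK.
move=> i; rewrite rev_rowB simple_root_rev neg opprK killing_norm_rev.
by rewrite -opprB killing_normN.
Qed.

End Distances.

(** * Expanding cones and perturbed products *)

Section Plane.
Variable R : realType.

Definition rot2 : 'M[R]_2 := \matrix_(i, j)
  (if (i == ord0) && (j == ord_max) then -1 else
   if (i == ord_max) && (j == ord0) then 1 else 0).

Lemma ord2P (i : 'I_2) : i = ord0 \/ i = ord_max.
Proof. by case: i => [[|[|//]] ?]; [left|right]; apply/val_inj. Qed.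

Lemma big_ord2 (f : 'I_2 -> R) : \sum_i f i = f ord0 + f ord_max.
Proof.
rewrite !big_ord_recl big_ord0 addr0; congr (_ + f _); exact/val_inj.
Qed.

Lemma rot2_orthogonal : rot2^T *m rot2 = 1%:M.
Proof.
apply/matrixP => i j; rewrite !mxE big_ord2 !mxE.
by case: (ord2P i) => ->; case: (ord2P j) => -> /=; ring.
Qed.

Lemma rot2_symplectic (g : 'M[R]_2) : g^T *m rot2 *m g = \det g *: rot2.
Proof.
apply/matrixP => i j; rewrite !mxE big_ord2 !mxE !big_ord2 !mxE det_mx22 /=.
by case: (ord2P i) => ->; case: (ord2P j) => -> /=; ring.
Qed.

Lemma invmx_SL2 (g : 'M[R]_2) : \det g = 1 -> invmx g = rot2^T *m g^T *m rot2.
Proof.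
move=> dg; apply/mulmx1_invmx/mulmx1C.
by rewrite -!mulmxA (mulmxA _ rot2) rot2_symplectic dg scale1r rot2_orthogonal.
Qed.

Lemma fro_rot2 n (A : 'M[R]_(2, n)) : fro (rot2 *m A) = fro A.
Proof. exact/fro_mulmx_tr/rot2_orthogonal. Qed.

(** In SL(2) the inverse is the transpose conjugated by the right-angle rotation; hence one bound
    [K] serves a block and its inverse. *)
Lemma fro_invmx_SL2 (g : 'M[R]_2) : \det g = 1 -> fro (invmx g) = fro g.
Proof.
move=> dg; rewrite invmx_SL2 // -mulmxA fro_mulmx_tr ?trmxK; last first.
  exact/mulmx1C/rot2_orthogonal.
by rewrite -fro_trmx trmx_mul trmxK fro_mulmx_tr ?trmxK // ?(mulmx1C rot2_orthogonal).
Qed.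

Lemma rank1_decomposition (v : 'cV[R]_2) :
  v *m v^T + (rot2 *m v) *m (rot2 *m v)^T = (fro v ^+ 2)%:M.
Proof.
apply/matrixP => i j; rewrite fro_sqr big_ord2 !big_ord1 !mxE !big_ord1 !mxE.
rewrite !big_ord2 !mxE.
by case: (ord2P i) => ->; case: (ord2P j) => -> /=; rewrite ?mulr1n ?mulr0n; ring.
Qed.

Lemma unitmx_SL2 (g : 'M[R]_2) : \det g = 1 -> g \in unitmx.
Proof. by move=> dg; rewrite unitmxE dg unitr1. Qed.

(* With v = g' w: |v|^2 g g' = (g v)(v^T g') + (g J v)(J w)^T, where J is the
   rotation by a right angle and g'^T J g' = J. *)
Lemma fro_mul_le (g g' : 'M[R]_2) (v : 'cV[R]_2) : \det g' = 1 ->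
  fro (g *m g') * fro v <=
  fro (g *m v) * fro g' + fro g * fro (invmx g' *m v).
Proof.
move=> dg; have ug := unitmx_SL2 dg.
have [v0|v0] := eqVneq (fro v) 0.
  by rewrite v0 mulr0 addr_ge0 // mulr_ge0 // fro_ge0.
have vp : 0 < fro v by rewrite lt_def v0 fro_ge0.
pose w := invmx g' *m v.
have e : (fro v ^+ 2) *: (g *m g') =
    (g *m v) *m (v^T *m g') + (g *m (rot2 *m v)) *m (rot2 *m w)^T.
  have -> : (rot2 *m w)^T = (rot2 *m v)^T *m g'.
    have -> : v = g' *m w by rewrite /w mulmxA mulmxV // mul1mx.
    rewrite !trmx_mul -!mulmxA; congr (_ *m _).
    have := rot2_symplectic g'; rewrite dg scale1r => h.
    by rewrite -[in LHS]h !trmx_mul trmxK !mulmxA.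
  rewrite -!mulmxA -mulmxDr !mulmxA -mulmxDl rank1_decomposition.
  by rewrite mul_scalar_mx scalemxAr.
have : fro ((fro v ^+ 2) *: (g *m g')) <=
    fro (g *m v) * (fro v * fro g') + (fro g * fro v) * fro w.
  rewrite e; apply: le_trans (fro_add _ _) _; apply: lerD.
    apply: le_trans (fro_mul _ _) _; apply: (ler_wpM2l (fro_ge0 _)).
    by rewrite -[X in _ <= X * _]fro_trmx fro_mul.
  apply: le_trans (fro_mul _ _) _; rewrite fro_trmx fro_rot2.
  apply: (ler_wpM2r (fro_ge0 _)).
  by rewrite -[X in _ <= _ * X]fro_rot2 fro_mul.
rewrite froZ ger0_norm ?sqr_ge0 // -/w => h.
rewrite -(ler_pM2l vp).
by move: h; move: (fro (g *m g')) (fro w) (fro (g *m v)) => a b c; lra.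
Qed.

Definition dot2 (x y : 'cV[R]_2) : R := (x^T *m y) ord0 ord0.

Definition wedge (x y : 'cV[R]_2) : R := dot2 (rot2 *m x) y.

Lemma dot2_wedge_sqr x y :
  dot2 x y ^+ 2 + wedge x y ^+ 2 = fro x ^+ 2 * fro y ^+ 2.
Proof.
rewrite !fro_sqr !big_ord2 !big_ord1 /wedge /dot2 !mxE !big_ord2 !mxE !big_ord2.
by rewrite !mxE /=; ring.
Qed.

(** A vector [y] nearly parallel to [x] would be expanded along with it. Decompose [y] along [x] and
    the rotated [x]: under [g] the second part contributes at most K times the wedge, so a small
    wedge contradicts the contraction of [y]. *)
Lemma transverse (g : 'M[R]_2) (x y : 'cV[R]_2) (K : R) : 1 <= K ->
  fro g <= K -> 0 < fro x -> 0 < fro y ->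
  100 * fro x <= fro (g *m x) -> fro (g *m y) <= 1 / 20 * fro y ->
  K^-1 / 2 * (fro x * fro y) <= `|wedge x y|.
Proof.
move=> K1 gK x0 y0 gx gy; rewrite leNgt; apply/negP => wlt.
have K0 : 0 < K by lra.
have dec : (fro x ^+ 2) *: y = dot2 x y *: x + wedge x y *: (rot2 *m x).
  rewrite -mul_scalar_mx -rank1_decomposition mulmxDl -!mulmxA.
  rewrite [x^T *m y]mx11_scalar [(rot2 *m x)^T *m y]mx11_scalar.
  by rewrite !mul_mx_scalar -scalemxAr.
have e : dot2 x y *: (g *m x) =
    (fro x ^+ 2) *: (g *m y) - wedge x y *: (g *m (rot2 *m x)).
  by have := congr1 (mulmx g) dec; rewrite mulmxDr -!scalemxAr => ->; rewrite addrK.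
have h : `|dot2 x y| * fro (g *m x) <=
    fro x ^+ 2 * fro (g *m y) + `|wedge x y| * (K * fro x).
  rewrite -froZ e; apply: le_trans (fro_add _ _) _; rewrite froN !froZ.
  rewrite ger0_norm ?sqr_ge0 // lerD2l ler_wpM2l //.
  rewrite -(fro_rot2 x); apply: le_trans (fro_mul _ _) _.
  by apply: ler_wpM2r; rewrite ?fro_ge0.
have := dot2_wedge_sqr x y.
have -> : dot2 x y ^+ 2 = `|dot2 x y| ^+ 2 by rewrite real_normK ?num_real.
have -> : wedge x y ^+ 2 = `|wedge x y| ^+ 2 by rewrite real_normK ?num_real.
have := normr_ge0 (dot2 x y); have := normr_ge0 (wedge x y).
have KW : K * `|wedge x y| <= fro x * fro y / 2.
  rewrite -ler_pdivlMl // mulrCA mulrC; apply: ltW; move: wlt; lra.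
have W2 : `|wedge x y| <= fro x * fro y / 2.
  apply: le_trans KW; rewrite ler_peMl //.
move: h gx gy x0 y0 KW W2; clear.
move: (fro x) (fro y) (fro (g *m x)) (fro (g *m y)) `|dot2 x y| `|wedge x y|.
move=> a b ga gb d w h1 h2 h3 a0 b0 h4 h5 w0 d0 e.
have ab : 0 < a * b by exact: mulr_gt0.
have d1 : a * b / 2 <= d by nra.
have h6 : d * (100 * a) <= d * ga by apply: ler_wpM2l.
have h7 : a ^+ 2 * gb <= a ^+ 2 * (1 / 20 * b).
  by apply: ler_wpM2l => //; exact: sqr_ge0.
have h8 : w * (K * a) <= a * (a * b / 2).
  have -> : w * (K * a) = a * (K * w) by ring.
  by apply: ler_wpM2l => //; lra.
have h9 : a * b / 2 * (100 * a) <= d * (100 * a).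
  by apply: ler_wpM2r => //; lra.
have : 0 < a * (a * b) by exact: mulr_gt0.
have r1 : a ^+ 2 * (1 / 20 * b) = 1 / 20 * (a * (a * b)) by ring.
have r2 : a * b / 2 * (100 * a) = 50 * (a * (a * b)) by field.
have r3 : a * (a * b / 2) = 1 / 2 * (a * (a * b)) by field.
rewrite r1 in h7; rewrite r2 in h9; rewrite r3 in h8.
lra.
Qed.

Lemma expanded_vector (g : 'M[R]_2) : 200 <= fro g ->
  exists2 x : 'cV[R]_2, fro x = 1 & 100 <= fro (g *m x).
Proof.
move=> g200.
have e1 j : fro (delta_mx j ord0 : 'cV[R]_2) = 1.
  apply/eqP; rewrite -(@eqrXn2 _ 2) ?fro_ge0 // fro_sqr big_ord2 !big_ord1 !mxE.
  by case: (ord2P j) => -> /=; apply/eqP; ring.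
have : fro g ^+ 2 = fro (g *m delta_mx ord0 ord0 : 'cV[R]_2) ^+ 2 +
   fro (g *m delta_mx ord_max ord0 : 'cV[R]_2) ^+ 2.
  by rewrite !fro_sqr !big_ord2 !big_ord1 !mxE !big_ord2 !mxE /=; ring.
have := fro_ge0 (g *m delta_mx ord0 ord0 : 'cV[R]_2).
have := fro_ge0 (g *m delta_mx ord_max ord0 : 'cV[R]_2).
have [h|h] := lerP 100 (fro (g *m delta_mx ord0 ord0 : 'cV[R]_2)).
  by move=> *; exists (delta_mx ord0 ord0).
move=> h1 h2 h3; exists (delta_mx ord_max ord0) => //; nra.
Qed.

End Plane.

Section Cones.
Variable R : realType.

Definition blk (g : 'M[R]_2) : 'M[R]_3 :=
  mx3 (g ord0 ord0) 0 (g ord0 ord_max) 0 1 0 (g ord_max ord0) 0 (g ord_max ord_max).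

(** [j.*2] sends the two coordinates of the plane to 0 and 2, those on which [blk] acts. *)
Definition inc : 'M[R]_(3, 2) := \matrix_(i, j) (i == j.*2 :> nat)%:R.

Definition hor (v : 'cV[R]_3) : 'cV[R]_2 := inc^T *m v.

Definition ver (v : 'cV[R]_3) : R := v (lift ord0 ord0) ord0.

Lemma big_ord3 (f : 'I_3 -> R) : \sum_i f i =
  f ord0 + f (lift ord0 ord0) + f (lift ord0 (lift ord0 ord0)).
Proof. by rewrite !big_ord_recl big_ord0 addr0 addrA. Qed.

Lemma ord3P (i : 'I_3) :
  [\/ i = ord0, i = lift ord0 ord0 | i = lift ord0 (lift ord0 ord0)].
Proof.
by case: i => [[|[|[|//]]] ?]; [constructor 1|constructor 2|constructor 3];
  apply/val_inj.
Qed.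

Lemma blkM g g' : blk (g *m g') = blk g *m blk g'.
Proof.
apply/matrixP => i j; rewrite !mxE big_ord3 !mxE !big_ord2.
by case: (ord3P i) => ->; case: (ord3P j) => -> /=; ring.
Qed.

Lemma blk1 : blk 1%:M = 1%:M.
Proof.
apply/matrixP => i j; rewrite !mxE.
by case: (ord3P i) => ->; case: (ord3P j) => -> /=.
Qed.

Lemma blk_tr g : blk g^T = (blk g)^T.
Proof.
apply/matrixP => i j; rewrite !mxE.
by case: (ord3P i) => ->; case: (ord3P j) => -> /=.
Qed.

Lemma det_blk g : \det (blk g) = \det g.
Proof. by rewrite /blk det_mx3 det_mx22; ring. Qed.

Lemma blk_inv g : \det g = 1 -> blk (invmx g) = invmx (blk g).
Proof.
move=> dg; apply/esym/mulmx1_invmx.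
by rewrite -blkM mulmxV ?blk1 // unitmx_SL2.
Qed.

Lemma fro_blk g : fro (blk g) ^+ 2 = fro g ^+ 2 + 1.
Proof. by rewrite !fro_sqr !big_ord3 !big_ord2 !mxE /=; ring. Qed.

Lemma blk_inj : injective blk.
Proof.
move=> g g' /matrixP h; apply/matrixP => i j.
have h00 := h ord0 ord0; have h02 := h ord0 (lift ord0 (lift ord0 ord0)).
have h20 := h (lift ord0 (lift ord0 ord0)) ord0.
have h22 := h (lift ord0 (lift ord0 ord0)) (lift ord0 (lift ord0 ord0)).
move: h00 h02 h20 h22; rewrite !mxE /= => h00 h02 h20 h22.
by case: (ord2P i) => ->; case: (ord2P j) => ->.
Qed.

Lemma hor_blk g v : hor (blk g *m v) = g *m hor v.
Proof.
apply/matrixP => i j; rewrite ord1 !mxE big_ord3 !mxE !big_ord3 !mxE big_ord2 !mxE.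
rewrite !big_ord3 !mxE /=.
by case: (ord2P i) => -> /=; ring.
Qed.

Lemma ver_blk g v : ver (blk g *m v) = ver v.
Proof. by rewrite /ver !mxE big_ord3 !mxE /=; ring. Qed.

Lemma horD u v : hor (u + v) = hor u + hor v.
Proof. exact: mulmxDr. Qed.

Lemma verD u v : ver (u + v) = ver u + ver v.
Proof. by rewrite /ver mxE. Qed.

Lemma horZ a v : hor (a *: v) = a *: hor v.
Proof. by rewrite /hor scalemxAr. Qed.

Lemma verZ a v : ver (a *: v) = a * ver v.
Proof. by rewrite /ver mxE. Qed.

Lemma fro_hor_ver v : fro v ^+ 2 = fro (hor v) ^+ 2 + ver v ^+ 2.
Proof.
rewrite !fro_sqr !big_ord3 !big_ord2 !big_ord1 /ver !mxE !big_ord3 !mxE /=; ring.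
Qed.

Lemma fro_hor v : fro (hor v) <= fro v.
Proof.
rewrite -ler_sqr ?nnegrE ?fro_ge0 // fro_hor_ver lerDl; exact: sqr_ge0.
Qed.

Lemma norm_ver v : `|ver v| <= fro v.
Proof. exact: fro_entry. Qed.

Lemma fro_le_hor_ver v : fro v <= fro (hor v) + `|ver v|.
Proof.
rewrite -ler_sqr ?nnegrE ?addr_ge0 ?fro_ge0 // fro_hor_ver.
rewrite -(real_normK (num_real (ver v))).
by have := fro_ge0 (hor v); have := normr_ge0 (ver v); nra.
Qed.

(* [K] bounds the norm of a block, [eps] its perturbation and [eta] the slope of
   the cone; the last inequality keeps the perturbed block expanding. *)
Definition cone_constants (K eps eta : R) : Prop :=
  [/\ 1 <= K, 0 <= eps, eps <= eta & 400 * (eta * K) <= 1].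

Variables (K eps eta : R).
Hypothesis constants : cone_constants K eps eta.

Lemma cone_constants_small :
  [/\ 0 <= eta, eta <= 1, eps <= 1 & 4 * (eps * K) <= 1].
Proof.
have [K1 eps0 h1 h2] := constants.
have e0 : 0 <= eta by lra.
have e1 : eta <= eta * K by rewrite ler_peMr.
have : eps * K <= eta * K by apply: ler_wpM2r => //; lra.
have : 0 <= eta * K by lra.
by split=> //; lra.
Qed.

(** The perturbation moves the image of [v] by at most 2 eps |hor v|, so the expansion 100 drops to
    98 at worst. The last conclusion, that the inverse block strongly contracts the image, is what
    the preceding block of a chain will use. *)
Lemma cone_step (B : 'M[R]_3) (g : 'M[R]_2) (v : 'cV[R]_3) :
  \det g = 1 -> fro g <= K -> fro (B - blk g) <= eps ->
  0 < fro (hor v) -> `|ver v| <= eta * fro (hor v) ->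
  100 * fro (hor v) <= fro (g *m hor v) ->
  [/\ 50 * fro (hor v) <= fro (hor (B *m v)),
      `|ver (B *m v)| <= eta * fro (hor (B *m v)) &
      fro (invmx g *m hor (B *m v)) <= 1 / 20 * fro (hor (B *m v))].
Proof.
have [K1 eps0 eps_eta _] := constants.
have [eta0 eta1 e1 epsK] := cone_constants_small.
move=> dg gK Bg v0 vc gv.
have [e eE] : exists e, e = (B - blk g) *m v by eexists.
have Bv : B *m v = blk g *m v + e by rewrite eE -mulmxDl addrC subrK.
have fv : fro v <= 2 * fro (hor v).
  have := fro_le_hor_ver v; have : eta * fro (hor v) <= fro (hor v); last by lra.
  by rewrite ler_piMl // ltW.
have fe : fro e <= 2 * eps * fro (hor v).
  rewrite eE; apply: le_trans (fro_mul _ _) _; apply: (@le_trans _ _ (eps * fro v)).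
    by apply: ler_wpM2r Bg; exact: fro_ge0.
  by rewrite [2 * _]mulrC -mulrA; apply: ler_wpM2l.
have fe1 : eps * fro (hor v) <= fro (hor v) by rewrite ler_piMl // ltW.
have hB : hor (B *m v) = g *m hor v + hor e by rewrite Bv horD hor_blk.
have vB : ver (B *m v) = ver v + ver e by rewrite Bv verD ver_blk.
have he := fro_hor e; have ve := norm_ver e.
have grow : 98 * fro (hor v) <= fro (hor (B *m v)).
  rewrite hB; have := fro_sub (g *m hor v) (- hor e); rewrite opprK froN.
  lra.
split; first by lra.
  rewrite vB; apply: le_trans (ler_normD _ _) _.
  apply: (@le_trans _ _ (eta * (98 * fro (hor v)))); last by apply: ler_wpM2l.
  have : eps * fro (hor v) <= eta * fro (hor v) by apply: ler_wpM2r => //; exact: ltW.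
  have : 0 <= eta * fro (hor v) by rewrite mulr_ge0 // ltW.
  lra.
rewrite hB mulmxDr mulmxA mulVmx ?unitmx_SL2 // mul1mx -hB.
have : fro (invmx g *m hor e) <= fro (hor v).
  apply: le_trans (fro_mul _ _) _; rewrite fro_invmx_SL2 //.
  apply: (@le_trans _ _ (K * (2 * eps * fro (hor v)))).
    by apply: ler_pM => //; rewrite ?fro_ge0 //; lra.
  have -> : K * (2 * eps * fro (hor v)) = 2 * (eps * K) * fro (hor v) by ring.
  by rewrite ler_piMl ?(ltW v0) //; lra.
have := fro_add (hor v) (invmx g *m hor e); lra.
Qed.

(** There are n + 1 blocks, [B 0] to [B n]. Closeness of the inverses and both inequalities on
    consecutive blocks are required so that the inverse transposes, and the inverses in reversed
    order, form chains again. *)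
Definition block_chain n (B : nat -> 'M[R]_3) (g : nat -> 'M[R]_2) : Prop :=
  (forall i, (i <= n)%N ->
    [/\ \det (B i) = 1, \det (g i) = 1, 200 <= fro (g i), fro (g i) <= K &
        fro (B i - blk (g i)) <= eps /\
        fro (invmx (B i) - blk (invmx (g i))) <= eps]) /\
  (forall i, (i < n)%N ->
    200 * fro (g i) <= fro (g i *m g i.+1) /\
    200 * fro (g i.+1) <= fro (g i *m g i.+1)).

Lemma block_chain_dual n B g : block_chain n B g ->
  block_chain n (fun i => (invmx (B i))^T) (fun i => (invmx (g i))^T).
Proof.
move=> [h1 h2]; split=> i lein.
  have [dB dg g200 gK [Bg Bg']] := h1 i lein.
  rewrite !det_tr !det_inv dB dg invr1 !fro_trmx !fro_invmx_SL2 //; split=> //.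
  by rewrite blk_tr -raddfB /= fro_trmx -!trmx_inv !invmxK blk_tr -raddfB fro_trmx.
have [_ dg _ _ _] := h1 i (ltnW lein); have [_ dg1 _ _ _] := h1 i.+1 lein.
rewrite -trmx_mul !fro_trmx -invmxM ?unitmx_SL2 // !fro_invmx_SL2 //; first exact: h2.
by rewrite det_mulmx dg dg1 mulr1.
Qed.

Lemma block_chain_rev n B g : block_chain n B g ->
  block_chain n (fun i => invmx (B (n - i)%N)) (fun i => invmx (g (n - i)%N)).
Proof.
move=> [h1 h2]; split=> i lein.
  have [dB dg g200 gK [Bg Bg1]] := h1 _ (leq_subr i n).
  by rewrite !det_inv dB dg invr1 !fro_invmx_SL2 // !invmxK.
have [_ dg _ _ _] := h1 _ (leq_subr i.+1 n).
have [_ dg1 _ _ _] := h1 _ (leq_subr i n).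
rewrite -invmxM ?unitmx_SL2 // !fro_invmx_SL2 //; last first.
  by rewrite det_mulmx dg dg1 mulr1.
have -> : (n - i = (n - i.+1).+1)%N by lia.
by have [] := h2 (n - i.+1)%N; first lia.
Qed.

Definition in_cone (v : 'cV[R]_3) : Prop :=
  0 < fro (hor v) /\ `|ver v| <= eta * fro (hor v).

(** [B i] maps [v i.+1] to [v i], as in a product of [B 0], ..., [B n] acting on a column: the
    vectors grow towards index 0. *)
Definition expanding_orbit n (B : nat -> 'M[R]_3) (g : nat -> 'M[R]_2)
    (v : nat -> 'cV[R]_3) : Prop :=
  (forall i, (i <= n.+1)%N -> in_cone (v i)) /\
  (forall i, (i <= n)%N -> [/\ v i = B i *m v i.+1,
    50 * fro (hor (v i.+1)) <= fro (hor (v i)),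
    100 * fro (hor (v i.+1)) <= fro (g i *m hor (v i.+1)) &
    fro (invmx (g i) *m hor (v i)) <= 1 / 20 * fro (hor (v i))]).

Lemma hor_inc x : hor (inc *m x) = x.
Proof.
apply/matrixP => i j; rewrite ord1 !mxE !big_ord3 !mxE !big_ord2 !mxE /=.
by case: (ord2P i) => -> /=; ring.
Qed.

Lemma ver_inc x : ver (inc *m x) = 0.
Proof. by rewrite /ver !mxE big_ord2 !mxE /=; ring. Qed.

(** The orbit is built from the last block towards the first, starting from a horizontal vector
    expanded by the last one. *)
Lemma expanding_orbit_exists n B g : block_chain n B g ->
  exists v, expanding_orbit n B g v.
Proof.
have step B0 g0 v : \det g0 = 1 -> fro g0 <= K -> fro (B0 - blk g0) <= eps ->
    in_cone v -> 100 * fro (hor v) <= fro (g0 *m hor v) ->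
    [/\ in_cone (B0 *m v), 50 * fro (hor v) <= fro (hor (B0 *m v)) &
      fro (invmx g0 *m hor (B0 *m v)) <= 1 / 20 * fro (hor (B0 *m v))].
  move=> dg gK Bg [v0 vc] gv.
  have [h1 h2 h3] := cone_step dg gK Bg v0 vc gv.
  by split=> //; split=> //; lra.
elim: n B g => [|n IH] B g [h1 h2].
  have [dB dg g200 gK [Bg _]] := h1 0%N (leqnn _).
  have [x x1 gx] := expanded_vector g200.
  have c0 : in_cone (inc *m x).
    by rewrite /in_cone hor_inc ver_inc x1 normr0; case: cone_constants_small; lra.
  have [|s1 s2 s3] := step _ _ _ dg gK Bg c0; first by rewrite hor_inc x1; lra.
  exists (fun i => if i is 0%N then B 0%N *m (inc *m x) else inc *m x).
  split=> [[|[|//]] //|[|//] _]; split=> //.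
  by rewrite hor_inc x1; lra.
have [|v [v1 v2]] := IH (fun i => B i.+1) (fun i => g i.+1).
  by split=> i lein; [exact: h1 | exact: h2].
have [dB dg g200 gK [Bg _]] := h1 0%N (leq0n _).
have [_ dg1 _ _ _] := h1 1%N (ltn0Sn _).
have [big0 big1] := h2 0%N (ltn0Sn _).
have c0 := v1 0%N (leq0n _); have [_ _ _ inv0] := v2 0%N (leq0n _).
(* The vector [v 0] of the shifted chain was just produced by block 1, whose inverse contracts it.
   By [fro_mul_le], a failure of block 0 to expand it would make the product of the two blocks too
   short. *)
have gv : 100 * fro (hor (v 0%N)) <= fro (g 0%N *m hor (v 0%N)).
  have key := fro_mul_le (g 0%N) (hor (v 0%N)) dg1.
  have {}v0 := c0.1.
  have F0 : 0 < fro (g 0%N *m g 1%N) by lra.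
  move: key inv0 big0 big1 v0 F0; clear.
  move: (fro (g 0%N *m g 1%N)) (fro (hor (v 0%N))) (fro (g 0%N *m hor (v 0%N))) (fro (invmx _ *m _)).
  move: (fro_ge0 (g 0%N)) (fro_ge0 (g 1%N)).
  move: (fro (g 0%N)) (fro (g 1%N)) => a b a0 b0 F x y z h1 h2 h3 h4 x0 F0.
  rewrite leNgt; apply/negP => ylt.
  have l1 : y * b <= 100 * x * b by apply: ler_wpM2r => //; exact: ltW.
  have l2 : a * z <= a * (1 / 20 * x) by apply: ler_wpM2l.
  have l3 : x * (200 * b) <= x * F by apply: ler_wpM2l => //; exact: ltW.
  have l4 : x * (200 * a) <= x * F by apply: ler_wpM2l => //; exact: ltW.
  have l5 : 0 < x * F by exact: mulr_gt0.
  have l6 : 0 <= x * a by rewrite mulr_ge0 // ltW.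
  lra.
have [s1 s2 s3] := step _ _ _ dg gK Bg c0 gv.
exists (fun i => if i is j.+1 then v j else B 0%N *m v 0%N); split=> [[|i] //|[|i] lei].
- exact: v1.
- by split.
- exact: v2.
Qed.

End Cones.

(** * Invariant frames: expanded, neutral and contracted directions *)

Section Frames.
Variable R : realType.
Local Notation "'o1'" := (lift ord0 ord0).
Local Notation "'o2'" := (lift ord0 (lift ord0 ord0)).

Definition cross (f g : 'cV[R]_3) : 'cV[R]_3 := \col_i
  nth 0 [:: f o1 ord0 * g o2 ord0 - f o2 ord0 * g o1 ord0;
            f o2 ord0 * g ord0 ord0 - f ord0 ord0 * g o2 ord0;
            f ord0 ord0 * g o1 ord0 - f o1 ord0 * g ord0 ord0] i.

Lemma det_mx33 (A : 'M[R]_3) : \det A =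
  A ord0 ord0 * (A o1 o1 * A o2 o2 - A o1 o2 * A o2 o1)
  - A ord0 o1 * (A o1 ord0 * A o2 o2 - A o1 o2 * A o2 ord0)
  + A ord0 o2 * (A o1 ord0 * A o2 o1 - A o1 o1 * A o2 ord0).
Proof.
rewrite -det_mx3; congr (\det _); apply/matrixP => i j; rewrite !mxE.
by case: (ord3P i) => ->; case: (ord3P j) => ->.
Qed.

Lemma cross_tr_mul (A : 'M[R]_3) f g :
  A^T *m cross (A *m f) (A *m g) = \det A *: cross f g.
Proof.
apply/colP => i; rewrite det_mx33 !mxE big_ord3 !mxE !big_ord3 /=.
by case: (ord3P i) => -> /=; ring.
Qed.

Lemma mul_cross (B : 'M[R]_3) f g : \det B = 1 ->
  B *m cross f g = cross ((invmx B)^T *m f) ((invmx B)^T *m g).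
Proof.
move=> dB; have uB : B \in unitmx by rewrite unitmxE dB unitr1.
have := cross_tr_mul (invmx B)^T f g.
rewrite trmxK det_tr det_inv dB invr1 scale1r => <-.
by rewrite mulmxA mulmxV // mul1mx.
Qed.

Lemma ver_cross f g : ver (cross f g) = - wedge (hor f) (hor g).
Proof.
rewrite /ver /wedge /dot2 /hor !mxE /= big_ord2 !mxE !big_ord2 !mxE !big_ord3.
by rewrite !mxE /=; ring.
Qed.

Lemma hor_cross f g :
  hor (cross f g) = ver g *: (rot2 R *m hor f) - ver f *: (rot2 R *m hor g).
Proof.
apply/colP => i; rewrite /ver /hor !mxE !big_ord3 !big_ord2 !mxE !big_ord3 !mxE /=.
by case: (ord2P i) => -> /=; ring.
Qed.

Lemma wedge_le (x y : 'cV[R]_2) : `|wedge x y| <= fro x * fro y.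
Proof.
rewrite -ler_sqr ?nnegrE ?mulr_ge0 ?fro_ge0 // exprMn -dot2_wedge_sqr.
by rewrite real_normK ?num_real // lerDr sqr_ge0.
Qed.

Lemma wedgeC (x y : 'cV[R]_2) : wedge x y = - wedge y x.
Proof. by rewrite /wedge /dot2 !mxE !big_ord2 !mxE !big_ord2 !mxE /=; ring. Qed.

Definition frame (u1 u2 u3 : 'cV[R]_3) : 'M[R]_3 :=
  \matrix_(i, k) nth 0 [:: u1 i ord0; u2 i ord0; u3 i ord0] k.

Lemma mul_frame B u1 u2 u3 :
  B *m frame u1 u2 u3 = frame (B *m u1) (B *m u2) (B *m u3).
Proof.
apply/matrixP => i k; rewrite !mxE.
by case: (ord3P k) => -> /=; apply: eq_bigr => j _; rewrite !mxE.
Qed.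

Lemma det_frame u1 u2 u3 : \det (frame u1 u2 u3) =
  ver u2 * wedge (hor u1) (hor u3) - ver u1 * wedge (hor u2) (hor u3)
  - ver u3 * wedge (hor u1) (hor u2).
Proof.
rewrite det_mx33 /ver /wedge /dot2 /hor !mxE !big_ord2 !mxE !big_ord2 !mxE.
by rewrite !big_ord3 !mxE /=; ring.
Qed.

Lemma fro_frame_expd u1 u2 u3 (s : 'rV[R]_3) :
  fro (frame u1 u2 u3 *m expd s) ^+ 2 = (expR (s ord0 ord0) * fro u1) ^+ 2 +
   (expR (s ord0 o1) * fro u2) ^+ 2 + (expR (s ord0 o2) * fro u3) ^+ 2.
Proof.
rewrite !exprMn !fro_sqr /expd mul_mx_diag !big_ord3 !big_ord1 !mxE /=; ring.
Qed.

Variables (K eps eta : R).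
Hypothesis constants : cone_constants K eps eta.
Local Notation chain := (block_chain K eps).
Local Notation cone := (in_cone eta).

(** [u] is an expanding orbit of the chain and [w] one of the reversed chain of inverses, read
    backwards; at each index a common block expands one of them and contracts the other. *)
Lemma transverse_orbits n B g : chain n B g ->
  exists u w : nat -> 'cV[R]_3,
  [/\ forall i, (i <= n.+1)%N -> cone (u i) /\ cone (w i),
    forall i, (i <= n)%N -> u i = B i *m u i.+1 /\ w i.+1 = invmx (B i) *m w i,
    forall i, (i <= n)%N -> 50 * fro (hor (u i.+1)) <= fro (hor (u i)) /\
      50 * fro (hor (w i)) <= fro (hor (w i.+1)) &
    forall i, (i <= n.+1)%N -> K^-1 / 2 * (fro (hor (u i)) * fro (hor (w i))) <=
      `|wedge (hor (u i)) (hor (w i))|].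
Proof.
move=> ch; have [K1 _ _ _] := constants.
have [u [u1 u2]] := expanding_orbit_exists constants ch.
have [v [v1 v2]] := expanding_orbit_exists constants (block_chain_rev ch).
exists u, (fun i => v (n.+1 - i)%N); split=> i lei.
- by split; [exact: u1 | apply: v1; exact: leq_subr].
- have [-> _ _ _] := u2 i lei; split=> //.
  have [e _ _ _] := v2 (n - i)%N (leq_subr _ _).
  by rewrite subSS e subKn // subSn.
- have [_ e1 _ _] := u2 i lei; split=> //.
  have [_ e _ _] := v2 (n - i)%N (leq_subr _ _).
  by rewrite subSS subSn.
have [p1 _] := u1 i lei; have [p2 _] := v1 (n.+1 - i)%N (leq_subr _ _).
case: i lei p1 p2 => [|i] lei p1 p2.
  (* No block precedes index 0; there the inverse of block 0 expands [w] and contracts [u], so the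
     roles are exchanged. *)
  have [_ _ _ e1] := u2 0%N (leq0n _); have [_ _ e2 _] := v2 n (leqnn _).
  rewrite subn0 in p2 *; rewrite subnn in e2.
  have [_ dg _ gK _] := ch.1 0%N (leq0n _).
  rewrite wedgeC normrN [X in _ / 2 * X]mulrC.
  by apply: (transverse K1 _ p2 p1 e2 e1); rewrite fro_invmx_SL2.
have [_ _ e1 _] := u2 i lei; have [_ _ _ e2] := v2 (n - i)%N (leq_subr _ _).
rewrite subKn // invmxK in e2; rewrite subSS in p2 *.
have [_ dg _ gK _] := ch.1 i lei.
exact: (transverse K1 gK p1 p2 e1 e2).
Qed.

Lemma cone_fro u : cone u -> fro u <= 2 * fro (hor u).
Proof.
move=> [h0 h]; have [_ e1 _ _] := cone_constants_small constants.
have := fro_le_hor_ver u.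
have : eta * fro (hor u) <= fro (hor u) by rewrite ler_piMl // ltW.
lra.
Qed.

Lemma fro_block n B g i : chain n B g -> (i <= n)%N ->
  fro (B i) <= K + 2 /\ fro (invmx (B i)) <= K + 2.
Proof.
move=> ch lei; have [_ dg _ gK [h1 h2]] := ch.1 i lei.
have [_ _ e1 _] := cone_constants_small constants.
have le (g0 : 'M[R]_2) : fro (blk g0) <= fro g0 + 1.
  rewrite -ler_sqr ?nnegrE ?addr_ge0 ?fro_ge0 // fro_blk sqrrD expr1n.
  by rewrite -addrA lerD2l lerDr mulrn_wge0 // mulr1 fro_ge0.
split.
  have := fro_add (B i - blk (g i)) (blk (g i)); rewrite subrK.
  by have := le (g i); lra.
have := fro_add (invmx (B i) - blk (invmx (g i))) (blk (invmx (g i))).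
by rewrite subrK; have := le (invmx (g i)); rewrite fro_invmx_SL2 //; lra.
Qed.

(* [u1] spans the expanded line, [u2] is close to the coordinate fixed by
   [blk g], and [u3] spans the contracted line. *)
Definition frame_at (u1 u2 u3 : 'cV[R]_3) : Prop :=
  [/\ cone u1, cone u3, 0 < `|ver u2|,
    fro (hor u2) <= 1 / 100 * `|ver u2| & K^-1 / 2 * (fro (hor u1) * fro (hor u3)) <=
      `|wedge (hor u1) (hor u3)|].

(** In [det_frame] the term with [ver u2] dominates: the two others carry a factor eta from a cone
    and 1 / 100 from [u2], while transversality costs only a factor 2 K, and 400 eta K <= 1. *)
Lemma det_frame_bounds u1 u2 u3 : frame_at u1 u2 u3 ->
  `|ver u2| * (fro (hor u1) * fro (hor u3)) <= 4 * K * `|\det (frame u1 u2 u3)| /\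
  `|\det (frame u1 u2 u3)| <= 2 * (`|ver u2| * (fro (hor u1) * fro (hor u3))).
Proof.
have [K1 _ _ etaK] := constants.
have [eta0 eta1 _ _] := cone_constants_small constants.
move=> [[p1 c1] [p3 c3] p2 c2 tr].
have K0 : 0 < K by lra.
have [x xE] : exists x, x = ver u2 * wedge (hor u1) (hor u3) by eexists.
have [y yE] : exists y, y = ver u1 * wedge (hor u2) (hor u3)
  + ver u3 * wedge (hor u1) (hor u2) by eexists.
have dE : \det (frame u1 u2 u3) = x - y by rewrite det_frame xE yE; ring.
set P := `|ver u2| * _.
have P0 : 0 < P by rewrite /P !mulr_gt0.
have y1 : K * `|y| <= P / 400.
  have w1 := wedge_le (hor u2) (hor u3); have w2 := wedge_le (hor u1) (hor u2).
  have h1 : `|ver u1 * wedge (hor u2) (hor u3)| <= eta * P / 100.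
    rewrite normrM; apply: le_trans (ler_pM (normr_ge0 _) (normr_ge0 _) c1 w1) _.
    have -> : eta * P / 100 = eta * fro (hor u1) *
      ((1 / 100 * `|ver u2|) * fro (hor u3)) by rewrite /P; field.
    apply: ler_wpM2l; first by rewrite mulr_ge0 // ltW.
    by apply: ler_wpM2r => //; exact: ltW.
  have h2 : `|ver u3 * wedge (hor u1) (hor u2)| <= eta * P / 100.
    rewrite normrM; apply: le_trans (ler_pM (normr_ge0 _) (normr_ge0 _) c3 w2) _.
    have -> : eta * P / 100 = eta * fro (hor u3) *
      (fro (hor u1) * (1 / 100 * `|ver u2|)) by rewrite /P; field.
    apply: ler_wpM2l; first by rewrite mulr_ge0 // ltW.
    by apply: ler_wpM2l => //; exact: ltW.
  have h3 : `|y| <= eta * P / 50 by rewrite yE; apply: le_trans (ler_normD _ _) _; lra.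
  apply: (@le_trans _ _ (K * (eta * P / 50))); first by apply: ler_wpM2l => //; exact: ltW.
  have -> : K * (eta * P / 50) = (eta * K) * (P / 50) by field.
  apply: (@le_trans _ _ (1 / 400 * (P / 50))); last by lra.
  apply: ler_wpM2r; lra.
have x1 : P / 2 <= K * `|x|.
  have -> : P / 2 = K * (`|ver u2| * (K^-1 / 2 * (fro (hor u1) * fro (hor u3)))).
    by rewrite /P; field; exact: lt0r_neq0.
  rewrite xE normrM; apply: ler_wpM2l; first exact: ltW.
  by apply: ler_wpM2l.
have x2 : `|x| <= P.
  by rewrite xE normrM; apply: ler_wpM2l => //; exact: wedge_le.
have y2 : `|y| <= P.
  have : `|y| <= K * `|y| by rewrite ler_peMl.
  lra.
rewrite dE; split; last by have := ler_normB x y; lra.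
have : `|x| <= `|x - y| + `|y| by have := ler_normD (x - y) y; rewrite subrK.
move=> h; have : K * `|x| <= K * (`|x - y| + `|y|) by apply: ler_wpM2l => //; exact: ltW.
lra.
Qed.

(** The middle vector is the cross product of the two transverse orbits of the dual chain: its
    vertical part is, up to sign, their wedge, bounded below by transversality, and its horizontal
    part is small because both lie in the cone. *)
Lemma frame_orbit n B g : chain n B g ->
  exists u1 u2 u3 : nat -> 'cV[R]_3,
  [/\ forall i, (i <= n.+1)%N -> frame_at (u1 i) (u2 i) (u3 i) /\
        \det (frame (u1 i) (u2 i) (u3 i)) = 1,
    forall i, (i <= n)%N -> [/\ u1 i = B i *m u1 i.+1, u2 i = B i *m u2 i.+1 &
        u3 i = B i *m u3 i.+1],
    forall i, (i <= n)%N -> 50 * fro (hor (u1 i.+1)) <= fro (hor (u1 i)) <=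
        (2 * K + 4) * fro (hor (u1 i.+1)),
    forall i, (i <= n)%N -> 50 * fro (hor (u3 i)) <= fro (hor (u3 i.+1)) <=
        (2 * K + 4) * fro (hor (u3 i)) &
    forall i, (i <= n)%N -> `|ver (u2 i)| <= 2 * `|ver (u2 i.+1)| /\
        `|ver (u2 i.+1)| <= 2 * `|ver (u2 i)|].
Proof.
move=> ch; have [K1 _ eps_eta etaK] := constants.
have [eta0 eta1 eps1 _] := cone_constants_small constants.
have K0 : 0 < K by lra.
have [u [w [uw_cone uw_eq uw_grow uw_tr]]] := transverse_orbits ch.
have [f [f' [ff_cone ff_eq _ ff_tr]]] := transverse_orbits (block_chain_dual ch).
have uB i : (i <= n)%N -> B i \in unitmx.
  by move=> lei; have [dB _ _ _ _] := ch.1 i lei; rewrite unitmxE dB unitr1.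
have weq i : (i <= n)%N -> w i = B i *m w i.+1.
  by move=> lei; have [_ ->] := uw_eq i lei; rewrite mulmxA mulmxV ?mul1mx ?uB.
pose z i := cross (f i) (f' i).
have zeq i : (i <= n)%N -> z i = B i *m z i.+1.
  move=> lei; have [dB _ _ _ _] := ch.1 i lei; have [e1 e2] := ff_eq i lei.
  rewrite /z mul_cross // -e1 e2 mulmxA mulmxV ?mul1mx //.
  by rewrite unitmx_tr unitmx_inv uB.
have zcone i : (i <= n.+1)%N -> frame_at (u i) (z i) (w i).
  move=> lei; have [c1 c3] := uw_cone i lei.
  have [[p1 q1] [p2 q2]] := ff_cone i lei; have tr := ff_tr i lei.
  have pp : 0 < fro (hor (f i)) * fro (hor (f' i)) by exact: mulr_gt0.
  have vz : K^-1 / 2 * (fro (hor (f i)) * fro (hor (f' i))) <= `|ver (z i)|.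
    by rewrite ver_cross normrN.
  split=> //; last exact: uw_tr.
    by apply: lt_le_trans vz; rewrite mulr_gt0 // divr_gt0 // invr_gt0.
  have hz : fro (hor (z i)) <= 2 * eta * (fro (hor (f i)) * fro (hor (f' i))).
    rewrite hor_cross; apply: le_trans (fro_add _ _) _; rewrite froN !froZ !fro_rot2.
    have : `|ver (f' i)| * fro (hor (f i)) <= eta * fro (hor (f' i)) * fro (hor (f i)).
      by apply: ler_wpM2r => //; exact: fro_ge0.
    have : `|ver (f i)| * fro (hor (f' i)) <= eta * fro (hor (f i)) * fro (hor (f' i)).
      by apply: ler_wpM2r => //; exact: fro_ge0.
    lra.
  apply: le_trans hz _; apply: (@le_trans _ _ (1 / 100 *
      (K^-1 / 2 * (fro (hor (f i)) * fro (hor (f' i)))))); last by lra.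
  rewrite !mulrA; apply: ler_wpM2r; first exact: fro_ge0.
  apply: ler_wpM2r; first exact: fro_ge0.
  have : eta * K * K^-1 <= 1 / 400 * K^-1.
    by apply: ler_wpM2r; [rewrite invr_ge0 ltW | lra].
  rewrite mulfK ?gt_eqF //; lra.
pose F i := frame (u i) (z i) (w i).
have Feq i : (i <= n)%N -> F i = B i *m F i.+1.
  by move=> lei; rewrite /F mul_frame -zeq // -weq //; have [<- _] := uw_eq i lei.
have dF i : (i <= n.+1)%N -> \det (F i) = \det (F 0%N).
  elim: i => // i IH lei; rewrite -IH ?(ltnW lei) // [in RHS]Feq //.
  by have [dB _ _ _ _] := ch.1 i lei; rewrite det_mulmx dB mul1r.
have d0 : \det (F 0%N) != 0.
  have [h _] := det_frame_bounds (zcone 0%N (leq0n _)).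
  have [[p1 _] [p3 _] p2 _ _] := zcone 0%N (leq0n _).
  apply: contraTneq isT => e; move: h; rewrite -/(F 0%N) e normr0 mulr0.
  by rewrite leNgt !mulr_gt0.
(* The determinant is constant along the chain. Scaling the middle vector alone makes it 1 and keeps
   the conditions on that vector, which are homogeneous. *)
have [d dE] : exists d, d = (\det (F 0%N))^-1 by eexists.
have dn : d != 0 by rewrite dE invr_eq0.
have dp : 0 < `|d| by rewrite normr_gt0.
exists u, (fun i => d *: z i), w; split=> i lei.
- have [c1 c3 p2 c2 tr] := zcone i lei; split.
    split=> //; first by rewrite verZ normrM mulr_gt0.
    by rewrite verZ horZ froZ normrM mulrCA ler_pM2l.
  have -> : \det (frame (u i) (d *: z i) (w i)) = d * \det (F i).
    by rewrite !det_mx33 !mxE /=; ring.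
  by rewrite dF // dE mulVf.
- by split; rewrite -?scalemxAr -?zeq // -?weq //; have [] := uw_eq i lei.
- have [e1 _] := uw_grow i lei; rewrite e1 /=.
  have [-> _] := uw_eq i lei; have [c _] := uw_cone i.+1 lei.
  have [hB _] := fro_block ch lei; have hc := cone_fro c.
  apply: le_trans (fro_hor _) (le_trans (fro_mul _ _) _).
  have := ler_pM (fro_ge0 _) (fro_ge0 _) hB hc; lra.
- have [_ e1] := uw_grow i lei; rewrite e1 /=.
  have [_ ->] := uw_eq i lei; have [_ c] := uw_cone i (leqW lei).
  have [_ hB] := fro_block ch lei; have hc := cone_fro c.
  apply: le_trans (fro_hor _) (le_trans (fro_mul _ _) _).
  have := ler_pM (fro_ge0 _) (fro_ge0 _) hB hc; lra.
(* As [blk] fixes the vertical part, only the perturbation changes it, by at most a half. *)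
rewrite !verZ !normrM ![2 * _]mulrCA !ler_pM2l //.
have [_ _ p2 c2 _] := zcone i.+1 lei.
have [_ _ _ _ [hB _]] := ch.1 i lei.
have -> : ver (z i) = ver (z i.+1) + ver ((B i - blk (g i)) *m z i.+1).
  by rewrite zeq // -{1}(subrK (blk (g i)) (B i)) mulmxDl verD ver_blk addrC.
have e : `|ver ((B i - blk (g i)) *m z i.+1)| <= 1 / 2 * `|ver (z i.+1)|.
  apply: le_trans (norm_ver _) (le_trans (fro_mul _ _) _).
  have := fro_le_hor_ver (z i.+1) => h.
  have eps4 : fro (B i - blk (g i)) <= 1 / 4.
    have : eta <= eta * K by rewrite ler_peMr.
    lra.
  have := ler_pM (fro_ge0 _) (fro_ge0 _) eps4 h; lra.
have := ler_normD (ver (z i.+1)) (ver ((B i - blk (g i)) *m z i.+1)).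
have := ler_normB (ver (z i.+1) + ver ((B i - blk (g i)) *m z i.+1))
  (ver ((B i - blk (g i)) *m z i.+1)).
rewrite addrK; lra.
Qed.

End Frames.

(** * From frames to points of a flat *)

Section FlatFrames.
Variable R : realType.
Local Notation "'o1'" := (lift ord0 ord0).
Local Notation "'o2'" := (lift ord0 (lift ord0 ord0)).

Fixpoint mxprod (B : nat -> 'M[R]_3) j : 'M[R]_3 :=
  if j is i.+1 then mxprod B i *m B i else 1%:M.

Lemma increments_ge (f : nat -> R) c n :
  (forall i, (i < n)%N -> c <= f i.+1 - f i) ->
  forall i j, (i <= j <= n)%N -> c * (j - i)%:R <= f j - f i.
Proof.
move=> h i j /andP [ij jn]; elim: j ij jn => [|j IH] ij jn.
  by move: ij; rewrite leqn0 => /eqP ->; rewrite subnn mulr0 subrr.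
move: ij; rewrite leq_eqVlt => /orP [/eqP <-|ij].
  by rewrite subnn mulr0 subrr.
have := IH ij (ltnW jn); have := h j jn.
by rewrite subSn // -(natr1 (j - i)) mulrDr mulr1; lra.
Qed.

Lemma ln_mul_le (a b c : R) : 0 < a -> 0 < b -> 0 < c ->
  c * a <= b -> ln c <= ln b - ln a.
Proof.
move=> a0 b0 c0 h; have : ln (c * a) <= ln b by rewrite ler_ln ?posrE ?mulr_gt0.
by rewrite lnM ?posrE //; lra.
Qed.

Variables (K eps eta : R).
Hypothesis constants : cone_constants K eps eta.

(** [F 0] is the product of the first [j] blocks times [F j], so pulling the flat back by that
    product leaves the frame at [j], whose columns [expd (s j)] rescales to bounded length. The
    roots of [s] grow because the first column shrinks and the third grows at rate 50, while the
    middle one changes by a factor at most 2. *)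
Lemma flat_frame n B g : block_chain K eps n B g ->
  exists (h : 'M[R]_3) (s : nat -> 'rV[R]_3),
  [/\ SL3 h, forall j, (j <= n.+1)%N -> \sum_k s j ord0 k = 0 /\
        fro (invmx (mxprod B j) *m (h *m expd (s j))) <= 9 * K,
    forall i j r, (i <= j <= n.+1)%N ->
       (ln 50 - ln 2) * (j - i)%:R - (ln 2 + ln (4 * K)) <=
       simple_root r (s j - s i),
    forall i j, (i <= j <= n.+1)%N ->
       fro (s j - s i) <= 4 * ln (2 * K + 4) * (j - i)%:R &
    50 ^+ n.+1 <= 2 * fro (mxprod B n.+1)].
Proof.
move=> ch; have [K1 _ _ _] := constants.
have [u1 [u2 [u3 [fr eqs gr1 gr3 gr2]]]] := frame_orbit constants ch.
pose a i := fro (hor (u1 i)); pose b i := `|ver (u2 i)|.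
pose c i := fro (hor (u3 i)).
have pos i : (i <= n.+1)%N -> [/\ 0 < a i, 0 < b i & 0 < c i].
  by move=> /fr [[[p1 _] [p3 _] p2 _ _] _].
pose F i := frame (u1 i) (u2 i) (u3 i).
have FE i : (i <= n.+1)%N -> F 0%N = mxprod B i *m F i.
  elim: i => [|i IH] lei /=; first by rewrite mul1mx.
  have [e1 e2 e3] := eqs i lei.
  have Fs : F i = B i *m F i.+1 by rewrite /F mul_frame -e1 -e2 -e3.
  by rewrite IH ?(ltnW lei) // -mulmxA -Fs.
have dP i : (i <= n.+1)%N -> \det (mxprod B i) = 1.
  elim: i => [|i IH] lei /=; first by rewrite det1.
  by have [dB _ _ _ _] := ch.1 i lei; rewrite det_mulmx IH ?(ltnW lei) // dB mulr1.
have vol i : (i <= n.+1)%N -> b i * (a i * c i) <= 4 * K /\ 1 <= 2 * (b i * (a i * c i)).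
  by move=> lei; have [f1 d1] := fr i lei; have := det_frame_bounds constants f1;
    rewrite d1 normr1 mulr1.
(* The middle entry is ln a + ln c rather than - ln b, so that the entries sum to 0; the two differ
   by a bounded amount because a b c lies between 1 / 2 and 4 K. *)
pose s i : 'rV[R]_3 := \row_k nth 0 [:: - ln (a i); ln (a i) + ln (c i); - ln (c i)] k.
have U0 : 0 < 2 * K + 4 by lra.
have logs : [/\ forall i j, (i <= j <= n.+1)%N -> ln 50 * (j - i)%:R <= ln (a i) - ln (a j),
    forall i j, (i <= j <= n.+1)%N -> ln (a i) - ln (a j) <= ln (2 * K + 4) * (j - i)%:R,
    forall i j, (i <= j <= n.+1)%N -> ln 50 * (j - i)%:R <= ln (c j) - ln (c i),
    forall i j, (i <= j <= n.+1)%N -> ln (c j) - ln (c i) <= ln (2 * K + 4) * (j - i)%:R &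
    forall i j, (i <= j <= n.+1)%N -> ln (b i) - ln (b j) <= ln 2 * (j - i)%:R /\
      ln (b j) - ln (b i) <= ln 2 * (j - i)%:R].
  split=> [i j|i j|i j|i j|i j] ij.
  - have := @increments_ge (fun i => - ln (a i)) (ln 50) n.+1 _ i j ij.
    rewrite opprK [X in _ <= X]addrC; apply=> k lek; rewrite opprK addrC.
    have [p _ _] := pos k (leqW lek); have [p1 _ _] := pos k.+1 lek.
    by apply: ln_mul_le => //; have /andP [] := gr1 k lek.
  - have := @increments_ge (fun i => ln (a i)) (- ln (2 * K + 4)) n.+1 _ i j ij.
    rewrite mulNr; suff h : forall k, (k < n.+1)%N -> - ln (2 * K + 4) <= ln (a k.+1) - ln (a k).
      by move=> /(_ h); lra.
    move=> k lek; have [p _ _] := pos k (leqW lek); have [p1 _ _] := pos k.+1 lek.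
    have /andP [_ h] := gr1 k lek.
    have : ln (a k) <= ln ((2 * K + 4) * a k.+1) by rewrite ler_ln ?posrE ?mulr_gt0.
    by rewrite lnM ?posrE //; lra.
  - apply: (@increments_ge (fun i => ln (c i)) (ln 50) n.+1 _ i j ij) => k lek.
    have [_ _ p] := pos k (leqW lek); have [_ _ p1] := pos k.+1 lek.
    by apply: ln_mul_le => //; have /andP [] := gr3 k lek.
  - have := @increments_ge (fun i => - ln (c i)) (- ln (2 * K + 4)) n.+1 _ i j ij.
    rewrite mulNr; suff h : forall k, (k < n.+1)%N -> - ln (2 * K + 4) <= - ln (c k.+1) - - ln (c k).
      by move=> /(_ h); lra.
    move=> k lek; have [_ _ p] := pos k (leqW lek); have [_ _ p1] := pos k.+1 lek.
    have /andP [_ h] := gr3 k lek.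
    have : ln (c k.+1) <= ln ((2 * K + 4) * c k) by rewrite ler_ln ?posrE ?mulr_gt0.
    by rewrite lnM ?posrE //; lra.
  have lb k : (k < n.+1)%N -> ln (b k) <= ln 2 + ln (b k.+1) /\
      ln (b k.+1) <= ln 2 + ln (b k).
    move=> lek; have [_ p _] := pos k (leqW lek); have [_ p1 _] := pos k.+1 lek.
    have [h1 h2] := gr2 k lek.
    by rewrite -!lnM ?posrE // !ler_ln ?posrE ?mulr_gt0.
  have h1 := @increments_ge (fun i => - ln (b i)) (- ln 2) n.+1 _ i j ij.
  have h2 := @increments_ge (fun i => ln (b i)) (- ln 2) n.+1 _ i j ij.
  split.
    have : forall k, (k < n.+1)%N -> - ln 2 <= ln (b k.+1) - ln (b k).
      by move=> k /lb; lra.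
    by move=> /h2; rewrite mulNr; lra.
  have : forall k, (k < n.+1)%N -> - ln 2 <= - ln (b k.+1) - - ln (b k).
    by move=> k /lb; lra.
  by move=> /h1; rewrite mulNr; lra.
case: logs => la1 la2 lc1 lc2 lb.
have lvol i : (i <= n.+1)%N -> - ln 2 <= ln (a i) + ln (b i) + ln (c i) <= ln (4 * K).
  move=> lei; have [p1 p2 p3] := pos i lei; have [v1 v2] := vol i lei.
  have p : 0 < b i * (a i * c i) by rewrite !mulr_gt0.
  have e : ln (b i * (a i * c i)) = ln (b i) + (ln (a i) + ln (c i)).
    by rewrite !lnM ?posrE ?mulr_gt0.
  apply/andP; split.
    have : ln 1 <= ln (2 * (b i * (a i * c i))) by rewrite ler_ln ?posrE ?mulr_gt0.
    by rewrite ln1 lnM ?posrE // e; lra.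
  have : ln (b i * (a i * c i)) <= ln (4 * K).
    by rewrite ler_ln ?posrE //; lra.
  by rewrite e; lra.
exists (F 0%N), s; split.
- by have [_ d1] := fr 0%N (leq0n _).
- move=> j lej; split; first by rewrite big_ord3 !mxE /=; ring.
  have [p1 p2 p3] := pos j lej; have [[c1 c3 q2 c2 _] _] := fr j lej.
  have uP : mxprod B j \in unitmx by rewrite unitmxE dP // unitr1.
  rewrite (FE j lej) -mulmxA mulKmx //.
  have K0 : 0 < K by lra.
  rewrite -ler_sqr ?nnegrE ?fro_ge0 ?mulr_ge0 ?(ltW K0) //.
  rewrite fro_frame_expd !mxE /= !expRN expRD !lnK ?posrE //.
  have h1 : (a j)^-1 * fro (u1 j) <= 2.
    by rewrite ler_pdivrMl // mulrC (cone_fro constants c1).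
  have h3 : (c j)^-1 * fro (u3 j) <= 2.
    by rewrite ler_pdivrMl // mulrC (cone_fro constants c3).
  have h2 : a j * c j * fro (u2 j) <= 8 * K.
    have f2 : fro (u2 j) <= 2 * b j.
      by have := fro_le_hor_ver (u2 j); rewrite /b; move: q2 c2; lra.
    have [v1 _] := vol j lej.
    apply: (@le_trans _ _ (a j * c j * (2 * b j))); last by lra.
    by apply: ler_wpM2l => //; rewrite mulr_ge0 // ltW.
  have g1 : 0 <= (a j)^-1 * fro (u1 j) by rewrite mulr_ge0 ?invr_ge0 ?fro_ge0 // ltW.
  have g2 : 0 <= a j * c j * fro (u2 j) by rewrite !mulr_ge0 ?fro_ge0 // ltW.
  have g3 : 0 <= (c j)^-1 * fro (u3 j) by rewrite mulr_ge0 ?invr_ge0 ?fro_ge0 // ltW.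
  move: K1 h1 h2 h3 g1 g2 g3; clear.
  move: (_ * fro (u1 j)) (_ * fro (u2 j)) (_ * fro (u3 j)) => x y z.
  move=> K1 h1 h2 h3 g1 g2 g3.
  have : x ^+ 2 <= 4 by nra.
  have : z ^+ 2 <= 4 by nra.
  have : y ^+ 2 <= 64 * K ^+ 2 by nra.
  have : 1 <= K ^+ 2 by nra.
  lra.
- move=> i j r ij; have := lvol i; have := lvol j; have [ij1 jn] := andP ij.
  move=> /(_ jn) /andP [v1 v2] /(_ (leq_trans ij1 jn)) /andP [v3 v4].
  have := la1 i j ij; have := lc1 i j ij; have [] := lb i j ij.
  move: (j - i)%:R => x h1 h2 h3 h4.
  have xx : (ln 50 - ln 2) * x = ln 50 * x - ln 2 * x by rewrite mulrBl.
  rewrite xx simple_rootB /simple_root !mxE.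
  by case: (ord2P r) => -> /=; lra.
- move=> i j ij; apply: le_trans (fro_le_sum _) _; rewrite big_ord1 big_ord3 !mxE /=.
  have := la1 i j ij; have := la2 i j ij; have := lc1 i j ij; have := lc2 i j ij.
  have l50 : 0 <= ln 50 * (j - i)%:R :> R.
    by rewrite mulr_ge0 // ln_ge0 //; lra.
  move=> h1 h2 h3 h4.
  have -> : `|- ln (a j) - - ln (a i)| = ln (a i) - ln (a j).
    by rewrite ger0_norm; lra.
  have -> : `|- ln (c j) - - ln (c i)| = ln (c j) - ln (c i).
    by rewrite -normrN ger0_norm; lra.
  have : `|ln (a j) + ln (c j) - (ln (a i) + ln (c i))| <=
      2 * (ln (2 * K + 4) * (j - i)%:R) by rewrite ler_norml; apply/andP; split; lra.
  lra.
(* The product carries the first column at n + 1 to the one at 0, whose horizontal part is 50^(n+1)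
   times longer; this bounds its norm below. *)
have grow j : (j <= n.+1)%N -> 50 ^+ j * a j <= a 0%N.
  elim: j => [|j IH] lej; first by rewrite expr0 mul1r.
  apply: le_trans (IH (ltnW lej)); rewrite exprSr -mulrA.
  by apply: ler_wpM2l; [rewrite exprn_ge0 // ler0n | have /andP [] := gr1 j lej].
have := grow n.+1 (leqnn _); have [p _ _] := pos n.+1 (leqnn _).
have [[c1 _ _ _ _] _] := fr n.+1 (leqnn _); have := cone_fro constants c1.
have uE j : (j <= n.+1)%N -> u1 0%N = mxprod B j *m u1 j.
  elim: j => [|j IH] lej /=; first by rewrite mul1mx.
  by have [e1 _ _] := eqs j lej; rewrite IH ?(ltnW lej) // -mulmxA -e1.
have := fro_mul (mxprod B n.+1) (u1 n.+1); rewrite -uE // => h1 h2 h3.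
have h4 := fro_hor (u1 0%N).
have h5 : fro (mxprod B n.+1) * fro (u1 n.+1) <= fro (mxprod B n.+1) * (2 * a n.+1).
  by apply: ler_wpM2l => //; exact: fro_ge0.
rewrite -(ler_pM2r p); rewrite -/(a 0%N) in h4; move: h1 h3 h4 h5; lra.
Qed.

End FlatFrames.

(** * The octagon group *)

Section Octagon.
Variable R : realType.
Local Notation q := (Num.sqrt 2 : R).

Lemma sqrt2_sqr : q * q = 2. Proof. by rewrite -expr2 sqr_sqrtr. Qed.

Lemma sqrt2_bounds : 1414 / 1000 <= q <= 1415 / 1000.
Proof.
have := sqrt2_sqr; have : 0 <= q by exact: sqrtr_ge0.
move: (q) => x x0 xx; apply/andP; split; nra.
Qed.

Lemma cos_pi4 : cos (pi / 4) = q / 2.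
Proof.
have h : cos (pi / 4 *+ 2) = 0 :> R.
  by rewrite -mulr_natr -[RHS]cos_pihalf; congr cos; field.
have c0 : 0 < cos (pi / 4) :> R.
  by have := @pi_gt0 R => p0; apply: cos_gt0_pihalf; apply/andP; split; lra.
move: h; rewrite cos_mulr2n; move: (cos _) c0 => x x0 h.
apply/eqP; rewrite -(@eqrXn2 _ 2) ?divr_ge0 ?sqrtr_ge0 ?(ltW x0) //; apply/eqP.
have := sqrt2_sqr; move: h; rewrite mulr2n !expr2.
by move: (q) => y h yy; lra.
Qed.

Lemma sin_pi4 : sin (pi / 4) = q / 2.
Proof.
have h : sin (pi / 4 *+ 2) = 1 :> R.
  by rewrite -mulr_natr -[RHS]sin_pihalf; congr sin; field.
move: h; rewrite sin_mulr2n cos_pi4 mulr2n; move: (sin _) => x h.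
have := sqrt2_sqr; have /andP [q1 _] := sqrt2_bounds.
by move: (q) q1 h => y q1 h yy; nra.
Qed.

Lemma cot_pi8 : cot (pi / 8) = 1 + q.
Proof.
have e : pi / 8 *+ 2 = pi / 4 :> R by rewrite -mulr_natr; field.
have := @cos_mulr2n R (pi / 8); have := @sin_mulr2n R (pi / 8).
rewrite e cos_pi4 sin_pi4 /cot !mulr2n.
have s0 : 0 < sin (pi / 8) :> R.
  by have := @pi_gt0 R => p0; apply: sin_gt0_pihalf; apply/andP; split; lra.
move: (sin _) (cos _) s0 => s c s0 h1 h2.
have := sqrt2_sqr; move: (q) h1 h2 => x h1 h2 xx.
have e1 : c * (x / 2) = (1 + x / 2) * s.
  have -> : 1 + x / 2 = c ^+ 2 + c ^+ 2 by rewrite h2; ring.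
  rewrite h1; ring.
have e2 : c * (x * x / 2) = (x + x * x / 2) * s.
  rewrite (_ : c * _ = x * (c * (x / 2))); last by field.
  by rewrite e1; field.
have -> : c = (1 + x) * s by rewrite xx in e2; lra.
by rewrite mulfK // gt_eqF.
Qed.

(* Coordinates of 2x2 matrices in the basis 1, J, Z, X of the quaternion
   algebra M_2(R). *)
Definition quat (x0 x1 y1 y2 : R) : 'M[R]_2 := \matrix_(i, j)
  if i == ord0 then (if j == ord0 then x0 + y1 else y2 + x1)
  else (if j == ord0 then y2 - x1 else x0 - y1).

Lemma quatM a0 a1 b1 b2 c0 c1 d1 d2 :
  quat a0 a1 b1 b2 *m quat c0 c1 d1 d2 =
  quat (a0 * c0 - a1 * c1 + b1 * d1 + b2 * d2)
       (a0 * c1 + a1 * c0 + b1 * d2 - b2 * d1)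
       (a0 * d1 + b1 * c0 + a1 * d2 - b2 * c1)
       (a0 * d2 + b2 * c0 - a1 * d1 + b1 * c1).
Proof.
apply/matrixP => i j; rewrite !mxE big_ord2 !mxE /=.
by case: (ord2P i) => ->; case: (ord2P j) => -> /=; ring.
Qed.

Lemma det_quat a0 a1 b1 b2 :
  \det (quat a0 a1 b1 b2) = a0 ^+ 2 + a1 ^+ 2 - b1 ^+ 2 - b2 ^+ 2.
Proof. by rewrite det_mx22 !mxE /=; ring. Qed.

Lemma fro_quat a0 a1 b1 b2 : fro (quat a0 a1 b1 b2) ^+ 2 =
  2 * (a0 ^+ 2 + a1 ^+ 2 + b1 ^+ 2 + b2 ^+ 2).
Proof. by rewrite fro_sqr !big_ord2 !mxE /=; ring. Qed.

Lemma quat1 : quat 1 0 0 0 = 1%:M.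
Proof.
apply/matrixP => i j; rewrite !mxE.
by case: (ord2P i) => ->; case: (ord2P j) => -> /=; ring.
Qed.

Lemma invmx_quat a0 a1 b1 b2 : \det (quat a0 a1 b1 b2) = 1 ->
  invmx (quat a0 a1 b1 b2) = quat a0 (- a1) (- b1) (- b2).
Proof.
rewrite det_quat => d; apply: mulmx1_invmx; rewrite quatM -quat1 -d.
congr quat; ring.
Qed.

(* Half the trace, and the two other coordinates, of h h^T: a point of the
   hyperboloid model of the hyperbolic plane. *)
Definition hyp0 (h : 'M[R]_2) : R := fro h ^+ 2 / 2.
Definition hyp1 (h : 'M[R]_2) : R :=
  (h ord0 ord0 ^+ 2 + h ord0 ord_max ^+ 2
   - h ord_max ord0 ^+ 2 - h ord_max ord_max ^+ 2) / 2.
Definition hyp2 (h : 'M[R]_2) : R :=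
  h ord0 ord0 * h ord_max ord0 + h ord0 ord_max * h ord_max ord_max.

Lemma hyp_eq h : \det h = 1 -> hyp1 h ^+ 2 + hyp2 h ^+ 2 = hyp0 h ^+ 2 - 1.
Proof.
move=> dh.
have e : hyp1 h ^+ 2 + hyp2 h ^+ 2 = hyp0 h ^+ 2 - (\det h) ^+ 2.
  rewrite det_mx22 /hyp1 /hyp2 /hyp0 fro_sqr !big_ord2.
  by move: (h _ _) (h _ _) (h _ _) (h _ _) => a b c d; field.
by rewrite e dh expr1n.
Qed.

Lemma fro_quat_inv_mul (c y1 y2 : R) h : c ^+ 2 - y1 ^+ 2 - y2 ^+ 2 = 1 ->
  fro (invmx (quat c 0 y1 y2) *m h) ^+ 2 =
  2 * ((c ^+ 2 + y1 ^+ 2 + y2 ^+ 2) * hyp0 h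
       - 2 * c * (y1 * hyp1 h + y2 * hyp2 h)).
Proof.
move=> cy; rewrite invmx_quat; last by rewrite det_quat -cy; ring.
by rewrite /hyp1 /hyp2 /hyp0 !fro_sqr !big_ord2 !mxE !big_ord2 !mxE /=; field.
Qed.

(* The square root of h h^T moved along its geodesic to the distance fixed by
   the operator norm [e]. *)
Lemma geodesic_point h (e : R) : \det h = 1 -> 1 <= e -> 2 * e ^+ 2 <= fro h ^+ 2 ->
  exists k : 'M[R]_2, [/\ \det k = 1, fro k ^+ 2 <= 2 * e ^+ 2 &
    fro (invmx k *m h) ^+ 2 * e ^+ 2 <= 2 * fro h ^+ 2].
Proof.
move=> dh e1 eh; have := hyp_eq dh.
have pE : fro h ^+ 2 = 2 * hyp0 h by rewrite /hyp0; field.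
rewrite pE in eh *; have [w1 w1E] : exists w, w = hyp1 h by eexists.
have [w2 w2E] : exists w, w = hyp2 h by eexists.
have [p pE'] : exists w, w = hyp0 h by eexists.
rewrite -w1E -w2E -pE' in eh * => w.
have pe : e ^+ 2 <= p by lra.
have p1 : 1 <= p by nra.
have e0 : e != 0 by rewrite gt_eqF //; lra.
have [p2|p2] := leP p 1.
  have pp : p = 1 by lra.
  have ee : e ^+ 2 = 1 by nra.
  exists 1%:M; rewrite det1 invmx1 mul1mx ee pE -pE' pp; split=> //; last by lra.
  by rewrite -quat1 fro_quat; lra.
have [r rE] : exists r, r = Num.sqrt (p ^+ 2 - 1) by eexists.
have rr : r ^+ 2 = p ^+ 2 - 1 by rewrite rE sqr_sqrtr //; nra.
have r0 : 0 < r by rewrite rE sqrtr_gt0; nra.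
have rn : r != 0 by rewrite gt_eqF.
pose c := (e + e^-1) / 2; pose s := (e - e^-1) / 2.
have ww : (w1 / r) ^+ 2 + (w2 / r) ^+ 2 = 1.
  by rewrite !expr_div_n -mulrDl w rr mulfV // -rr sqrf_eq0.
have cs : c ^+ 2 - s ^+ 2 = 1 by rewrite /c /s; field.
have cy : c ^+ 2 - (s * (w1 / r)) ^+ 2 - (s * (w2 / r)) ^+ 2 = 1.
  by rewrite !exprMn -addrA -opprD -mulrDr -!exprMn ww mulr1 cs.
have i1 : e^-1 ^+ 2 <= 1.
  by rewrite exprVn invf_le1 ?exprn_gt0 ?expr_ge1 //; lra.
exists (quat c 0 (s * (w1 / r)) (s * (w2 / r))); split.
- by rewrite det_quat -cy; ring.
- rewrite fro_quat expr0n addr0 -addrA !exprMn -mulrDr -!exprMn ww mulr1.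
  rewrite (_ : 2 * (c ^+ 2 + s ^+ 2) = e ^+ 2 + e^-1 ^+ 2); last first.
    by rewrite /c /s; field.
  nra.
rewrite fro_quat_inv_mul // -w1E -w2E -pE'.
have -> : 2 * ((c ^+ 2 + (s * (w1 / r)) ^+ 2 + (s * (w2 / r)) ^+ 2) * p -
    2 * c * (s * (w1 / r) * w1 + s * (w2 / r) * w2)) =
    2 * ((c ^+ 2 + s ^+ 2) * p - 2 * c * s * r).
  have -> : s * (w1 / r) * w1 + s * (w2 / r) * w2 = s * r.
    have -> : s * (w1 / r) * w1 + s * (w2 / r) * w2 = s * ((w1 ^+ 2 + w2 ^+ 2) / r).
      by field.
    by rewrite w -rr; field.
  rewrite -addrA !exprMn -mulrDr -!exprMn ww mulr1; ring.
have -> : 2 * ((c ^+ 2 + s ^+ 2) * p - 2 * c * s * r) * e ^+ 2 =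
    e ^+ 4 * (p - r) + (p + r) by rewrite /c /s; field.
have rp : r <= p by nra.
have pr : (p - r) * (p + r) = 1 by rewrite -subr_sqr rr; ring.
have e4 : e ^+ 4 <= p ^+ 2.
  have -> : e ^+ 4 = e ^+ 2 * e ^+ 2 by ring.
  by rewrite [X in _ <= X]expr2 ler_pM ?sqr_ge0.
have : p ^+ 2 * (p - r) <= p by nra.
have : e ^+ 4 * (p - r) <= p ^+ 2 * (p - r) by apply: ler_wpM2r => //; lra.
lra.
Qed.

(** The eight directions are pi / 4 apart, so one lies within pi / 8 of (w1, w2), a vector of length
    sqrt (p^2 - 1); for p >= 30 the constant 0.919 stays below cos (pi / 8) * sqrt (1 - p^-2). *)
Lemma octagon_direction (p w1 w2 : R) : 30 <= p ->
  w1 ^+ 2 + w2 ^+ 2 = p ^+ 2 - 1 ->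
  exists c s, [/\ (c, s) \in [:: (1, 0); (-1, 0); (0, 1); (0, -1);
     (q / 2, q / 2); (q / 2, - (q / 2)); (- (q / 2), q / 2); (- (q / 2), - (q / 2))] &
     919 / 1000 * p <= c * w1 + s * w2].
Proof.
move=> p30 w.
have /andP [q1 _] := sqrt2_bounds; have qq := sqrt2_sqr.
have main a b : 0 <= a -> 0 <= b -> a ^+ 2 + b ^+ 2 = p ^+ 2 - 1 ->
    919 / 1000 * p <= a \/ 919 / 1000 * p <= b \/ 919 / 1000 * p <= q / 2 * (a + b).
  move=> a0 b0 ab.
  have [h1|h1] := lerP (919 / 1000 * p) a; first by left.
  have [h2|h2] := lerP (919 / 1000 * p) b; first by right; left.
  right; right; rewrite leNgt; apply/negP => h3.
  have a2 : a ^+ 2 < 845 / 1000 * p ^+ 2 by nra.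
  have b2 : b ^+ 2 < 845 / 1000 * p ^+ 2 by nra.
  have s2 : (a + b) ^+ 2 < 2 * (845 / 1000) * p ^+ 2.
    have h4 : 0 <= q / 2 * (a + b) by rewrite mulr_ge0 ?addr_ge0 // divr_ge0 // sqrtr_ge0.
    have h5 : (q / 2 * (a + b)) ^+ 2 < (919 / 1000 * p) ^+ 2 by nra.
    have h6 : (q / 2 * (a + b)) ^+ 2 = (a + b) ^+ 2 / 2.
      by rewrite exprMn expr_div_n [q ^+ 2]expr2 qq; field.
    nra.
  have p2 : 900 <= p ^+ 2 by nra.
  have d2 : (2 * a * b) ^+ 2 = 4 * a ^+ 2 * b ^+ 2 by ring.
  move: a2 b2 s2 p2 ab; clear -a0 b0.
  rewrite (_ : (a + b) ^+ 2 = a ^+ 2 + b ^+ 2 + 2 * (a * b)); last by ring.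
  move=> a2 b2 s2 p2 ab.
  have c1 : 153 / 1000 * p ^+ 2 <= a ^+ 2 by lra.
  have c2 : a * b < 346 / 1000 * p ^+ 2 by lra.
  have c3 : 0 <= a * b by exact: mulr_ge0.
  have c4 : (a * b) ^+ 2 = a ^+ 2 * b ^+ 2 by rewrite exprMn.
  move: c4 c2 c3 c1 a2 b2 ab p2; move: (a ^+ 2) (b ^+ 2) (a * b) (p ^+ 2).
  move=> A B C P c4 c2 c3 c1 a2 b2 ab p2.
  (* A + B = P - 1 and A, B < 0.845 P force A B > 0.129 P^2, whereas 0.346^2 < 0.12. *)
  have c5 : C ^+ 2 < (346 / 1000 * P) ^+ 2 by nra.
  nra.
have := main `|w1| `|w2| (normr_ge0 _) (normr_ge0 _).
rewrite !real_normK ?num_real // => /(_ w) [|[|]].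
  case: (leP 0 w1) => w1s h.
    exists 1, 0; rewrite !inE eqxx; split=> //; move: h; rewrite ger0_norm //; lra.
  exists (-1), 0; rewrite !inE eqxx orbT; split=> //; move: h; rewrite ltr0_norm //; lra.
  case: (leP 0 w2) => w2s h.
    exists 0, 1; rewrite !inE eqxx !orbT; split=> //; move: h; rewrite ger0_norm //; lra.
  exists 0, (-1); rewrite !inE eqxx !orbT; split=> //; move: h; rewrite ltr0_norm //; lra.
case: (leP 0 w1) => w1s; case: (leP 0 w2) => w2s h.
- exists (q / 2), (q / 2); rewrite !inE eqxx !orbT; split=> //; move: h.
  rewrite !ger0_norm //; lra.
- exists (q / 2), (- (q / 2)); rewrite !inE eqxx !orbT; split=> //; move: h.
  rewrite ger0_norm // ltr0_norm //; lra.
- exists (- (q / 2)), (q / 2); rewrite !inE eqxx !orbT; split=> //; move: h.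
  rewrite ltr0_norm // ger0_norm //; lra.
exists (- (q / 2)), (- (q / 2)); rewrite !inE eqxx !orbT; split=> //; move: h.
rewrite !ltr0_norm //; lra.
Qed.

End Octagon.

(** * Arithmetic and cocompactness of the octagon group *)

Section Group.
Variable R : realType.
Local Notation q := (Num.sqrt 2 : R).

Lemma generated_subgroup (A : set 'M[R]_3) : A `<=` SL3 ->
  is_subgroup (generated A).
Proof.
have sSL : is_subgroup (SL3 : set 'M[R]_3).
  split=> // [|g h|g]; [exact: det1 | exact: SL3_mul | exact: SL3_inv].
move=> sA; split.
- by move=> g; apply.
- by move=> X [[_ X1 _ _] _].
- by move=> g h Gg Gh X XX; case: (XX) => [[_ _ Xm _] _]; apply: Xm; [exact: Gg|exact: Gh].
- by move=> g Gg X XX; case: (XX) => [[_ _ _ Xi] _]; apply: Xi; exact: Gg.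
Qed.

Lemma generated_sub (A : set 'M[R]_3) : A `<=` generated A.
Proof. by move=> g Ag X [_]; apply. Qed.

Lemma generated_min (A X : set 'M[R]_3) : is_subgroup X -> A `<=` X ->
  generated A `<=` X.
Proof. by move=> sX AX g; apply. Qed.

(* Pairs of conjugate elements of Z[sqrt 2]. *)
Definition conj_pair (a a' : R) : Prop :=
  exists m n : int, a = m%:~R + n%:~R * q /\ a' = m%:~R - n%:~R * q.

Lemma conj_pairD a a' b b' : conj_pair a a' -> conj_pair b b' ->
  conj_pair (a + b) (a' + b').
Proof.
move=> [m [n [-> ->]]] [k [l [-> ->]]]; exists (m + k), (n + l).
by rewrite !rmorphD /=; split; ring.
Qed.

Lemma conj_pairN a a' : conj_pair a a' -> conj_pair (- a) (- a').
Proof.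
move=> [m [n [-> ->]]]; exists (- m), (- n).
by rewrite !rmorphN /=; split; ring.
Qed.

Lemma conj_pairM a a' b b' : conj_pair a a' -> conj_pair b b' ->
  conj_pair (a * b) (a' * b').
Proof.
move=> [m [n [-> ->]]] [k [l [-> ->]]]; exists (m * k + 2 * (n * l)), (m * l + n * k).
rewrite !rmorphD /= !rmorphM /=; have := sqrt2_sqr R; move: (q) => x xx.
have e : (2 : int)%:~R = x * x :> R by rewrite xx.
by rewrite e; split; ring.
Qed.

Lemma conj_pair_int (m : int) : conj_pair m%:~R m%:~R.
Proof. by exists m, 0; rewrite mul0r addr0 subr0. Qed.

Lemma conj_pair_sqrt2 : conj_pair q (- q).
Proof. by exists 0, 1; rewrite !mul1r add0r sub0r. Qed.

Lemma finite_conj_pair (M : R) :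
  finite_set [set a : R | exists a', [/\ conj_pair a a', `|a| <= M & `|a'| <= M]].
Proof.
have [N MN] : exists N : nat, M <= N%:R.
  exists (Num.bound `|M|).
  exact: le_trans (ler_norm _) (ltW (archi_boundP (normr_ge0 _))).
pose f (p : nat * nat) : R :=
  (p.1%:R - N%:R) + (p.2%:R - N%:R) * q.
apply: (@sub_finite_set _ _ (f @` (`I_(N.*2.+1) `*` `I_(N.*2.+1)))); last first.
  by apply/finite_image/finite_setX; exact: finite_II.
move=> a [a' [[m [n [-> ->]]] h1 h2]].
have /andP [q1 _] := sqrt2_bounds R.
have hm : `|m%:~R : R| <= N%:R.
  have := ler_normD (m%:~R + n%:~R * q) (m%:~R - n%:~R * q).
  have -> : m%:~R + n%:~R * q + (m%:~R - n%:~R * q) = 2 * m%:~R :> R by ring.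
  by rewrite normrM normr_nat; lra.
have hn : `|n%:~R : R| <= N%:R.
  have := ler_normB (m%:~R + n%:~R * q) (m%:~R - n%:~R * q).
  have -> : m%:~R + n%:~R * q - (m%:~R - n%:~R * q) = 2 * q * n%:~R :> R by ring.
  rewrite normrM ger0_norm; last by lra.
  have := normr_ge0 (n%:~R : R); move: (`|n%:~R|) => z z0 h.
  have : 2 * z <= 2 * q * z by apply: ler_wpM2r => //; lra.
  lra.
have nat_of (k : int) : `|k%:~R : R| <= N%:R ->
    exists2 p : nat, (p < N.*2.+1)%N & k%:~R = p%:R - N%:R :> R.
  rewrite -intr_norm -[N%:R]/((N%:Z)%:~R) ler_int => hk.
  exists `|(k + N%:Z)%R|%N; first by lia.
  have e : `|(k + N%:Z)%R|%N%:Z = k + N%:Z by lia.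
  by rewrite -[(absz _)%:R]/((absz _)%:Z%:~R) e rmorphD /= addrK.
have [x xN ->] := nat_of _ hm; have [y yN ->] := nat_of _ hn.
by exists (x, y).
Qed.

Variable lambda : R.
Hypotheses (lambda_gt1 : 1 < lambda) (lambdaE : ln lambda = acosh (cot (pi / 8))).
Definition sinhl : R := locked ((lambda - lambda^-1) / 2).
(** Chosen so that mu^2 = 1 + sqrt 2, whose conjugate 1 - sqrt 2 is negative: this sign makes the
    conjugate norm form of [arith] definite. *)
Definition mu : R := locked (sinhl / q).

Lemma cosh_acosh (c : R) : 1 <= c -> cosh (acosh c) = c.
Proof.
move=> c1; suff h : exists x, 0 <= x /\ cosh x = c.
  by have [] := @xgetPex R 0 [set x | 0 <= x /\ cosh x = c] h.
pose r := Num.sqrt (c ^+ 2 - 1).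
have rr : r ^+ 2 = c ^+ 2 - 1 by rewrite sqr_sqrtr //; nra.
have r0 : 0 <= r by exact: sqrtr_ge0.
have E1 : 1 <= c + r by lra.
exists (ln (c + r)); split; first exact: ln_ge0.
rewrite /cosh expRN lnK ?posrE; last by lra.
have -> : (c + r)^-1 = c - r.
  apply: (mulfI (x := c + r)); first by rewrite gt_eqF //; lra.
  rewrite mulfV; last by rewrite gt_eqF //; lra.
  rewrite (_ : (c + r) * (c - r) = c ^+ 2 - r ^+ 2); last by ring.
  by rewrite rr; ring.
by field.
Qed.

Lemma lambda_cosh : (lambda + lambda^-1) / 2 = 1 + q.
Proof.
have q0 : 0 <= q by exact: sqrtr_ge0.
have := @cosh_acosh (1 + q); rewrite -cot_pi8 -lambdaE /cosh expRN lnK; last first.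
  by rewrite posrE (lt_trans ltr01).
by apply; rewrite cot_pi8 lerDl.
Qed.

Lemma sinhl_gt0 : 0 < sinhl.
Proof.
have : lambda^-1 < 1 by rewrite invf_lt1 // (lt_trans ltr01).
by move: lambda_gt1 => h1 h2; rewrite /sinhl -lock; lra.
Qed.

Lemma sinhl_sqr : sinhl ^+ 2 = 2 + 2 * q.
Proof.
have l0 : lambda != 0 by rewrite gt_eqF // (lt_trans ltr01).
have -> : sinhl ^+ 2 = ((lambda + lambda^-1) / 2) ^+ 2 - 1 by rewrite /sinhl -lock; field.
by rewrite lambda_cosh; have := sqrt2_sqr R; move: (q) => x xx; lra.
Qed.

Lemma q_neq0 : q != 0. Proof. by rewrite gt_eqF // sqrtr_gt0. Qed.

Lemma mu_sqr : mu ^+ 2 = 1 + q.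
Proof.
by rewrite /mu -lock expr_div_n sinhl_sqr [q ^+ 2]expr2 sqrt2_sqr; move: (q) => x; lra.
Qed.

(** A translation of the hyperbolic plane in the direction (c, s). For the generator of angle theta
    this direction has angle - 2 theta ([gen_mxE]), so the four generators and their inverses point
    in eight equally spaced directions. *)
Definition oct (c s : R) : 'M[R]_2 := quat (1 + q) 0 (sinhl * c) (sinhl * s).

Lemma gen_mxE theta : gen_mx lambda theta =
  blk (oct (cos theta ^+ 2 - sin theta ^+ 2) (- (2 * (sin theta * cos theta)))).
Proof.
have l0 : lambda != 0 by rewrite gt_eqF // (lt_trans ltr01).
have h := cos2Dsin2 theta; rewrite /oct -lambda_cosh.
have -> : (lambda + lambda^-1) / 2 =
    (lambda + lambda^-1) / 2 * (cos theta ^+ 2 + sin theta ^+ 2) by rewrite h mulr1.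
rewrite /gen_mx /sinhl -lock; apply/matrixP => i j; rewrite !mxE !big_ord3 !mxE !big_ord3 !mxE /=.
by case: (ord3P i) => ->; case: (ord3P j) => -> /=; field.
Qed.

Definition Gam : set 'M[R]_2 := [set g | Gamma2 lambda (blk g)].

Lemma cos_sin_pi8 : cos (pi / 8) ^+ 2 - sin (pi / 8) ^+ 2 = q / 2 :> R /\
  2 * (sin (pi / 8) * cos (pi / 8)) = q / 2 :> R.
Proof.
have e : pi / 8 *+ 2 = pi / 4 :> R by rewrite mulr2n; field.
have := @cos_mulr2n R (pi / 8); have := @sin_mulr2n R (pi / 8).
rewrite e cos_pi4 sin_pi4 !mulr2n; have := cos2Dsin2 (pi / 8 : R).
by move: (cos _) (sin _) (q) => c s x h h1 h2; split; lra.
Qed.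

Lemma pihalfB (x : R) : cos (pi / 2 - x) = sin x /\ sin (pi / 2 - x) = cos x.
Proof.
by rewrite cosB sinB cos_pihalf sin_pihalf; split; ring.
Qed.

Lemma gen_mx_values :
  [/\ gen_mx lambda 0 = blk (oct 1 0), gen_mx lambda (pi / 8) = blk (oct (q / 2) (- (q / 2))),
      gen_mx lambda (pi / 4) = blk (oct 0 (-1)) &
      gen_mx lambda (3 * pi / 8) = blk (oct (- (q / 2)) (- (q / 2)))].
Proof.
rewrite !gen_mxE; split.
- by rewrite cos0 sin0; congr (blk (oct _ _)); ring.
- by have [-> ->] := cos_sin_pi8.
- rewrite cos_pi4 sin_pi4; have := sqrt2_sqr R; move: (q) => x xx.
  by congr (blk (oct _ _)); lra.
have -> : 3 * pi / 8 = pi / 2 - pi / 8 :> R by field.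
have [-> ->] := pihalfB (pi / 8); have [h1 h2] := cos_sin_pi8.
by rewrite [cos _ * _]mulrC h2 -opprB h1.
Qed.

Lemma oct_det c s : c ^+ 2 + s ^+ 2 = 1 -> \det (oct c s) = 1.
Proof.
move=> cs; rewrite det_quat !exprMn -addrA -opprD -mulrDr cs sinhl_sqr mulr1.
by have := sqrt2_sqr R; move: (q) => x xx; lra.
Qed.

(* Elements of an order in a quaternion algebra over Q(sqrt 2); the second norm
   equation, conjugate to the first, is positive definite and bounds a0', a1',
   b1' and b2'. *)
Definition arith (g : 'M[R]_2) : Prop :=
  exists a0 a0' a1 a1' b1 b1' b2 b2' : R,
  [/\ conj_pair a0 a0', conj_pair a1 a1', conj_pair b1 b1', conj_pair b2 b2' &
   [/\ g = quat a0 a1 (mu * b1) (mu * b2),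
    a0 ^+ 2 + a1 ^+ 2 - (1 + q) * (b1 ^+ 2 + b2 ^+ 2) = 1 &
    a0' ^+ 2 + a1' ^+ 2 - (1 - q) * (b1' ^+ 2 + b2' ^+ 2) = 1]].

Lemma arith_det g : arith g -> \det g = 1.
Proof.
move=> [a0 [? [a1 [? [b1 [? [b2 [? [_ _ _ _ [-> h _]]]]]]]]]].
by rewrite det_quat !exprMn mu_sqr -[RHS]h; ring.
Qed.

Lemma arithM g h : arith g -> arith h -> arith (g *m h).
Proof.
move=> [a0 [a0' [a1 [a1' [b1 [b1' [b2 [b2' [pa0 pa1 pb1 pb2 [-> N1 N2]]]]]]]]]].
move=> [c0 [c0' [c1 [c1' [d1 [d1' [d2 [d2' [pc0 pc1 pd1 pd2 [-> M1 M2]]]]]]]]]].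
have pt : conj_pair (1 + q) (1 - q).
  by apply: conj_pairD; [exact: (conj_pair_int 1) | exact: conj_pair_sqrt2].
exists (a0 * c0 - a1 * c1 + (1 + q) * (b1 * d1 + b2 * d2)),
  (a0' * c0' - a1' * c1' + (1 - q) * (b1' * d1' + b2' * d2')),
  (a0 * c1 + a1 * c0 + (1 + q) * (b1 * d2 - b2 * d1)),
  (a0' * c1' + a1' * c0' + (1 - q) * (b1' * d2' - b2' * d1')),
  (a0 * d1 + b1 * c0 + a1 * d2 - b2 * c1),
  (a0' * d1' + b1' * c0' + a1' * d2' - b2' * c1'),
  (a0 * d2 + b2 * c0 - a1 * d1 + b1 * c1),
  (a0' * d2' + b2' * c0' - a1' * d1' + b1' * c1').
split.
1-4: by do ![assumption | apply: conj_pairD | apply: conj_pairN | apply: conj_pairM].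
split.
- by rewrite quatM -mu_sqr; congr quat; ring.
- rewrite -[RHS]mulr1 -[X in _ = X * _]N1 -[X in _ = _ * X]M1; ring.
- rewrite -[RHS]mulr1 -[X in _ = X * _]N2 -[X in _ = _ * X]M2; ring.
Qed.

Lemma arith_inv g : arith g -> arith (invmx g).
Proof.
move=> ag; have dg := arith_det ag; move: ag dg.
move=> [a0 [a0' [a1 [a1' [b1 [b1' [b2 [b2' [pa0 pa1 pb1 pb2 [-> N1 N2]]]]]]]]]] dg.
exists a0, a0', (- a1), (- a1'), (- b1), (- b1'), (- b2), (- b2').
split; rewrite ?sqrrN //; try exact: conj_pairN.
by split; rewrite ?sqrrN // invmx_quat // !mulrN.
Qed.

Lemma arith1 : arith 1%:M.
Proof.
exists 1, 1, 0, 0, 0, 0, 0, 0.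
have p0 := conj_pair_int 0; have p1 := conj_pair_int 1.
by split=> //; split; [rewrite -quat1 mulr0 | ring | ring].
Qed.

Lemma sinhl_mu : sinhl = mu * q. Proof. by rewrite /mu -lock divfK // q_neq0. Qed.

(** Multiplied by sqrt 2, the eight directions have coordinates 0, 1, -1, sqrt 2 or - sqrt 2, all in
    Z[sqrt 2], and [sinhl] is mu * sqrt 2. *)
Lemma arith_oct b1 b1' b2 b2' : conj_pair b1 b1' -> conj_pair b2 b2' ->
  b1 ^+ 2 + b2 ^+ 2 = 2 -> b1' ^+ 2 + b2' ^+ 2 = 2 ->
  arith (quat (1 + q) 0 (mu * b1) (mu * b2)).
Proof.
move=> p1 p2 h h'; exists (1 + q), (1 - q), 0, 0, b1, b1', b2, b2'.
have qq := sqrt2_sqr R.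
split=> //; first by apply: conj_pairD; [exact: (conj_pair_int 1) | exact: conj_pair_sqrt2].
  exact: (conj_pair_int 0).
by split=> //; rewrite ?h ?h'; move: (q) qq => x xx; lra.
Qed.

Lemma Gamma2_arith g : Gamma2 lambda g -> exists2 k, arith k & g = blk k.
Proof.
move: g; apply: generated_min.
  split.
  - by move=> g [k ak ->]; rewrite /SL3 /= det_blk arith_det.
  - by exists 1%:M; [exact: arith1 | rewrite blk1].
  - move=> g h [k ak ->] [l al ->]; exists (k *m l); first exact: arithM.
    by rewrite blkM.
  - move=> g [k ak ->]; exists (invmx k); first exact: arith_inv.
    by rewrite blk_inv // arith_det.
have [e1 e2 e3 e4] := gen_mx_values.
have q2 : q ^+ 2 = 2 by rewrite expr2 sqrt2_sqr.
have p0 := conj_pair_int 0; have p1 := conj_pair_int 1.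
have pm := conj_pairN p1; have pq := conj_pair_sqrt2; have pmq := conj_pairN pq.
have yq : sinhl * (q / 2) = mu.
  by rewrite {1}sinhl_mu -!mulrA (mulrA q) sqrt2_sqr mulfV // mulr1.
move=> _ [_ [[[->|->]|->]|->] <-].
- rewrite e1; exists (oct 1 0) => //.
  have -> : oct 1 0 = quat (1 + q) 0 (mu * q) (mu * 0).
    by rewrite /oct -sinhl_mu mulr1 !mulr0.
  by apply: (arith_oct pq p0); rewrite ?sqrrN q2; ring.
- rewrite e2; exists (oct (q / 2) (- (q / 2))) => //.
  have -> : oct (q / 2) (- (q / 2)) = quat (1 + q) 0 (mu * 1) (mu * -1).
    by rewrite /oct mulrN yq mulr1 mulrN1.
  by apply: (arith_oct p1 pm); ring.
- rewrite e3; exists (oct 0 (-1)) => //.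
  have -> : oct 0 (-1) = quat (1 + q) 0 (mu * 0) (mu * - q).
    by rewrite /oct mulrN [mu * - q]mulrN -sinhl_mu mulr1 !mulr0.
  by apply: (arith_oct p0 pmq); rewrite ?opprK ?sqrrN q2; ring.
- rewrite e4; exists (oct (- (q / 2)) (- (q / 2))) => //.
  have -> : oct (- (q / 2)) (- (q / 2)) = quat (1 + q) 0 (mu * -1) (mu * -1).
    by rewrite /oct mulrN yq mulrN1.
  by apply: (arith_oct pm pm); ring.
Qed.

Lemma Gamma2_subgroup : is_subgroup (Gamma2 lambda).
Proof.
apply: generated_subgroup => _ [t _ <-].
by rewrite gen_mxE /SL3 /= det_blk oct_det //; have := cos2Dsin2 t; 
  move: (cos t) (sin t) => c s h; nra.
Qed.

Lemma Gam_det g : Gam g -> \det g = 1.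
Proof.
by move=> /Gamma2_arith [k ak /blk_inj ->]; exact: arith_det.
Qed.

Lemma Gam1 : Gam 1%:M.
Proof. by rewrite /Gam /= blk1; case: Gamma2_subgroup. Qed.

Lemma GamM g h : Gam g -> Gam h -> Gam (g *m h).
Proof. by rewrite /Gam /= blkM; case: Gamma2_subgroup => _ _ hm _; exact: hm. Qed.

Lemma GamV g : Gam g -> Gam (invmx g).
Proof.
move=> Gg; rewrite /Gam /= blk_inv ?(Gam_det Gg) //.
by case: Gamma2_subgroup => _ _ _; exact.
Qed.

Lemma Gamma2_blk g : Gamma2 lambda g -> exists2 k, Gam k & g = blk k.
Proof. by move=> Gg; have [k _ e] := Gamma2_arith Gg; exists k; rewrite /Gam /= -?e. Qed.

Lemma Gam_oct c s : (c, s) \in [:: (1, 0); (-1, 0); (0, 1); (0, -1);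
     (q / 2, q / 2); (q / 2, - (q / 2)); (- (q / 2), q / 2); (- (q / 2), - (q / 2))] ->
  c ^+ 2 + s ^+ 2 = 1 /\ Gam (oct c s).
Proof.
have [e1 e2 e3 e4] := gen_mx_values.
have q2 : (q / 2) ^+ 2 = 1 / 2 by rewrite expr_div_n expr2 sqrt2_sqr; field.
have gen t : [set 0; pi / 8; pi / 4; 3 * pi / 8] t -> Gamma2 lambda (gen_mx lambda t).
  by move=> ht; apply: generated_sub; exists t.
have inv c0 s0 : c0 ^+ 2 + s0 ^+ 2 = 1 -> Gam (oct c0 s0) -> Gam (oct (- c0) (- s0)).
  move=> cs /GamV; rewrite /oct invmx_quat ?oppr0 ?mulrN //; exact: oct_det.
have g1 : Gam (oct 1 0) by rewrite /Gam /= -e1; apply: gen; left; left; left.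
have g2 : Gam (oct (q / 2) (- (q / 2))) by rewrite /Gam /= -e2; apply: gen; left; left; right.
have g3 : Gam (oct 0 (-1)) by rewrite /Gam /= -e3; apply: gen; left; right.
have g4 : Gam (oct (- (q / 2)) (- (q / 2))) by rewrite /Gam /= -e4; apply: gen; right.
have n1 : (1 : R) ^+ 2 + 0 ^+ 2 = 1 by ring.
have n3 : (0 : R) ^+ 2 + (-1) ^+ 2 = 1 by ring.
have n2 : (q / 2) ^+ 2 + (- (q / 2)) ^+ 2 = 1 by rewrite sqrrN q2; field.
have n4 : (- (q / 2)) ^+ 2 + (- (q / 2)) ^+ 2 = 1 by rewrite !sqrrN q2; field.
rewrite !inE => /orP [|/orP [|/orP [|/orP [|/orP [|/orP [|/orP [|]]]]]]] /eqP [-> ->].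
- by [].
- by have := inv _ _ n1 g1; rewrite oppr0 sqrrN.
- by have := inv _ _ n3 g3; rewrite oppr0 opprK; split=> //; ring.
- by [].
- by have := inv _ _ n4 g4; rewrite opprK; split=> //; rewrite q2; field.
- by [].
- by have := inv _ _ n2 g2; rewrite opprK; split=> //; rewrite sqrrN q2; field.
- by [].
Qed.

Lemma fro_oct c s : c ^+ 2 + s ^+ 2 = 1 -> fro (oct c s) ^+ 2 <= 60.
Proof.
move=> cs; rewrite fro_quat !exprMn expr0n addr0 -addrA -mulrDr cs mulr1 sinhl_sqr.
have /andP [_ q1] := sqrt2_bounds R; have := sqrt2_sqr R.
by move: (q) q1 => x x1 xx; nra.
Qed.

(* Among the eight side pairings of the octagon one decreases the
   displacement by a definite factor. *)
Lemma reduction h : \det h = 1 -> 60 < fro h ^+ 2 ->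
  exists g, [/\ Gam g, fro g ^+ 2 <= 60 &
    fro (invmx g *m h) ^+ 2 <= 19 / 20 * fro h ^+ 2].
Proof.
move=> dh h60; have p30 : 30 <= hyp0 h by rewrite /hyp0; lra.
have [c [s [cs dir]]] := octagon_direction p30 (hyp_eq dh).
have [cs1 Go] := Gam_oct cs.
exists (oct c s); split; [exact: Go | exact: fro_oct | ].
have -> : fro h ^+ 2 = 2 * hyp0 h by rewrite /hyp0; field.
have d : (1 + q) ^+ 2 - (sinhl * c) ^+ 2 - (sinhl * s) ^+ 2 = 1.
  by have := oct_det cs1; rewrite det_quat expr0n addr0.
rewrite /oct fro_quat_inv_mul //.
have -> : (1 + q) ^+ 2 + (sinhl * c) ^+ 2 + (sinhl * s) ^+ 2 = 5 + 4 * q.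
  rewrite !exprMn -addrA -mulrDr cs1 mulr1 sinhl_sqr.
  by have := sqrt2_sqr R; move: (q) => x xx; lra.
have -> : 2 * (1 + q) * (sinhl * c * hyp1 h + sinhl * s * hyp2 h) =
  2 * (1 + q) * sinhl * (c * hyp1 h + s * hyp2 h) by ring.
have y2 := sinhl_sqr; have y0 := sinhl_gt0; have /andP [q1 q2] := sqrt2_bounds R.
move: y2 y0 q1 q2 dir p30; clear.
move: sinhl (q) (hyp0 h) (c * hyp1 h + s * hyp2 h) => z x p d z2 z0 x1 x2 dir p30.
(* 10.57 * 0.919 > 9.71 and 5 + 4 sqrt 2 <= 10.66, which leaves a factor below 19 / 20. *)
have z1 : 219 / 100 <= z by nra.
have w1 : 1057 / 100 <= 2 * (1 + x) * z by nra.
have h1 : 1057 / 100 * (919 / 1000 * p) <= 2 * (1 + x) * z * (919 / 1000 * p).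
  by apply: ler_wpM2r w1; lra.
have h2 : 2 * (1 + x) * z * (919 / 1000 * p) <= 2 * (1 + x) * z * d.
  by apply: ler_wpM2l dir; lra.
have h3 : x * p <= 1415 / 1000 * p by apply: ler_wpM2r x2; lra.
by move: (2 * (1 + x) * z * d) h2 => D h2; lra.
Qed.

(** Each [reduction] multiplies the squared norm by at most 19 / 20, and Bernoulli's inequality
    provides a sufficient number of them. Geometrically, the action on the hyperbolic plane is
    cocompact. *)
Lemma orbit_cover h : \det h = 1 ->
  exists2 g, Gam g & fro (invmx g *m h) ^+ 2 <= 60.
Proof.
have bern n : 1 + n%:R / 19 <= (20 / 19 : R) ^+ n.
  elim: n => [|n IH]; first by rewrite expr0 mul0r addr0.
  rewrite exprS -natr1; have n0 : 0 <= n%:R :> R by exact: ler0n.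
  nra.
have : exists n, fro h ^+ 2 <= 60 * (20 / 19 : R) ^+ n.
  have [N hN] : exists N : nat, fro h ^+ 2 <= N%:R.
    by exists (Num.bound (fro h ^+ 2)); exact: ltW (archi_boundP (sqr_ge0 _)).
  exists N; have := bern N; have n0 : 0 <= N%:R :> R by exact: ler0n.
  lra.
move=> [n]; elim: n h => [|n IH] h hn dh.
  by exists 1%:M; [exact: Gam1 | rewrite invmx1 mul1mx; move: hn; rewrite expr0 mulr1].
have [h60|h60] := leP (fro h ^+ 2) 60.
  by exists 1%:M; [exact: Gam1 | rewrite invmx1 mul1mx].
have [g [Gg _ gh]] := reduction dh h60.
have [|| k Gk hk] := IH (invmx g *m h).
- by apply: le_trans gh _; move: hn; rewrite (exprS (20 / 19) n); lra.
- by rewrite det_mulmx det_inv (Gam_det Gg) dh invr1 mulr1.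
exists (g *m k); first exact: GamM.
by rewrite invmxM ?unitmx_SL2 ?Gam_det // -mulmxA.
Qed.

(** The norm bounds the coordinates and the definite conjugate equation bounds their conjugates by
    less than 3, so only finitely many elements of Z[sqrt 2] can occur as coordinates. *)
Lemma finite_ball (L : R) : finite_set [set g | Gam g /\ fro g <= L].
Proof.
pose A := [set a : R | exists a', [/\ conj_pair a a', `|a| <= `|L| + 3 & `|a'| <= `|L| + 3]].
pose f (p : R * R * R * R) := quat p.1.1.1 p.1.1.2 (mu * p.1.2) (mu * p.2).
apply: (@sub_finite_set _ _ (f @` (A `*` A `*` A `*` A))); last first.
  by apply: finite_image; do !apply: finite_setX; exact: finite_conj_pair.
move=> g [/Gamma2_arith [k ak /blk_inj ->] gL]; move: ak gL.
move=> [a0 [a0' [a1 [a1' [b1 [b1' [b2 [b2' [pa0 pa1 pb1 pb2 [-> N1 N2]]]]]]]]]] gL.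
have L0 : 0 <= `|L| by exact: normr_ge0.
have {gL} : fro (quat a0 a1 (mu * b1) (mu * b2)) ^+ 2 <= `|L| ^+ 2.
  by rewrite ler_sqr ?nnegrE ?fro_ge0 //; apply: le_trans gL (ler_norm _).
rewrite fro_quat !exprMn mu_sqr; have /andP [q1 q2] := sqrt2_bounds R.
move: N1 N2 q1 q2 => N1 N2 q1 q2 gL.
have [s1 s2 s3 s4] : [/\ 0 <= b1 ^+ 2, 0 <= b2 ^+ 2, 0 <= a0 ^+ 2 & 0 <= a1 ^+ 2].
  by split; exact: sqr_ge0.
have [t1 t2 t3 t4] : [/\ 0 <= b1' ^+ 2, 0 <= b2' ^+ 2, 0 <= a0' ^+ 2 & 0 <= a1' ^+ 2].
  by split; exact: sqr_ge0.
have sq (x M : R) : 0 <= M -> x ^+ 2 <= M ^+ 2 -> `|x| <= M.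
  by move=> M0 h; rewrite -ler_sqr ?nnegrE // real_normK ?num_real.
have u1 : b1 ^+ 2 <= (1 + q) * b1 ^+ 2 by rewrite ler_peMl //; lra.
have u2 : b2 ^+ 2 <= (1 + q) * b2 ^+ 2 by rewrite ler_peMl //; lra.
have big : `|L| ^+ 2 <= (`|L| + 3) ^+ 2 by nra.
have nine : 9 <= (`|L| + 3) ^+ 2 by nra.
have v1 : 4 / 10 * b1' ^+ 2 <= (q - 1) * b1' ^+ 2 by apply: ler_wpM2r => //; lra.
have v2 : 4 / 10 * b2' ^+ 2 <= (q - 1) * b2' ^+ 2 by apply: ler_wpM2r => //; lra.
have N3 : a0' ^+ 2 + a1' ^+ 2 + (q - 1) * b1' ^+ 2 + (q - 1) * b2' ^+ 2 = 1.
  by rewrite -[RHS]N2; ring.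
have [m1 m2 m3 m4] : [/\ a0' ^+ 2 <= (`|L| + 3) ^+ 2, a1' ^+ 2 <= (`|L| + 3) ^+ 2,
    b1' ^+ 2 <= (`|L| + 3) ^+ 2 & b2' ^+ 2 <= (`|L| + 3) ^+ 2].
  by clear -N3 nine v1 v2 t1 t2 t3 t4; split; lra.
have [m5 m6 m7 m8] : [/\ a0 ^+ 2 <= (`|L| + 3) ^+ 2, a1 ^+ 2 <= (`|L| + 3) ^+ 2,
    b1 ^+ 2 <= (`|L| + 3) ^+ 2 & b2 ^+ 2 <= (`|L| + 3) ^+ 2].
  by clear -gL big u1 u2 s1 s2 s3 s4; split; lra.
have L3 : 0 <= `|L| + 3 by rewrite addr_ge0.
exists (a0, a1, b1, b2) => //; split; [split; [split|]|]; rewrite /A /=.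
- by exists a0'; split=> //; apply: sq.
- by exists a1'; split=> //; apply: sq.
- by exists b1'; split=> //; apply: sq.
- by exists b2'; split=> //; apply: sq.
Qed.

End Group.

(** * Hyperbolicity *)

Section Coarse.
Variables (R : realType) (T : Type) (P : T -> Prop) (d : T -> T -> R) (delta : R).

(** Vanishing on the diagonal is relaxed to [delta], since the function [hd] to which this is
    applied has value ln (sqrt 2) there. *)
Definition four_point : Prop :=
  [/\ forall x y, P x -> P y -> d x y = d y x,
      forall x y z, P x -> P y -> P z -> d x z <= d x y + d y z,
      forall x y, P x -> P y -> 0 <= d x y,
      forall x, P x -> d x x <= delta &
      forall x y z w, P x -> P y -> P z -> P w ->
        d x y + d z w <= d x z + d y w + delta \/
        d x y + d z w <= d x w + d y z + delta].

Hypothesis fp : four_point.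

(* Local-to-global principle: if every two consecutive steps gain at least
   2 delta + 1, the distances along the sequence keep growing. *)
Lemma coarse_growth (y : nat -> T) n a : 2 * delta + 1 <= a -> 0 <= delta ->
  (forall i, (i <= n)%N -> P (y i)) ->
  (forall i, (i.+2 <= n)%N -> d (y i) (y i.+1) + a <= d (y i) (y i.+2) /\
     d (y i.+1) (y i.+2) + a <= d (y i) (y i.+2)) ->
  forall i j, (i < j)%N -> (j < n)%N ->
    d (y i) (y j) + (a - delta) <= d (y i) (y j.+1).
Proof.
move=> a_big d0 Py step i j; elim: j => // j IH.
rewrite ltnS leq_eqVlt => /orP [/eqP <-|ij] jn.
  by have [h _] := step i jn; lra.
have {}IH := IH ij (ltnW jn); have [h5 h] := step j jn.
have [dC _ _ _ f] := fp.
have Pi : P (y i) by apply: Py; lia.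
have Pj : P (y j) by apply: Py; lia.
have Pj1 : P (y j.+1) by apply: Py; lia.
have Pj2 : P (y j.+2) by apply: Py; lia.
have := f _ _ _ _ Pi Pj1 Pj Pj2; rewrite (dC _ _ Pj1 Pj); case; lra.
Qed.

(** Distances from [y 0] grow up to [j.+1] and, by reversal, distances from [y n] grow down to [j].
    This rules out one alternative of the four-point condition for [y 0], [y j.+1], [y j], [y n];
    the other one is the claim up to one step. *)
Lemma coarse_geodesic (y : nat -> T) n a L : 2 * delta + 1 <= a -> 0 <= delta ->
  (forall i, (i <= n)%N -> P (y i)) ->
  (forall i, (i < n)%N -> d (y i) (y i.+1) <= L) ->
  (forall i, (i.+2 <= n)%N -> d (y i) (y i.+1) + a <= d (y i) (y i.+2) /\
     d (y i.+1) (y i.+2) + a <= d (y i) (y i.+2)) ->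
  forall j, (j <= n)%N ->
    d (y 0%N) (y j) + d (y j) (y n) <= d (y 0%N) (y n) + `|L| + delta.
Proof.
move=> a_big d0 Py len step j jn; have [dC _ _ dxx f] := fp.
have L0 := normr_ge0 L.
have [->|j0] := eqVneq j 0%N; first by have := dxx _ (Py 0%N (leq0n _)); lra.
have [->|jn1] := eqVneq j n; first by have := dxx _ (Py n (leqnn _)); lra.
have {}j0 : (0 < j)%N by rewrite lt0n.
have {}jn : (j < n)%N by rewrite ltn_neqAle jn1.
have g1 := @coarse_growth y n a a_big d0 Py step 0%N j j0 jn.
have Lj := le_trans (len j jn) (ler_norm _).
have [e|jn2] := eqVneq j.+1 n; first by rewrite e in g1 Lj *; lra.
have {}jn2 : (j.+1 < n)%N by rewrite ltn_neqAle jn2.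
have P0 := Py _ (leq0n n); have Pn := Py _ (leqnn n).
have Pj := Py _ (ltnW jn); have Pj1 := Py _ jn.
have g2 : d (y j.+1) (y n) + (a - delta) <= d (y j) (y n).
  have := @coarse_growth (fun i => y (n - i)%N) n a a_big d0.
  have h1 i : (i <= n)%N -> P (y (n - i)%N) by move=> _; apply: Py; exact: leq_subr.
  have h2 i : (i.+2 <= n)%N ->
      d (y (n - i)%N) (y (n - i.+1)%N) + a <= d (y (n - i)%N) (y (n - i.+2)%N) /\
      d (y (n - i.+1)%N) (y (n - i.+2)%N) + a <= d (y (n - i)%N) (y (n - i.+2)%N).
    move=> le; have le2 : ((n - i.+2).+2 <= n)%N by lia.
    have [] := step _ le2.
    have q0 := Py _ (leq_subr i n); have q1 := Py _ (leq_subr i.+1 n).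
    have q2 := Py _ (leq_subr i.+2 n).
    have -> : ((n - i.+2).+2 = n - i)%N by lia.
    have -> : ((n - i.+2).+1 = n - i.+1)%N by lia.
    by rewrite (dC _ _ q0 q1) (dC _ _ q0 q2) (dC _ _ q1 q2).
  move=> /(_ h1 h2 0%N (n - j.+1)%N); rewrite subn0.
  have -> : (n - (n - j.+1) = j.+1)%N by lia.
  have -> : (n - (n - j.+1).+1 = j)%N by lia.
  by rewrite (dC _ _ Pn Pj1) (dC _ _ Pn Pj); apply; lia.
have := f _ _ _ _ P0 Pj1 Pj Pn; rewrite (dC _ _ Pj1 Pj); case; lra.
Qed.

Definition thin_path (C r : R) (x z : T) n (p : nat -> T) : Prop :=
  [/\ p 0%N = x, p n = z, forall i, (i <= n)%N -> P (p i),
    forall i, (i < n)%N -> d x (p i.+1) <= d x (p i) + r &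
    forall i, (i <= n)%N -> d x (p i) + d (p i) z <= d x z + C].

(** A discrete intermediate value argument: the distance to the start increases by at most [r] at
    each step. *)
Lemma thin_path_at C r x z n p t c : 0 <= delta -> 0 <= r -> 0 <= c ->
  thin_path C r x z n p -> 0 <= t -> t <= d x z + c ->
  exists2 i, (i <= n)%N & `|d x (p i) - t| <= r + delta + c.
Proof.
move=> d0 r0 c0 [p0 pn Pp st _] t0 tle.
have [_ _ _ dxx _] := fp.
have start : d x (p 0%N) <= t + delta.
  by rewrite p0; have := dxx x; rewrite -{1}p0 => /(_ (Pp _ (leq0n _))); lra.
have : forall m, (m <= n)%N ->
    (exists2 i, (i <= m)%N & `|d x (p i) - t| <= r + delta + c) \/
    d x (p m) <= t + delta.
  elim=> [|m IH] mn; first by right.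
  case: (IH (ltnW mn)) => [[i im hi]|h]; first by left; exists i => //; exact: leqW.
  have [h1|h1] := lerP (d x (p m.+1)) (t + delta); first by right.
  left; exists m => //; have := st m mn; rewrite ler_norml => h2.
  by apply/andP; split; lra.
move=> /(_ n (leqnn _)) [//|h]; exists n => //.
by rewrite pn in h *; rewrite ler_norml; apply/andP; split; lra.
Qed.

(* In a tree, opposite sides whose lengths have the largest sum cross. *)
Lemma crossing C r x y z w n p m s : 0 <= delta -> 0 <= r -> 0 <= C ->
  P x -> P y -> P z -> P w ->
  thin_path C r x w n p -> thin_path C r y z m s ->
  d x y + d z w <= d x w + d y z + delta ->
  d x z + d y w <= d x w + d y z + delta ->
  exists i j, [/\ (i <= n)%N, (j <= m)%N & d (p i) (s j) <= 9 * C + 9 * r + 40 * delta].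
Proof.
move=> d0 r0 C0 Px Py Pz Pw tp ts h1 h2; have [dC tri dge dxx f] := fp.
(* The Gromov product of [y] and [w] at [x]: in a tree the segments from [x] to [y] and to [w]
   separate at this distance. *)
have [||i lei hi] := @thin_path_at C r x w n p ((d x y + d x w - d y w) / 2) 0 d0 r0 (lexx _) tp.
- have := tri _ _ _ Py Px Pw; rewrite (dC y x) //; lra.
- have := tri _ _ _ Px Pw Py; rewrite (dC w y) //; lra.
have [_ _ Pp _ thp] := tp; have [_ _ Ps _ ths] := ts.
have Pi := Pp _ lei; have ti := thp _ lei.
rewrite ler_norml in hi; have /andP [hi1 hi2] := hi.
have k1 : d (p i) y + d x w <= (d x y + d x w + d y w) / 2 + C + r + 2 * delta.
  have := f (p i) y x w Pi Py Px Pw.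
  rewrite (dC (p i) x Pi Px) (dC y x Py Px) => -[]; lra.
have k2 : d (p i) z <= d y z - d (p i) y + 2 * (C + r + 2 * delta) + delta.
  have := f (p i) z x w Pi Pz Px Pw.
  rewrite (dC (p i) x Pi Px) (dC z x Pz Px) => -[]; lra.
have [|||j lej hj] := @thin_path_at C r y z m s (d y (p i))
    (2 * (C + r + 2 * delta) + delta) d0 r0 _ ts.
- lra.
- exact: dge.
- by have := dge _ _ Pi Pz; rewrite (dC y (p i) Py Pi); lra.
exists i, j; split=> //.
have Pj := Ps _ lej; have tj := ths _ lej.
rewrite ler_norml in hj; have /andP [hj1 hj2] := hj.
have := f (p i) (s j) y z Pi Pj Py Pz.
rewrite (dC (s j) y Pj Py) (dC (p i) y Pi Py).
rewrite (dC (p i) y Pi Py) in k2.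
case; lra.
Qed.

End Coarse.

(** * The logarithm of the norm as a hyperbolic length *)

Section HyperbolicLength.
Variable R : realType.

(** An element moving the base point by t in curvature -1 has |g|^2 = 2 cosh t, so this is half the
    hyperbolic distance up to a bounded error. *)
Definition hd (x y : 'M[R]_2) : R := ln (fro (invmx x *m y)).

Lemma fro_SL2_ge1 (g : 'M[R]_2) : \det g = 1 -> 1 <= fro g.
Proof.
move=> dg; rewrite -ler_sqr ?nnegrE ?fro_ge0 // expr1n.
have := dg; rewrite fro_sqr !big_ord2 det_mx22.
have := sqr_ge0 (g ord0 ord0 - g ord_max ord_max).
have := sqr_ge0 (g ord0 ord_max + g ord_max ord0); lra.
Qed.

Lemma det_inv_mul (x y : 'M[R]_2) :
  \det x = 1 -> \det y = 1 -> \det (invmx x *m y) = 1.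
Proof. by move=> dx dy; rewrite det_mulmx det_inv dx dy invr1 mulr1. Qed.

Lemma fro_inv_mul_gt0 (x y : 'M[R]_2) :
  \det x = 1 -> \det y = 1 -> 0 < fro (invmx x *m y).
Proof.
by move=> dx dy; apply: lt_le_trans (fro_SL2_ge1 (det_inv_mul dx dy)).
Qed.

(** A Ptolemy inequality. The entries of x^T J y are wedges of columns of [x] and [y], and a
    Pluecker relation expresses each product of two of them through the other two pairings. Summing
    the 16 squared bounds gives the factor 4. *)
Lemma fro_four_point (x y z w : 'M[R]_2) :
  \det x = 1 -> \det y = 1 -> \det z = 1 -> \det w = 1 ->
  fro (invmx x *m y) * fro (invmx z *m w) <=
  4 * (fro (invmx x *m z) * fro (invmx y *m w) +
       fro (invmx x *m w) * fro (invmx y *m z)).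
Proof.
pose M (a b : 'M[R]_2) := a^T *m rot2 R *m b.
have ME a b : \det a = 1 -> fro (invmx a *m b) = fro (M a b).
  move=> da; rewrite invmx_SL2 // -!mulmxA fro_mulmx_tr ?trmxK ?mulmxA //.
  exact/mulmx1C/rot2_orthogonal.
move=> dx dy dz dw; rewrite !ME //.
set t := fro (M x z) * fro (M y w) + fro (M x w) * fro (M y z).
have t0 : 0 <= t by rewrite addr_ge0 // mulr_ge0 // fro_ge0.
have key i j k l : M x y i j ^+ 2 * M z w k l ^+ 2 <= t ^+ 2.
  rewrite -exprMn -(real_normK (num_real (_ * _))) ler_sqr ?nnegrE ?normr_ge0 //.
  have -> : M x y i j * M z w k l = M x z i k * M y w j l - M x w i l * M y z j k.
    by rewrite !mxE !big_ord2 !mxE !big_ord2 !mxE /=; ring.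
  apply: le_trans (ler_normB _ _) _; rewrite !normrM.
  by apply: lerD; apply: ler_pM => //; exact: fro_entry.
rewrite -ler_sqr ?nnegrE ?mulr_ge0 ?fro_ge0 // exprMn [in X in X * _]fro_sqr.
rewrite [in X in _ * X]fro_sqr !big_ord2.
have := key ord0 ord0 ord0 ord0; have := key ord0 ord0 ord0 ord_max.
have := key ord0 ord0 ord_max ord0; have := key ord0 ord0 ord_max ord_max.
have := key ord0 ord_max ord0 ord0; have := key ord0 ord_max ord0 ord_max.
have := key ord0 ord_max ord_max ord0; have := key ord0 ord_max ord_max ord_max.
have := key ord_max ord0 ord0 ord0; have := key ord_max ord0 ord0 ord_max.
have := key ord_max ord0 ord_max ord0; have := key ord_max ord0 ord_max ord_max.
have := key ord_max ord_max ord0 ord0; have := key ord_max ord_max ord0 ord_max.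
have := key ord_max ord_max ord_max ord0; have := key ord_max ord_max ord_max ord_max.
move: (M x y ord0 ord0 ^+ 2) (M x y ord0 ord_max ^+ 2) (M x y ord_max ord0 ^+ 2)
  (M x y ord_max ord_max ^+ 2) (M z w ord0 ord0 ^+ 2) (M z w ord0 ord_max ^+ 2)
  (M z w ord_max ord0 ^+ 2) (M z w ord_max ord_max ^+ 2).
clear key; move=> a1 a2 a3 a4 b1 b2 b3 b4; rewrite exprMn; move: (t ^+ 2) => t2; lra.
Qed.

Lemma hd_four_point : four_point (fun g : 'M[R]_2 => \det g = 1) hd (ln 8).
Proof.
have inv (x y : 'M[R]_2) : \det x = 1 -> \det y = 1 -> invmx (invmx x *m y) = invmx y *m x.
  by move=> dx dy; rewrite invmxM ?unitmx_inv ?unitmx_SL2 // invmxK.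
split.
- move=> x y dx dy; rewrite /hd -inv // fro_invmx_SL2 //; exact: det_inv_mul.
- move=> x y z dx dy dz; rewrite /hd -lnM ?posrE ?fro_inv_mul_gt0 //.
  rewrite ler_ln ?posrE ?mulr_gt0 ?fro_inv_mul_gt0 //.
  have -> : invmx x *m z = (invmx x *m y) *m (invmx y *m z).
    by rewrite mulmxA mulmxK ?unitmx_SL2.
  exact: fro_mul.
- by move=> x y dx dy; rewrite ln_ge0 // fro_SL2_ge1 // det_inv_mul.
- move=> x dx; rewrite /hd mulVmx ?unitmx_SL2 //.
  rewrite ler_ln ?posrE //; last first.
    by apply: lt_le_trans (fro_SL2_ge1 _); rewrite ?det1.
  rewrite -ler_sqr ?nnegrE ?fro_ge0 // -mxtrace_mul_tr trmx1 mulmx1 mxtrace1; lra.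
move=> x y z w dx dy dz dw.
have h := fro_four_point dx dy dz dw.
have p a b da db := @fro_inv_mul_gt0 a b da db.
have [pxy pzw pxz] := And3 (p _ _ dx dy) (p _ _ dz dw) (p _ _ dx dz).
have [pyw pxw pyz] := And3 (p _ _ dy dw) (p _ _ dx dw) (p _ _ dy dz).
rewrite /hd -!lnM ?posrE ?mulr_gt0 //.
have [le|le] := lerP (fro (invmx x *m w) * fro (invmx y *m z))
  (fro (invmx x *m z) * fro (invmx y *m w)); [left|right];
  rewrite ler_ln ?posrE ?mulr_gt0 //; lra.
Qed.

Lemma ln4_ge1 : 1 <= ln 4 :> R.
Proof.
rewrite -ler_expR lnK ?posrE //.
have -> : (1 : R) = 1 / 2 + 1 / 2 by field.
have h := expR_ge1Dx (- (1 / 2) : R); rewrite expRN in h.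
rewrite expRD; have := expR_gt0 (1 / 2 : R); move: (expR _) h => x h x0.
have : x <= 2.
  have : 1 / 2 * x <= x^-1 * x by apply: ler_wpM2r; [exact: ltW | lra].
  rewrite mulVf ?gt_eqF //; lra.
nra.
Qed.

End HyperbolicLength.

(** * Word length, thin geodesics and the four-point condition *)

Section Words.
Variables (R : realType) (lambda Lam : R) (S : seq 'M[R]_3).
Hypotheses (lambda_gt1 : 1 < lambda) (lambdaE : ln lambda = acosh (cot (pi / 8))).
Hypothesis LamE : 140 * 140 * 400 <= Lam.
Hypothesis SE : [set` S] = [set blk g | g in [set g | Gam lambda g /\ fro g <= Lam]].
Local Notation G := (Gam lambda).

Local Lemma Gdet g : G g -> \det g = 1.
Proof. exact: Gam_det. Qed.

Lemma Lam_gt1 : 1 < Lam. Proof. by apply: lt_le_trans LamE; lra. Qed.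

Lemma letter_mem g : G g -> fro g <= Lam -> blk g \in S.
Proof. by move=> Gg gL; have : [set` S] (blk g) by rewrite SE; exists g. Qed.

Lemma letterP x : x \in S \/ invmx x \in S ->
  exists g, [/\ G g, x = blk g & fro g <= Lam].
Proof.
have mem z : z \in S -> exists g, [/\ G g, z = blk g & fro g <= Lam].
  move=> zS; have : [set` S] z by [].
  by rewrite SE => -[g [Gg gL] <-]; exists g.
case=> [/mem //|/mem [g [Gg e gL]]]; exists (invmx g); split.
- exact: GamV.
- by rewrite blk_inv ?Gdet // -e invmxK.
- by rewrite fro_invmx_SL2 // Gdet.
Qed.

Lemma is_word_nil : is_word S [::] 1%:M.
Proof. by split=> //; rewrite big_nil. Qed.

Lemma is_word1 g : G g -> fro g <= Lam -> is_word S [:: blk g] (blk g).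
Proof.
move=> Gg gL; split; last by rewrite big_cons big_nil mulmx1.
by move=> x; rewrite inE => /eqP ->; left; exact: letter_mem.
Qed.

Lemma is_word_cat v w a b :
  is_word S v a -> is_word S w b -> is_word S (v ++ w) (a *m b).
Proof.
move=> [hv ->] [hw ->]; split; last first.
  elim: v {hv} => [|y v IH]; first by rewrite big_nil mul1mx.
  by rewrite cat_cons !big_cons -IH mulmxA.
by move=> x; rewrite mem_cat => /orP [/hv|/hw].
Qed.

Lemma is_word_rev w a : is_word S w a ->
  exists2 v, is_word S v (invmx a) & size v = size w.
Proof.
elim: w a => [|x w IH] a [hw ->].
  by exists [::] => //; rewrite big_nil invmx1; exact: is_word_nil.
have [|v wv sv] := IH (\big[mulmx/1%:M]_(y <- w) y).
  by split=> // y yw; apply: hw; rewrite inE yw orbT.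
have hx : x \in S \/ invmx x \in S by apply: hw; rewrite inE eqxx.
have [g [Gg xE gL]] := letterP hx.
exists (v ++ [:: invmx x]); last by rewrite size_cat sv addn1.
rewrite big_cons invmxM.
- apply: is_word_cat => //; split; last by rewrite big_cons big_nil mulmx1.
  by move=> y; rewrite inE => /eqP ->; rewrite invmxK; case: hx; [right|left].
- by rewrite xE unitmxE det_blk Gdet ?unitr1.
have [h _] := wv; move: h sv wv; clear -hw lambda_gt1 lambdaE SE.
move=> _ _ _; elim: w hw => [|y w IH] hw; first by rewrite big_nil unitmx1.
rewrite big_cons unitmx_mul IH ?andbT; last first.
  by move=> z; rewrite inE => /orP [/eqP ->|zw]; apply: hw; rewrite !inE ?eqxx ?zw ?orbT.
have [|k [Gk -> _]] := @letterP y; first by apply: hw; rewrite !inE eqxx orbT.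
by rewrite unitmxE det_blk Gdet ?unitr1.
Qed.

(** A letter [c] is split off by stopping on the geodesic at a point [k] of operator norm [Lam / 12]
    and taking an orbit point near it. Then |c| <= sqrt 120 * Lam / 12 < Lam, and the rest has norm
    at most 12 sqrt 120 / Lam times |g|, where 12 sqrt 120 < 140. *)
Lemma short_word m g : G g -> fro g <= Lam * (Lam / 140) ^+ m ->
  exists2 w, is_word S w (blk g) & (size w <= m.+1)%N.
Proof.
have L1 := Lam_gt1; have LL := LamE.
elim: m g => [|m IH] g Gg gm.
  by exists [:: blk g] => //; apply: is_word1 => //; move: gm; rewrite expr0 mulr1.
have [gL|gL] := lerP (fro g) Lam; first by exists [:: blk g] => //; exact: is_word1.
have dg := Gdet Gg.
have e1 : 1 <= Lam / 12 by lra.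
have f0 := fro_ge0 g.
have sq : Lam ^+ 2 <= fro g ^+ 2 by rewrite ler_sqr ?nnegrE //; lra.
have eg : 2 * (Lam / 12) ^+ 2 <= fro g ^+ 2.
  rewrite (_ : 2 * (Lam / 12) ^+ 2 = Lam ^+ 2 / 72); last by field.
  by have := sqr_ge0 Lam; lra.
have [k [dk fk fkg]] := geodesic_point dg e1 eg.
have [c Gc ck] := orbit_cover lambda_gt1 lambdaE dk; have dc := Gdet Gc.
have uk := unitmx_SL2 dk; have uc := unitmx_SL2 dc.
have cL : fro c <= Lam.
  rewrite -ler_sqr ?nnegrE ?fro_ge0 //; last by lra.
  have e : c = k *m invmx (invmx c *m k).
    by rewrite invmxM ?unitmx_inv // invmxK mulmxA mulmxV // mul1mx.
  have h : fro c <= fro k * fro (invmx c *m k).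
    rewrite {1}e; apply: le_trans (fro_mul _ _) _.
    by rewrite fro_invmx_SL2 // det_inv_mul.
  apply: (@le_trans _ _ ((fro k * fro (invmx c *m k)) ^+ 2)).
    by rewrite ler_sqr ?nnegrE ?mulr_ge0 ?fro_ge0.
  rewrite exprMn; have := ler_pM (sqr_ge0 _) (sqr_ge0 _) fk ck.
  rewrite (_ : 2 * (Lam / 12) ^+ 2 * 60 = Lam ^+ 2 * (120 / 144)); last by field.
  by have := sqr_ge0 Lam; lra.
have cg : fro (invmx c *m g) <= fro g / (Lam / 140).
  rewrite ler_pdivlMr; last by lra.
  rewrite -ler_sqr ?nnegrE ?mulr_ge0 ?fro_ge0 //; last by lra.
  have h : fro (invmx c *m g) <= fro (invmx c *m k) * fro (invmx k *m g).
    rewrite -[X in fro X <= _](_ : (invmx c *m k) *m (invmx k *m g) = _) ?fro_mul //.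
    by rewrite mulmxA mulmxK.
  have h2 : fro (invmx c *m g) ^+ 2 <= fro (invmx c *m k) ^+ 2 * fro (invmx k *m g) ^+ 2.
    by rewrite -exprMn ler_sqr ?nnegrE ?mulr_ge0 ?fro_ge0.
  have h3 : fro (invmx c *m k) ^+ 2 * (fro (invmx k *m g) ^+ 2 * (Lam / 12) ^+ 2) <=
      60 * (2 * fro g ^+ 2).
    apply: ler_pM => //; [exact: sqr_ge0 | by apply: mulr_ge0; exact: sqr_ge0].
  have h4 : fro (invmx c *m g) ^+ 2 * (Lam / 12) ^+ 2 <= 60 * (2 * fro g ^+ 2).
    by apply: le_trans h3; rewrite mulrA; apply: ler_wpM2r h2; exact: sqr_ge0.
  have e : (fro (invmx c *m g) * (Lam / 140)) ^+ 2 =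
      fro (invmx c *m g) ^+ 2 * (Lam / 12) ^+ 2 * (144 / (140 * 140)) by field.
  by rewrite e; have := sqr_ge0 (fro g); lra.
have [|w hw sw] := IH _ (GamM lambda_gt1 lambdaE (GamV lambda_gt1 lambdaE Gc) Gg).
  apply: le_trans cg _; rewrite ler_pdivrMr; last by lra.
  by apply: le_trans gm _; rewrite exprSr mulrA.
exists (blk c :: w) => //.
have -> : blk g = blk c *m blk (invmx c *m g) by rewrite -blkM mulmxA mulmxV // mul1mx.
by have := is_word_cat (is_word1 Gc cL) hw.
Qed.

(* Geodesics of the Cayley graph: no word of length less than j - i joins p i
   and p j. *)
Definition gpath n (p : nat -> 'M[R]_2) : Prop :=
  [/\ forall i, (i <= n)%N -> G (p i),
      forall i, (i < n)%N -> fro (invmx (p i) *m p i.+1) <= Lam &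
      forall i j w, (i <= j <= n)%N -> is_word S w (blk (invmx (p i) *m p j)) ->
        (j - i <= size w)%N].

(** Otherwise [short_word] would give a word of m + 1 letters across m + 2 steps. *)
Lemma gpath_far n p i m : gpath n p -> (i + m.+2 <= n)%N ->
  Lam * (Lam / 140) ^+ m < fro (invmx (p i) *m p (i + m.+2)%N).
Proof.
move=> [Gp _ min] le; rewrite ltNge; apply/negP => h.
have Gi : G (p i) by apply: Gp; lia.
have Gj : G (p (i + m.+2)%N) by apply: Gp.
have [w hw sw] := short_word (GamM lambda_gt1 lambdaE (GamV lambda_gt1 lambdaE Gi) Gj) h.
have := min i (i + m.+2)%N w; rewrite le leq_addr => /(_ isT hw); lia.
Qed.

Lemma gpath_two n p i : gpath n p -> (i + 2 <= n)%N ->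
  fro (invmx (p i) *m p (i + 2)%N) <= Lam ^+ 2.
Proof.
move=> [Gp st _] le; have L1 := Lam_gt1.
have i2 : (i.+1 < n)%N by rewrite -addn2.
have i1 : (i < n)%N by exact: ltnW.
have d1 : \det (p i.+1) = 1 by exact: Gdet (Gp _ i1).
have -> : invmx (p i) *m p (i + 2)%N =
    (invmx (p i) *m p i.+1) *m (invmx (p i.+1) *m p i.+2).
  by rewrite addn2 mulmxA mulmxK ?unitmx_SL2.
apply: le_trans (fro_mul _ _) _; rewrite expr2.
by apply: ler_pM; rewrite ?fro_ge0 ?st.
Qed.

Definition thinness : R := 6 * ln Lam + 5 * ln 8.

(** Single steps may be short, so [coarse_geodesic] is applied to the even vertices: two of their
    steps make four letters, which beat two letters by the required margin. The other vertices are
    one letter away, which accounts for the remaining terms of [thinness]. *)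
Lemma gpath_thin n p : gpath n p ->
  thin_path (fun g => \det g = 1) (@hd R) thinness (ln Lam) (p 0%N) (p n) n p.
Proof.
move=> gp; have [Gp st _] := gp; have L1 := Lam_gt1; have LL := LamE.
have dp i : (i <= n)%N -> \det (p i) = 1 by move=> /Gp; exact: Gdet.
have [dC tri dge dxx f] := hd_four_point R.
have Lp : 0 < Lam by lra.
have L0 : 0 <= ln Lam by rewrite ln_ge0 // ltW.
have l8 : 0 <= ln 8 :> R by rewrite ln_ge0 //; lra.
have step i : (i < n)%N -> hd (p i) (p i.+1) <= ln Lam.
  move=> lt; have pos := fro_inv_mul_gt0 (dp _ (ltnW lt)) (dp _ lt).
  by rewrite /hd ler_ln ?posrE // st.
have p0 := dp _ (leq0n n); have pn := dp _ (leqnn n).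
split=> // [i lt|i lei].
  have := tri _ _ _ p0 (dp _ (ltnW lt)) (dp _ lt); have := step _ lt; lra.
pose y j := p j.*2.
have half j : (j <= n./2)%N -> (j.*2 <= n)%N.
  by move=> h; rewrite -(odd_double_half n); apply: leq_trans (leq_addl _ _); rewrite leq_double.
have dy j : (j <= n./2)%N -> \det (y j) = 1 by move=> /half; exact: dp.
have near j : (j <= n)%N -> hd (y j./2) (p j) <= ln Lam + ln 8.
  move=> le; rewrite /y; have := odd_double_half j; case: (odd j) => /= e.
    have -> : p j = p j./2.*2.+1 by rewrite -{1}e.
    by have := step j./2.*2; rewrite -{1}e in le; move=> /(_ le); lra.
  have -> : p j = p j./2.*2 by rewrite -{1}e.
  by have := dxx _ (dp j./2.*2 _); rewrite -{1}e in le => /(_ le); lra.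
have := @coarse_geodesic R _ _ (@hd R) (ln 8) (hd_four_point R) y n./2
  (2 * ln 8 + 1) (2 * ln Lam) (lexx _) l8 dy.
have len j : (j < n./2)%N -> hd (y j) (y j.+1) <= 2 * ln Lam.
  move=> lt; have le := half _ lt; rewrite /y doubleS in le *.
  have h := @gpath_two n p j.*2 gp; rewrite addn2 in h.
  have j0 : (j.*2 <= n)%N by apply: leq_trans le; rewrite -addn2 leq_addr.
  have pos := fro_inv_mul_gt0 (dp _ j0) (dp _ le).
  by rewrite mulr_natl -lnXn // /hd ler_ln ?posrE ?exprn_gt0 // h.
have big j : (j.+2 <= n./2)%N -> 2 * ln Lam + (2 * ln 8 + 1) <= hd (y j) (y j.+2).
  move=> lt; have le := half _ lt; rewrite /y !doubleS in le *.
  have h := @gpath_far n p j.*2 2 gp; rewrite !addnS addn0 in h.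
  have {}h := h le.
  (* 8^2 * 4 = 256 is below 400 <= Lam / 140^2; the 4 supplies the summand 1 of the margin, by
     [ln4_ge1]. *)
  have c8 : Lam ^+ 2 * (8 ^+ 2 * 4) <= Lam * (Lam / 140) ^+ 2.
    have -> : Lam * (Lam / 140) ^+ 2 = Lam ^+ 2 * (Lam / (140 * 140)) by field.
    by apply: ler_wpM2l; [exact: sqr_ge0 | lra].
  have : ln (Lam ^+ 2 * (8 ^+ 2 * 4)) <= hd (p j.*2) (p j.*2.+4).
    have j0 : (j.*2 <= n)%N by apply: leq_trans le; rewrite -addn4 leq_addr.
    have pos := fro_inv_mul_gt0 (dp _ j0) (dp _ le).
    rewrite /hd ler_ln ?posrE ?mulr_gt0 ?exprn_gt0 //; lra.
  rewrite lnM ?posrE ?mulr_gt0 ?exprn_gt0 // [ln (8 ^+ 2 * 4)]lnM ?posrE ?exprn_gt0 //.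
  by rewrite !lnXn // !mulr2n; have := ln4_ge1 R; lra.
have stepj j : (j.+2 <= n./2)%N ->
    hd (y j) (y j.+1) + (2 * ln 8 + 1) <= hd (y j) (y j.+2) /\
    hd (y j.+1) (y j.+2) + (2 * ln 8 + 1) <= hd (y j) (y j.+2).
  by move=> lt; have := big j lt; have := len j (ltnW lt); have := len j.+1 lt; split; lra.
move=> /(_ len stepj).
have y0 : y 0%N = p 0%N by [].
move=> /(_ i./2 (half_leq lei)); rewrite y0.
have L2 : `|2 * ln Lam| = 2 * ln Lam by rewrite ger0_norm //; lra.
rewrite L2.
have dyi := dy _ (half_leq lei); have dyn := dy _ (leqnn n./2).
have di := dp _ lei.
have ni := near _ lei; have nn := near _ (leqnn n).
have t1 := tri _ _ _ p0 dyi di; have t2 := tri _ _ _ di dyi pn.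
have t3 := tri _ _ _ dyi dyn pn; have t4 := tri _ _ _ p0 pn dyn.
rewrite (dC _ _ di dyi) in t2; rewrite (dC _ _ pn dyn) in t4.
rewrite /thinness; move: ni nn t1 t2 t3 t4.
move: (hd (p 0%N) (y i./2)) (hd (y i./2) (y n./2)) (hd (p 0%N) (y n./2))
  (hd (y i./2) (p i)) (hd (y n./2) (p n)) (hd (p 0%N) (p i)) (hd (p i) (p n))
  (hd (p 0%N) (p n)) (hd (y i./2) (p n)) (ln Lam) (ln 8).
clear=> *; lra.
Qed.

Lemma is_word_Gam w a : is_word S w a -> exists2 g, G g & a = blk g.
Proof.
move=> [hw ->]; elim: w hw => [|y w IH] hw.
  by exists 1%:M; [exact: Gam1 | rewrite big_nil blk1].
have [|g Gg e] := IH; first by move=> z zw; apply: hw; rewrite inE zw orbT.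
have [|k [Gk yE _]] := @letterP y; first by apply: hw; rewrite inE eqxx.
by exists (k *m g); [exact: GamM | rewrite big_cons e yE blkM].
Qed.

Lemma blk_inv_mul a b : G a -> blk (invmx a *m b) = invmx (blk a) *m blk b.
Proof. by move=> Ga; rewrite blkM blk_inv ?Gdet. Qed.

Lemma word_gpath x z n : G x -> G z -> word_length S (blk (invmx x *m z)) n ->
  exists p, [/\ gpath n p, p 0%N = x, p n = z & forall i j, (i <= j <= n)%N ->
    exists2 v, is_word S v (blk (invmx (p i) *m p j)) & size v = (j - i)%N].
Proof.
move=> Gx Gz [[wd [hl e] sz] min].
have ux := unitmx_SL2 (Gdet Gx).
have wpre i j : is_word S (drop i (take j wd))
    (\big[mulmx/1%:M]_(y <- drop i (take j wd)) y).
  by split=> // y /mem_drop /mem_take; exact: hl.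
have cat i j : (i <= j)%N -> \big[mulmx/1%:M]_(y <- take j wd) y =
    (\big[mulmx/1%:M]_(y <- take i wd) y) *m
    (\big[mulmx/1%:M]_(y <- drop i (take j wd)) y).
  move=> ij; rewrite -[in LHS](cat_take_drop i (take j wd)) take_takel //.
  elim: (take i wd) => [|y v IH]; first by rewrite big_nil mul1mx.
  by rewrite cat_cons !big_cons IH mulmxA.
have pre i : exists g, G g /\ \big[mulmx/1%:M]_(y <- take i wd) y = blk g.
  have := wpre 0%N i; rewrite drop0 => /is_word_Gam [g Gg eg]; by exists g.
have [f fP] := choice pre.
have f0 : f 0%N = 1%:M.
  by apply: blk_inj; have [_ <-] := fP 0%N; rewrite take0 big_nil blk1.
have fn : f n = invmx x *m z.
  by apply: blk_inj; have [_ <-] := fP n; rewrite -sz take_size -e.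
pose p i := x *m f i; have pE i : p i = x *m f i by [].
clearbody p.
have Gp i : G (p i) by rewrite pE; apply: GamM => //; case: (fP i).
have sub i j : (i <= j <= n)%N ->
    is_word S (drop i (take j wd)) (blk (invmx (p i) *m p j)) /\
    size (drop i (take j wd)) = (j - i)%N.
  move=> /andP [ij jn]; split; last by rewrite size_drop size_takel // sz.
  have -> : blk (invmx (p i) *m p j) = \big[mulmx/1%:M]_(y <- drop i (take j wd)) y.
    have [Gi ei] := fP i; have [Gj ej] := fP j; have ui := unitmx_SL2 (Gdet Gi).
    rewrite !pE invmxM // -mulmxA mulKmx // blk_inv_mul // -ei -ej (cat i j ij).
    by rewrite mulKmx // ei unitmxE det_blk Gdet ?unitr1.
  exact: wpre.
have p0 : p 0%N = x by rewrite pE f0 mulmx1.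
have pn : p n = z by rewrite pE fn mulKVmx.
exists p; split=> //; last by move=> i j ij; have [h1 h2] := sub i j ij; exists (drop i (take j wd)).
split=> // [i lt|i j v /andP [ij jn] hv].
  have [|[h1 h2] h3] := sub i i.+1; first by rewrite leqnSn.
  move: h1 h2 h3; case: (drop i _) => [|y []]; rewrite subSnn //= => h1 h2 _.
  have [|g [Gg yE gL]] := @letterP y; first by apply: h1; rewrite inE eqxx.
  by move: h2; rewrite big_cons big_nil mulmx1 yE => /blk_inj ->.
have [|w1 s1] := sub 0%N i; first by rewrite leq0n (leq_trans ij jn).
have [|w2 s2] := sub j n; first by rewrite jn leqnn.
(* Replacing the middle segment of the geodesic word by [v] gives a word for the same element, so
   [v] is not shorter than that segment. *)
have w3 := is_word_cat w1 (is_word_cat hv w2).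
have e3 : blk (invmx (p 0%N) *m p i) *m (blk (invmx (p i) *m p j) *m
    blk (invmx (p j) *m p n)) = blk (invmx x *m z).
  rewrite -!blkM p0 pn; congr blk; rewrite !mulmxA mulmxK ?mulmxK //.
    by apply/unitmx_SL2/Gdet.
  by apply/unitmx_SL2/Gdet.
rewrite e3 in w3; have := min _ w3; rewrite !size_cat s1 s2 subn0; move: (size v) => k; clear -ij jn; lia.
Qed.

(** Where the two geodesics cross they are boundedly close for the norm, hence joined by at most M +
    1 letters. Exchanging tails there connects [x] to [y] and [z] to [w] by the letters of both
    geodesics and twice this bridge. *)
Lemma crossing_words : exists N : nat, forall x y z w n m,
  G x -> G y -> G z -> G w ->
  word_length S (blk (invmx x *m w)) n -> word_length S (blk (invmx y *m z)) m ->
  hd x y + hd z w <= hd x w + hd y z + ln 8 ->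
  hd x z + hd y w <= hd x w + hd y z + ln 8 ->
  exists v1 v2, [/\ is_word S v1 (blk (invmx x *m y)),
    is_word S v2 (blk (invmx z *m w)) & (size v1 + size v2 <= n + m + N)%N].
Proof.
have L1 := Lam_gt1; have LL := LamE.
pose c := 9 * thinness + 9 * ln Lam + 40 * ln 8.
have [M cM] : exists M : nat, expR c <= Lam * (Lam / 140) ^+ M.
  exists (Num.bound (expR c)); have := archi_boundP (expR_ge0 c).
  move: (Num.bound _) => M cM.
  have h1 : M%:R <= (2 : R) ^+ M by rewrite -natrX ler_nat ltnW // ltn_expl.
  have h2 : (2 : R) ^+ M <= (Lam / 140) ^+ M by apply: lerXn2r; rewrite ?nnegrE; lra.
  have h3 : (Lam / 140) ^+ M <= Lam * (Lam / 140) ^+ M.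
    by rewrite ler_peMl ?exprn_ge0 //; lra.
  lra.
exists (2 * M.+1)%N => x y z w n m Gx Gy Gz Gw lxw lyz h1 h2.
have [p [gp p0 pn pw]] := word_gpath Gx Gw lxw.
have [s [gs s0 sm sw]] := word_gpath Gy Gz lyz.
have tp := gpath_thin gp; have ts := gpath_thin gs.
rewrite p0 pn in tp; rewrite s0 sm in ts.
have l0 : 0 <= ln Lam by rewrite ln_ge0 // ltW.
have l8 : 0 <= ln 8 :> R by rewrite ln_ge0 //; lra.
have th0 : 0 <= thinness by rewrite /thinness; lra.
have [i [j [lei lej hij]]] := crossing (hd_four_point R) l8 l0 th0
  (Gdet Gx) (Gdet Gy) (Gdet Gz) (Gdet Gw) tp ts h1 h2.
have [Gp _ _] := gp; have [Gs _ _] := gs.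
have Gi := Gp _ lei; have Gj := Gs _ lej.
have ui := unitmx_SL2 (Gdet Gi); have uj := unitmx_SL2 (Gdet Gj).
have uy := unitmx_SL2 (Gdet Gy); have uz := unitmx_SL2 (Gdet Gz).
have [u hu su] : exists2 u, is_word S u (blk (invmx (p i) *m s j)) & (size u <= M.+1)%N.
  apply: short_word.
    by apply: GamM => //; apply: GamV.
  apply: le_trans cM; rewrite -[X in X <= _]lnK ?posrE ?ler_expr //.
    by rewrite ler_expR.
  by apply: fro_inv_mul_gt0; exact: Gdet.
have [u' hu' su'] := is_word_rev hu.
have [|a1 wa1 sa1] := pw 0%N i; first by rewrite leq0n.
have [|a2 wa2 sa2] := pw i n; first by rewrite lei leqnn.
have [|b1 wb1 sb1] := sw 0%N j; first by rewrite leq0n.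
have [|b2 wb2 sb2] := sw j m; first by rewrite lej leqnn.
have [b1' wb1' sb1'] := is_word_rev wb1.
have [b2' wb2' sb2'] := is_word_rev wb2.
have inv a b : G a -> G b -> invmx (blk (invmx a *m b)) = blk (invmx b *m a).
  move=> Ga Gb; rewrite !blk_inv_mul // invmxM ?invmxK //.
    by rewrite unitmx_inv unitmxE det_blk Gdet ?unitr1.
  by rewrite unitmxE det_blk Gdet ?unitr1.
rewrite p0 in wa1; rewrite pn in wa2; rewrite s0 inv // in wb1'.
rewrite sm inv // in wb2'; rewrite inv // in hu'.
exists (a1 ++ u ++ b1'), (b2' ++ u' ++ a2); split.
- have := is_word_cat wa1 (is_word_cat hu wb1'); rewrite -!blkM.
  by rewrite !mulmxA mulmxK // mulmxK.
- have := is_word_cat wb2' (is_word_cat hu' wa2); rewrite -!blkM.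
  by rewrite !mulmxA mulmxK // mulmxK.
rewrite !size_cat sb1' sb2' su' sa1 sa2 sb1 sb2 !subn0; clear -lei lej su.
move: (size u) su => k su; lia.
Qed.

Lemma Gamma2_gromov : gromov_hyperbolic S (Gamma2 lambda).
Proof.
have [N cr] := crossing_words; exists N => X Y Z W GX GY GZ GW.
have [x Gx ->] := Gamma2_blk lambda_gt1 lambdaE GX.
have [y Gy ->] := Gamma2_blk lambda_gt1 lambdaE GY.
have [z Gz ->] := Gamma2_blk lambda_gt1 lambdaE GZ.
have [w Gw ->] := Gamma2_blk lambda_gt1 lambdaE GW.
rewrite /word_dist -!blk_inv_mul // => dxy dzw dxz dyw dxw dyz lxy lzw lxz lyw lxw lyz.
have [dC _ _ _ f] := hd_four_point R.
have F := f x y z w (Gdet Gx) (Gdet Gy) (Gdet Gz) (Gdet Gw).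
have l8 : 0 <= ln 8 :> R by rewrite ln_ge0 //; lra.
(* The larger of these two sums tells which pair of geodesics crosses. *)
have [le|lt] := lerP (hd x z + hd y w) (hd x w + hd y z).
  have A : hd x y + hd z w <= hd x w + hd y z + ln 8.
    by case: F => // F; apply: le_trans F _; rewrite lerD2r.
  have B : hd x z + hd y w <= hd x w + hd y z + ln 8.
    by apply: le_trans le _; rewrite lerDl.
  have [v1 [v2 [w1 w2 s]]] := cr x y z w _ _ Gx Gy Gz Gw lxw lyz A B.
  have := lxy.2 _ w1; have := lzw.2 _ w2; have := leq_maxr (dxz + dyw) (dxw + dyz).
  move: (maxn _ _) (size v1) (size v2) s => M k1 k2; clear; lia.
have A : hd x y + hd w z <= hd x z + hd y w + ln 8.
  rewrite (dC w z (Gdet Gw) (Gdet Gz)).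
  by case: F => // F; apply: le_trans F _; rewrite lerD2r ltW.
have B : hd x w + hd y z <= hd x z + hd y w + ln 8.
  by apply: le_trans (ltW lt) _; rewrite lerDl.
have [v1 [v2 [w1 w2 s]]] := cr x y w z _ _ Gx Gy Gw Gz lxz lyw A B.
have [v3 w3 s3] := is_word_rev w2.
have e : invmx (blk (invmx w *m z)) = blk (invmx z *m w).
  rewrite !blk_inv_mul // invmxM ?invmxK //.
    by rewrite unitmx_inv unitmxE det_blk Gdet ?unitr1.
  by rewrite unitmxE det_blk Gdet ?unitr1.
rewrite e in w3.
have := lxy.2 _ w1; have := lzw.2 _ w3; have := leq_maxl (dxz + dyw) (dxw + dyz).
rewrite s3; move: (maxn _ _) (size v1) (size v2) s => M k1 k2; clear; lia.
Qed.

End Words.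

(** * Perturbed geodesics are Morse *)

Section MoreDistances.
Variable R : realType.

Lemma norm_le_of_upper (l : 'I_3 -> R) m : 0 <= m -> \sum_i l i = 0 ->
  (forall i, l i <= m) ->
  Num.sqrt 6 * Num.sqrt (\sum_i l i ^+ 2) <= Num.sqrt 18 * (2 * m).
Proof.
move=> m0 l0 l1.
have -> : Num.sqrt 18 = Num.sqrt 6 * Num.sqrt 3 :> R.
  by rewrite -sqrtrM //; congr Num.sqrt; ring.
rewrite -mulrA ler_pM2l ?sqrtr_gt0 //.
have m2 : 0 <= 2 * m by lra.
rewrite -[X in _ * X](ger0_norm m2) -sqrtr_sqr -sqrtrM //; apply: ler_wsqrtr.
move: l0; rewrite !big_ord3.
have := l1 ord0; have := l1 (lift ord0 ord0).
have := l1 (lift ord0 (lift ord0 ord0)).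
move: (l _) (l _) (l _) => a b c h3 h2 h4 h.
have a1 : -(2 * m) <= a by lra.
have b1 : -(2 * m) <= b by lra.
have c1 : -(2 * m) <= c by lra.
have : a ^+ 2 <= (2 * m) ^+ 2 by nra.
have : b ^+ 2 <= (2 * m) ^+ 2 by nra.
have : c ^+ 2 <= (2 * m) ^+ 2 by nra.
lra.
Qed.

(** The logarithms of the singular values sum to 0, so an upper bound m gives the lower bound - 2 m;
    the norm of one of the two quotients is enough. *)
Lemma dist_le_one_sided (A C : 'M[R]_3) M : SL3 A -> SL3 C -> 1 <= M ->
  fro (invmx A *m C) <= M \/ fro (invmx C *m A) <= M ->
  dist (act A (basept R)) (act C (basept R)) <= Num.sqrt 18 * (2 * ln M).
Proof.
move=> sA sC M1 h1.
have [l [-> e1 e2 l0]] := dist_singular_values sA sC.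
have M0 : 0 < M by lra.
have ME : M ^+ 2 = expR (2 * ln M) by rewrite expRM_natl lnK.
have bound (f : 'I_3 -> R) x : 0 <= x -> x <= M -> x ^+ 2 = \sum_i expR (2 * f i) ->
    forall i, f i <= ln M.
  move=> x0 xM xE i; suff : 2 * f i <= 2 * ln M by lra.
  rewrite -ler_expR -ME; apply: (@le_trans _ _ (x ^+ 2)); last by nra.
  by rewrite xE (bigD1 i) //= lerDl; apply: sumr_ge0 => j _; exact: expR_ge0.
have m0 : 0 <= ln M by rewrite ln_ge0.
case: h1 => h1; first exact: norm_le_of_upper m0 l0 (bound _ _ (fro_ge0 _) h1 e1).
have e3 : fro (invmx C *m A) ^+ 2 = \sum_i expR (2 * - l i).
  by rewrite e2; apply: eq_bigr => i _; congr expR; ring.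
have -> : \sum_i l i ^+ 2 = \sum_i (- l i) ^+ 2.
  by apply: eq_bigr => i _; rewrite sqrrN.
apply: (norm_le_of_upper m0 _ (bound (fun i => - l i) _ (fro_ge0 _) h1 e3)).
by rewrite sumrN l0 oppr0.
Qed.

Lemma fro_blk_le (g : 'M[R]_2) : fro (blk g) <= fro g + 1.
Proof.
rewrite -ler_sqr ?nnegrE ?addr_ge0 ?fro_ge0 // fro_blk sqrrD expr1n.
by rewrite -addrA lerD2l lerDr mulrn_wge0 // mulr1 fro_ge0.
Qed.

Lemma ln2_le : ln 2 <= 74 / 100 :> R.
Proof.
rewrite -ler_expR lnK ?posrE //.
have h := expR_ge1Dx (37 / 400 : R).
have -> : (74 / 100 : R) = 8%:R * (37 / 400) by field.
rewrite expRM_natl; move: (expR _) h => x h.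
have x2 : 119 / 100 <= x ^+ 2 by nra.
have x4 : 1416 / 1000 <= x ^+ 4.
  by rewrite (_ : x ^+ 4 = x ^+ 2 * x ^+ 2); [nra | ring].
rewrite (_ : x ^+ 8 = x ^+ 4 * x ^+ 4); [nra | ring].
Qed.

(** Places the elements with |g|^2 <= 60 in [S']: for them |blk g|^2 <= 61 < 8^2, and [dist_le]
    applies with M = 8. *)
Lemma sqrt18_ln8 : Num.sqrt 18 * ln 8 <= 95 / 10 :> R.
Proof.
have -> : ln 8 = 3 * ln 2 :> R.
  by rewrite mulr_natl -lnXn //; congr ln; ring.
have p18 : 0 <= 18 :> R by lra.
have e18 := sqr_sqrtr p18; have s18 := sqrtr_ge0 (18 : R).
have h1 : Num.sqrt 18 <= 425 / 100 :> R.
  by move: (Num.sqrt 18) e18 s18 => x; clear; nra.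
have h2 := ln2_le; have h3 : 0 <= ln 2 :> R by rewrite ln_ge0 //; lra.
move: (ln 2) (Num.sqrt 18) h1 h2 h3 s18 {e18} => x z h1 h2 h3 h4.
have : z * (3 * x) <= 425 / 100 * (3 * (74 / 100)) by apply: ler_pM; lra.
lra.
Qed.

End MoreDistances.

(** * Propagation of the error from [S'] to larger elements *)

Section Perturbation.
Variables (R : realType) (lambda : R) (rho : 'M[R]_3 -> 'M[R]_3).
Hypotheses (lambda_gt1 : 1 < lambda) (lambdaE : ln lambda = acosh (cot (pi / 8))).
Hypothesis rho_rep : representation (Gamma2 lambda) rho.
Local Notation G := (Gam lambda).

Lemma rho_SL3 g : G g -> SL3 (rho (blk g)).
Proof. by move=> Gg; case: rho_rep => h _; exact: h. Qed.

Lemma rhoM g h : G g -> G h -> rho (blk (g *m h)) = rho (blk g) *m rho (blk h).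
Proof. by move=> Gg Gh; case: rho_rep => _ hm; rewrite blkM hm. Qed.

Lemma rho1 : rho (blk 1%:M) = 1%:M.
Proof.
have G1 := Gam1 lambda_gt1 lambdaE.
have u := SL3_unit (rho_SL3 G1); have := rhoM G1 G1; rewrite mulmx1 => e.
by rewrite -[LHS](mulKmx u) -e mulVmx.
Qed.

Lemma rhoV g : G g -> rho (blk (invmx g)) = invmx (rho (blk g)).
Proof.
move=> Gg; apply/esym/mulmx1_invmx; rewrite -rhoM //; last exact: GamV.
by rewrite mulmxV ?rho1 // unitmx_SL2 // (Gam_det lambda_gt1 lambdaE).
Qed.

Lemma S'_mem g : G g -> fro g ^+ 2 <= 60 -> S' lambda (blk g).
Proof.
move=> Gg g60; split=> //.
have dg := Gam_det lambda_gt1 lambdaE Gg.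
have e : basept R = act 1%:M (basept R) by rewrite act1 trmx1 mulmx1.
rewrite [X in dist X _]e.
have s1 : SL3 (1%:M : 'M[R]_3) by exact: det1.
have sg : SL3 (blk g) by rewrite /SL3 /= det_blk.
have f8 (k : 'M[R]_2) : fro k ^+ 2 <= 60 -> fro (blk k) <= 8.
  by move=> k60; rewrite -ler_sqr ?nnegrE ?fro_ge0 // fro_blk; lra.
apply: le_trans (@sqrt18_ln8 R); apply: (dist_le s1 sg); first by lra.
  by rewrite invmx1 mul1mx f8.
by rewrite mulmx1 -blk_inv // f8 // fro_invmx_SL2.
Qed.

Variable e0 : R.
Hypothesis rho_close : forall s, S' lambda s -> frobenius (rho s - s) <= e0.
Hypotheses (e0_ge0 : 0 <= e0) (e0_le1 : e0 <= 1).

(* Write g = k (k^-1 g) with k in S' shortening g. From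
   rho(k g') - k g' = (rho k - k) rho g' + k (rho g' - g'), |k| <= 9 and
   |rho g'| <= K + 1 + E, the error E becomes at most 20 E. *)
Lemma perturbation K n g : 1 <= K -> G g -> fro g <= K ->
  fro g ^+ 2 <= 60 * (20 / 19) ^+ n ->
  fro (rho (blk g) - blk g) <= e0 * (K + 2) * 20 ^+ n.
Proof.
have [a0 a1] := conj e0_ge0 e0_le1.
move=> K1; elim: n g => [|n IH] g Gg gK gn.
  rewrite -frobeniusE expr0 mulr1; apply: (le_trans (rho_close (S'_mem Gg _))).
    by move: gn; rewrite expr0 mulr1.
  by rewrite ler_peMr //; lra.
have [E EE] : exists E, E = e0 * (K + 2) * 20 ^+ n by eexists.
have p20 : 1 <= (20 : R) ^+ n by apply: exprn_ege1; lra.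
have E1 : e0 * (K + 2) <= E by rewrite EE ler_peMr // mulr_ge0 //; lra.
have E0 : 0 <= E by apply: le_trans E1; rewrite mulr_ge0 //; lra.
have -> : e0 * (K + 2) * 20 ^+ n.+1 = 20 * E by rewrite EE exprS; ring.
have [g60|g60] := leP (fro g ^+ 2) 60.
  rewrite -frobeniusE; apply: (le_trans (rho_close (S'_mem Gg g60))).
  have : e0 * 1 <= e0 * (K + 2) by apply: ler_wpM2l => //; lra.
  by lra.
have dg := Gam_det lambda_gt1 lambdaE Gg.
have [k [Gk k60 kg]] := reduction lambda_gt1 lambdaE dg g60.
have Gkg : G (invmx k *m g) by apply: GamM => //; exact: GamV.
have uk := unitmx_SL2 (Gam_det lambda_gt1 lambdaE Gk).
have sq := sqr_ge0 (fro g).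
have kg1 : fro (invmx k *m g) <= K.
  apply: le_trans gK; rewrite -ler_sqr ?nnegrE ?fro_ge0 //; apply: le_trans kg _.
  by lra.
have kgn : fro (invmx k *m g) ^+ 2 <= 60 * (20 / 19) ^+ n.
  apply: le_trans kg _; move: gn; rewrite (exprS (20 / 19)).
  move: (fro g ^+ 2) ((20 / 19) ^+ n) => x z; lra.
have := IH _ Gkg kg1 kgn; rewrite -EE => h.
have gE : g = k *m (invmx k *m g) by rewrite mulKVmx.
have -> : rho (blk g) - blk g = (rho (blk k) - blk k) *m rho (blk (invmx k *m g)) +
    blk k *m (rho (blk (invmx k *m g)) - blk (invmx k *m g)).
  rewrite {1 2}gE rhoM // blkM mulmxBl mulmxBr.
  by rewrite addrA subrK.
have h1 : fro (rho (blk k) - blk k) <= e0.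
  by rewrite -frobeniusE; apply: rho_close; exact: S'_mem.
have h2 : fro (blk k) <= 9.
  apply: le_trans (fro_blk_le k) _.
  have : fro k <= 8 by rewrite -ler_sqr ?nnegrE ?fro_ge0 //; lra.
  by lra.
have h3 : fro (rho (blk (invmx k *m g))) <= K + 1 + E.
  have := fro_add (rho (blk (invmx k *m g)) - blk (invmx k *m g)) (blk (invmx k *m g)).
  rewrite subrK; have := fro_blk_le (invmx k *m g); lra.
apply: le_trans (fro_add _ _) _.
have t1 : fro ((rho (blk k) - blk k) *m rho (blk (invmx k *m g))) <= e0 * (K + 1 + E).
  by apply: le_trans (fro_mul _ _) _; apply: ler_pM; rewrite ?fro_ge0.
have t2 : fro (blk k *m (rho (blk (invmx k *m g)) - blk (invmx k *m g))) <= 9 * E.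
  by apply: le_trans (fro_mul _ _) _; apply: ler_pM; rewrite ?fro_ge0.
have t3 : e0 * E <= E by rewrite ler_piMl.
move: (fro _) (fro _) t1 t2 => x z t1 t2; lra.
Qed.

End Perturbation.

Section Shadow.
Variables (R : realType) (lambda Lam K eps eta : R) (S : seq 'M[R]_3).
Variable rho : 'M[R]_3 -> 'M[R]_3.
Hypotheses (lambda_gt1 : 1 < lambda) (lambdaE : ln lambda = acosh (cot (pi / 8))).
Hypothesis rho_rep : representation (Gamma2 lambda) rho.
Hypothesis LamE : 140 * 140 * 400 <= Lam.
Hypothesis SE : [set` S] =
  [set blk g | g in [set g | Gam lambda g /\ fro g <= Lam]].
Hypothesis KE : K = Lam ^+ 2.
Hypothesis constants : cone_constants K eps eta.
Local Notation G := (Gam lambda).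
Hypothesis pert : forall g, G g -> fro g <= K ->
  fro (rho (blk g) - blk g) <= eps.
Local Notation path := (gpath lambda Lam S).

Local Lemma Gd g : G g -> \det g = 1.
Proof. exact: Gam_det. Qed.

Local Lemma GV g h : G g -> G h -> G (invmx g *m h).
Proof. by move=> Gg Gh; apply: GamM => //; exact: GamV. Qed.

Lemma rho_inv_mul g h : G g -> G h ->
  rho (blk (invmx g *m h)) = invmx (rho (blk g)) *m rho (blk h).
Proof.
move=> Gg Gh; rewrite (rhoM rho_rep) ?(rhoV lambda_gt1 lambdaE rho_rep) //.
exact: GamV.
Qed.

(** A single letter may be short, but two steps of a geodesic exceed [Lam]. Four steps exceed Lam *
    (Lam / 140)^2 >= 200 Lam^2, and each block is at most Lam^2, so nothing cancels. The predecessor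
    appears because a chain of index [n] has n + 1 blocks. *)
Lemma path_block_chain n p : path n p -> (2 <= n)%N ->
  block_chain K eps n./2.-1
    (fun j => rho (blk (invmx (p j.*2) *m p j.*2.+2)))
    (fun j => invmx (p j.*2) *m p j.*2.+2).
Proof.
move=> gp n2; have [Gp _ _] := gp; have L1 := Lam_gt1 LamE; have LL := LamE.
have half j : (j <= n./2.-1)%N -> (j.*2.+2 <= n)%N.
  move=> h; rewrite -doubleS -(odd_double_half n); apply: leq_trans (leq_addl _ _).
  rewrite leq_double; have : (0 < n./2)%N by rewrite half_gt0.
  by clear -h; lia.
split=> j lej.
  have le := half j lej.
  have le0 : (j.*2 <= n)%N by apply: leq_trans le; rewrite -addn2 leq_addr.
  have Gj := Gp _ le0; have Gj2 := Gp _ le.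
  have GB := GV Gj Gj2; have dB := Gd GB.
  have big : Lam < fro (invmx (p j.*2) *m p j.*2.+2).
    have := @gpath_far R lambda Lam S lambda_gt1 lambdaE LamE SE n p j.*2 0 gp.
    by rewrite addn2 expr0 mulr1; apply.
  have small : fro (invmx (p j.*2) *m p j.*2.+2) <= K.
    have := @gpath_two R lambda Lam S lambda_gt1 lambdaE LamE n p j.*2 gp.
    by rewrite addn2 -KE; apply.
  split=> //; first exact: (rho_SL3 rho_rep).
    by lra.
  split; first exact: pert.
  rewrite -(rhoV lambda_gt1 lambdaE rho_rep) //; apply: pert; first exact: GamV.
  by rewrite fro_invmx_SL2.
have lej1 : (j <= n./2.-1)%N by exact: ltnW.
have le := half _ lej1; have le2 := half _ lej; rewrite doubleS in le2 *.
have le0 : (j.*2 <= n)%N by apply: leq_trans le; rewrite -addn2 leq_addr.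
have d2 := Gd (Gp _ le).
have -> : (invmx (p j.*2) *m p j.*2.+2) *m (invmx (p j.*2.+2) *m p j.*2.+4) =
    invmx (p j.*2) *m p j.*2.+4 by rewrite mulmxA mulmxK ?unitmx_SL2.
have big : Lam * (Lam / 140) ^+ 2 < fro (invmx (p j.*2) *m p j.*2.+4).
  have := @gpath_far R lambda Lam S lambda_gt1 lambdaE LamE SE n p j.*2 2 gp.
  by rewrite addn4; apply.
have big2 : 200 * Lam ^+ 2 <= Lam * (Lam / 140) ^+ 2.
  have -> : Lam * (Lam / 140) ^+ 2 = (Lam / (140 * 140)) * Lam ^+ 2 by field.
  by apply: ler_wpM2r; [exact: sqr_ge0 | lra].
have small j0 : (j0.+2 <= n)%N -> fro (invmx (p j0) *m p j0.+2) <= Lam ^+ 2.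
  have := @gpath_two R lambda Lam S lambda_gt1 lambdaE LamE n p j0 gp.
  by rewrite addn2; apply.
have s1 := small _ le; have s2 := small _ le2.
by split; lra.
Qed.

Lemma near_even n p t : path n p -> (t <= n)%N ->
  fro (invmx (rho (blk (p t))) *m rho (blk (p t./2.*2))) <= Lam + 4.
Proof.
move=> [Gp st _] le; have L1 := Lam_gt1 LamE.
have [_ _ eps1 _] := cone_constants_small constants.
have K1 : Lam <= K by rewrite KE expr2 ler_peMl //; lra.
have le0 : (t./2.*2 <= t)%N by rewrite -{2}(odd_double_half t) leq_addl.
have Gt := Gp _ le; have G0 := Gp _ (leq_trans le0 le).
rewrite -rho_inv_mul //.
have f : fro (invmx (p t) *m p t./2.*2) <= Lam.
  move: (odd_double_half t) le; case: (odd t) => /= e le.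
    have d := Gd (GV G0 Gt).
    rewrite -fro_invmx_SL2; last exact: Gd (GV Gt G0).
    rewrite invmxM ?unitmx_inv ?unitmx_SL2 ?Gd // invmxK -{2}e add1n.
    by apply: st; rewrite -e add1n in le.
  rewrite -{1}e add0n mulVmx ?unitmx_SL2 ?Gd //.
  apply: le_trans (_ : 2 <= Lam); last by have := LamE; lra.
  by rewrite -ler_sqr ?nnegrE ?fro_ge0 // -mxtrace_mul_tr trmx1 mulmx1 mxtrace1; lra.
have h := pert (GV Gt G0) (le_trans f K1).
have := fro_add (rho (blk (invmx (p t) *m p t./2.*2)) - blk (invmx (p t) *m p t./2.*2))
  (blk (invmx (p t) *m p t./2.*2)).
rewrite subrK; have := fro_blk_le (invmx (p t) *m p t./2.*2).
move: h f; move: (fro _) (fro _) (fro _) (fro _) => a b c d; lra.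
Qed.

Definition rate : R := ln 50 - ln 2.
Definition slack : R := ln 2 + ln (4 * K).
Definition speed : R := 4 * ln (2 * K + 4).

Lemma path_shadow n p : path n p ->
  exists (h : 'M[R]_3) (s : nat -> 'rV[R]_3),
  [/\ SL3 h, forall j, (j <= n./2)%N -> \sum_k s j ord0 k = 0 /\
        fro (invmx (rho (blk (p j.*2))) *m (h *m expd (s j))) <= 9 * K,
    forall i j r, (i <= j <= n./2)%N ->
       rate * (j - i)%:R - slack <= simple_root r (s j - s i),
    forall i j, (i <= j <= n./2)%N -> fro (s j - s i) <= speed * (j - i)%:R &
    50 ^+ n./2 <= 2 * fro (invmx (rho (blk (p 0%N))) *m rho (blk (p n./2.*2)))].
Proof.
move=> gp; have [Gp _ _] := gp; have [K1 _ _ _] := constants.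
have G0 := Gp 0%N (leq0n _); have s0 := rho_SL3 rho_rep G0.
have u0 := SL3_unit s0.
(* With fewer than two steps there is no block; the frame [rho (blk (p 0))] with [s = 0] serves. *)
have [n2|n2] := ltnP n 2.
  have -> : n./2 = 0%N by move: n n2 {gp Gp} => [|[]].
  exists (rho (blk (p 0%N))), (fun=> 0); split=> //.
  - move=> j; rewrite leqn0 => /eqP ->; split.
      by rewrite big1 // => k _; rewrite mxE.
    have -> : expd 0 = 1%:M :> 'M[R]_3.
      by apply/matrixP => i k; rewrite !mxE expR0.
    rewrite mulmx1 mulVmx //; have := @fro_scalar1 R; lra.
  - move=> i j r; rewrite leqn0 => /andP [+ /eqP j0]; rewrite j0 leqn0 => /eqP ->.
    rewrite subnn mulr0 subrr /simple_root !mxE subrr sub0r oppr_le0 /slack.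
    by rewrite addr_ge0 // ln_ge0 //; lra.
  - move=> i j; rewrite leqn0 => /andP [+ /eqP j0]; rewrite j0 leqn0 => /eqP ->.
    by rewrite subnn mulr0 subrr fro0.
  rewrite expr0 mulVmx //.
  have := fro_entry (1%:M : 'M[R]_3) ord0 ord0; rewrite mxE eqxx normr1.
  by lra.
have ch := path_block_chain gp n2.
have [h [s [sh s1 s2 s3 s4]]] := flat_frame constants ch.
have half : n./2.-1.+1 = n./2 by rewrite prednK // half_gt0.
rewrite half in s1 s2 s3 s4.
set B := fun j => rho (blk (invmx (p j.*2) *m p j.*2.+2)) in s1 s4.
have le2 j : (j <= n./2)%N -> (j.*2 <= n)%N.
  move=> hj; rewrite -(odd_double_half n); apply: leq_trans (leq_addl _ _).
  by rewrite leq_double.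
have PE j : (j <= n./2)%N -> mxprod B j = invmx (rho (blk (p 0%N))) *m rho (blk (p j.*2)).
  elim: j => [|j IH] hj /=; first by rewrite mulVmx.
  have Gj := Gp _ (le2 _ (ltnW hj)); have Gj1 := Gp _ (le2 _ hj).
  have uj := SL3_unit (rho_SL3 rho_rep Gj).
  by rewrite IH ?(ltnW hj) // /B rho_inv_mul // -!mulmxA mulKVmx.
exists (rho (blk (p 0%N)) *m h), s; split=> //; first exact: SL3_mul.
  move=> j hj; have [e1 e2] := s1 j hj; split=> //.
  have uj := SL3_unit (rho_SL3 rho_rep (Gp _ (le2 _ hj))).
  by move: e2; rewrite PE // invmxM ?unitmx_inv // invmxK -!mulmxA.
by move: s4; rewrite PE.
Qed.

End Shadow.

Section Morse.
Variables (R : realType) (lambda Lam K eps eta : R) (S : seq 'M[R]_3).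
Variable rho : 'M[R]_3 -> 'M[R]_3.
Hypotheses (lambda_gt1 : 1 < lambda) (lambdaE : ln lambda = acosh (cot (pi / 8))).
Hypothesis rho_rep : representation (Gamma2 lambda) rho.
Hypothesis LamE : 140 * 140 * 400 <= Lam.
Hypothesis SE : [set` S] =
  [set blk g | g in [set g | Gam lambda g /\ fro g <= Lam]].
Hypothesis KE : K = Lam ^+ 2.
Hypothesis constants : cone_constants K eps eta.
Local Notation G := (Gam lambda).
Hypothesis pert : forall g, G g -> fro g <= K ->
  fro (rho (blk g) - blk g) <= eps.
Local Notation path := (gpath lambda Lam S).
Local Notation orbit p t := (act (rho (blk (p t))) (basept R)).

Local Lemma near n p t : path n p -> (t <= n)%N ->
  fro (invmx (rho (blk (p t))) *m rho (blk (p t./2.*2))) <= Lam + 4.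
Proof. exact: (near_even lambda_gt1 lambdaE rho_rep LamE KE constants pert). Qed.

Local Lemma shadow n p : path n p ->
  exists (h : 'M[R]_3) (s : nat -> 'rV[R]_3),
  [/\ SL3 h, forall j, (j <= n./2)%N -> \sum_k s j ord0 k = 0 /\
        fro (invmx (rho (blk (p j.*2))) *m (h *m expd (s j))) <= 9 * K,
    forall i j r, (i <= j <= n./2)%N ->
       rate R * (j - i)%:R - slack K <= simple_root r (s j - s i),
    forall i j, (i <= j <= n./2)%N -> fro (s j - s i) <= speed K * (j - i)%:R &
    50 ^+ n./2 <= 2 * fro (invmx (rho (blk (p 0%N))) *m rho (blk (p n./2.*2)))].
Proof.
exact: (path_shadow lambda_gt1 lambdaE rho_rep LamE SE KE constants pert).
Qed.

(** The roots of the shadow increase only up to the error [slack], so near the ends a point could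
    leave the cones. Moving both tips outwards by a fixed dominant vector [sg] with roots slack + 1
    makes all root differences positive and costs a bounded distance. *)
Lemma path_morse : exists D alpha0 : R, [/\ 0 < D, 0 < alpha0 &
  forall n p, path n p -> exists a b, [/\ symspace a, symspace b,
    dist a (orbit p 0%N) <= D, dist b (orbit p n) <= D &
    forall t, (t <= n)%N -> exists2 q, diamond alpha0 a b q &
      dist (orbit p t) q <= D]].
Proof.
have L1 := Lam_gt1 LamE; have [K1 _ _ _] := constants.
have sl0 : 0 <= slack K.
  by rewrite /slack addr_ge0 // ln_ge0 //; lra.
have [kap kapE] : exists k, k = slack K + 1 by eexists.
have kap0 : 0 < kap by lra.
have rt0 : 0 < rate R by rewrite /rate subr_gt0 ltr_ln ?posrE //; lra.
have sp0 : 0 <= speed K by rewrite /speed mulr_ge0 // ln_ge0 //; lra.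
pose sg : 'rV[R]_3 := kap *: \row_j nth 0 [:: 1; 0; -1] j.
have sg_sum : \sum_j sg ord0 j = 0 by rewrite big_ord3 !mxE /=; ring.
have sg_root r : simple_root r sg = kap.
  by rewrite /simple_root !mxE; case: (ord2P r) => -> /=; ring.
have sg_fro : fro sg <= 2 * kap.
  rewrite froZ ger0_norm ?(ltW kap0) // mulrC; apply: ler_wpM2r; first exact: ltW.
  apply: le_trans (fro_le_sum _) _.
  by rewrite big_ord1 big_ord3 !mxE /= normr1 normr0 normrN1; lra.
clearbody sg.
pose e1 := fro (expd (- sg)); pose e2 := fro (expd sg).
have e10 : 0 <= e1 by exact: fro_ge0.
have e20 : 0 <= e2 by exact: fro_ge0.
(* The summands e1, e2 and 1 serve the first tip, the second tip and the points between; [Lam + 4]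
   pays for passing from an odd vertex to the even one before it. *)
pose M := (Lam + 4) * (9 * K) * (e1 + e2 + 1).
have M9 : 9 * K <= (Lam + 4) * (9 * K) by rewrite ler_peMl //; lra.
have bM (x : R) : 0 <= x -> x <= e1 + e2 + 1 -> (Lam + 4) * (9 * K) * x <= M.
  by move=> x0 xe; rewrite /M; apply: ler_wpM2l xe; rewrite mulr_ge0 //; lra.
have M1 : 1 <= M.
  have := bM 1; rewrite mulr1 => h; have : 1 <= (Lam + 4) * (9 * K) by lra.
  by move=> h1; apply: le_trans h1 (h _ _); lra.
have [D DE] : exists D, D = Num.sqrt 18 * (2 * ln M) + 1 by eexists.
have D0 : 0 <= Num.sqrt 18 * (2 * ln M).
  by rewrite mulr_ge0 ?sqrtr_ge0 // mulr_ge0 // ln_ge0.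
have leD x : x <= Num.sqrt 18 * (2 * ln M) -> x <= D by rewrite DE; lra.
have Dp : 0 < D by rewrite DE; lra.
(* Compares length with roots: 3 (speed k + 2 kap) <= z (rate k + 1), where 3 >= sqrt 6. *)
pose z := 3 * (speed K / rate R) + 6 * kap.
have z0 : 0 < z.
  have : 0 <= speed K / rate R by rewrite divr_ge0 // ltW.
  by rewrite /z; lra.
exists D, z^-1; split=> //; first by rewrite invr_gt0.
move=> n p gp; have [h [s [sh s1 s2 s3 _]]] := shadow gp.
have [Gp _ _] := gp.
have S3 t : (t <= n)%N -> SL3 (rho (blk (p t))) by move=> /Gp; exact: (rho_SL3 rho_rep).
have half t : (t <= n)%N -> (t./2 <= n./2)%N := @half_leq t n.
have sum0 (x y : 'rV[R]_3) : \sum_j x ord0 j = 0 -> \sum_j y ord0 j = 0 ->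
    \sum_j (x + y) ord0 j = 0.
  by move=> x0 y0; under eq_bigr do rewrite mxE; rewrite big_split /= x0 y0 addr0.
have sgN : \sum_j (- sg) ord0 j = 0.
  by under eq_bigr do rewrite mxE; rewrite sumrN sg_sum oppr0.
have S0 := (s1 0%N (leq0n _)).1; have SN := (s1 n./2 (leqnn _)).1.
have sumA := sum0 _ _ S0 sgN; have sumB := sum0 _ _ SN sg_sum.
have shx (x : 'rV[R]_3) : \sum_j x ord0 j = 0 -> SL3 (h *m expd x).
  by move=> x0; apply: SL3_mul => //; exact: det_expd.
have sq6 : Num.sqrt 6 <= 3 :> R.
  have p6 : 0 <= 6 :> R by lra.
  have := sqr_sqrtr p6; have := sqrtr_ge0 (6 : R).
  by move: (Num.sqrt 6) => x; nra.
have cone (k : nat) (x : 'rV[R]_3) : fro x <= speed K * k%:R + 2 * kap ->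
    (forall r, rate R * k%:R + 1 <= simple_root r x) ->
    (forall r, 0 < simple_root r x) /\
    (forall r, z^-1 * killing_norm x <= simple_root r x).
  move=> fx rx; have k0 : 0 <= k%:R :> R by exact: ler0n.
  have rk : 0 <= rate R * k%:R by rewrite mulr_ge0 // ltW.
  split=> r; first by have := rx r; lra.
  apply: le_trans (rx r); rewrite killing_normE ler_pdivrMl //.
  apply: (@le_trans _ _ (3 * (speed K * k%:R + 2 * kap))).
    by apply: ler_pM sq6 fx; [exact: sqrtr_ge0 | exact: fro_ge0].
  have e : speed K = speed K / rate R * rate R by rewrite divfK // gt_eqF.
  rewrite /z; have w0 : 0 <= speed K / rate R by rewrite divr_ge0 // ltW.
  rewrite {1}e; move: (speed K / rate R) w0 => w w0.
  have t1 : 0 <= kap * (rate R * k%:R) by rewrite mulr_ge0 // ltW.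
  have -> : (3 * w + 6 * kap) * (rate R * k%:R + 1) =
    3 * (w * rate R * k%:R) + 3 * w + 6 * (kap * (rate R * k%:R)) + 6 * kap by ring.
  lra.
exists (flat_point h (s 0%N - sg)), (flat_point h (s n./2 + sg)); split.
- by apply: symspace_act; exact: shx.
- by apply: symspace_act; exact: shx.
- apply/leD/dist_le_one_sided => //; [exact: shx | exact: S3 | right].
  rewrite expd_add [h *m _]mulmxA mulmxA.
  apply: le_trans (fro_mul _ _) _; have [_ b0] := s1 0%N (leq0n _).
  apply: (@le_trans _ _ ((Lam + 4) * (9 * K) * e1)); last by apply: bM; lra.
  by apply: ler_pM; rewrite ?fro_ge0 //; apply: le_trans b0 M9.
- apply/leD/dist_le_one_sided => //; [exact: shx | exact: S3 | right].
  have le2 : (n./2.*2 <= n)%N by rewrite -{2}(odd_double_half n) leq_addl.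
  have uN := SL3_unit (S3 _ le2).
  have -> : invmx (rho (blk (p n))) *m (h *m expd (s n./2 + sg)) =
     (invmx (rho (blk (p n))) *m rho (blk (p n./2.*2))) *m
     (invmx (rho (blk (p n./2.*2))) *m (h *m expd (s n./2))) *m expd sg.
    by rewrite expd_add !mulmxA mulmxK.
  apply: le_trans (fro_mul _ _) _.
  apply: (@le_trans _ _ ((Lam + 4) * (9 * K) * e2)); last by apply: bM; lra.
  apply: ler_pM; rewrite ?fro_ge0 //; apply: le_trans (fro_mul _ _) _.
  apply: ler_pM; [exact: fro_ge0 | exact: fro_ge0 | exact: near gp (leqnn n) |].
  by case: (s1 n./2 (leqnn _)).
move=> t le; have le2 := half t le; have [sj bj] := s1 _ le2.
exists (flat_point h (s t./2)).
  have jN : (0 <= t./2 <= n./2)%N by [].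
  have jN2 : (t./2 <= n./2 <= n./2)%N by rewrite le2 leqnn.
  have [||r1 k1] := cone t./2 (s t./2 - (s 0%N - sg)).
  - rewrite opprB addrCA addrC; apply: le_trans (fro_add _ _) _.
    by apply: lerD => //; have := s3 0%N t./2 jN; rewrite subn0.
  - move=> r; have := s2 0%N t./2 r jN.
    by rewrite subn0 !simple_rootB sg_root kapE; lra.
  have [||r2 k2] := cone (n./2 - t./2)%N (s n./2 + sg - s t./2).
  - rewrite addrAC; apply: le_trans (fro_add _ _) _.
    by apply: lerD => //; exact: s3.
  - move=> r; have := s2 _ _ r jN2.
    by rewrite !simple_rootB simple_rootD sg_root kapE; lra.
  by apply: diamond_flat => //; rewrite invr_gt0.
apply/leD/dist_le_one_sided => //; [exact: S3 | exact: shx | left].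
have le3 : (t./2.*2 <= n)%N.
  by apply: leq_trans le; rewrite -{2}(odd_double_half t) leq_addl.
have u2 := SL3_unit (S3 _ le3).
have -> : invmx (rho (blk (p t))) *m (h *m expd (s t./2)) =
   (invmx (rho (blk (p t))) *m rho (blk (p t./2.*2))) *m
   (invmx (rho (blk (p t./2.*2))) *m (h *m expd (s t./2))).
  by rewrite !mulmxA mulmxK.
apply: le_trans (fro_mul _ _) _.
apply: (@le_trans _ _ ((Lam + 4) * (9 * K) * 1)); last by apply: bM; lra.
by rewrite mulr1; apply: (ler_pM _ _ (near gp le) bj); exact: fro_ge0.
Qed.

(** Both orders of the endpoints are treated because the step of a quasigeodesic may be negative.
    The lower constant comes from a growth of 50 per block of two letters, the upper one from a norm
    bound per letter. *)
Lemma path_quasi_isometric : exists c1 c2 c3 c4 : R,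
  [/\ 0 < c1, 0 < c2, 0 < c3, 0 < c4 & forall n p, path n p ->
    (c1^-1 * n%:R - c2 <= dist (orbit p 0%N) (orbit p n) <= c3 * n%:R + c4) /\
    (c1^-1 * n%:R - c2 <= dist (orbit p n) (orbit p 0%N) <= c3 * n%:R + c4)].
Proof.
have L1 := Lam_gt1 LamE; have [K1 _ _ _] := constants.
have [_ _ eps1 _] := cone_constants_small constants.
have L0 : 0 < Lam + 4 by lra.
have [a aE] : exists a : R, a = Num.sqrt 6 by eexists.
have a0 : 0 < a by rewrite aE sqrtr_gt0; lra.
have [b bE] : exists b : R, b = Num.sqrt 18 by eexists.
have b0 : 0 < b by rewrite bE sqrtr_gt0; lra.
have l2 : 0 < ln 2 :> R by rewrite ln_gt0 //; lra.
have l50 : 0 < ln 50 :> R by rewrite ln_gt0 //; lra.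
have lL : 0 < ln (Lam + 4) by rewrite ln_gt0 //; lra.
have ale x y : x <= y -> a * x <= a * y by move=> xy; rewrite ler_pM2l.
exists (a * (ln 50 / 2))^-1, (a * (ln 50 / 2 + 2 * ln 2 + ln (Lam + 4))),
  (b * 2 * ln (Lam + 4)), (b * 2 * ln 2); split.
- by rewrite invr_gt0 !mulr_gt0 // divr_gt0.
- by rewrite mulr_gt0 //; lra.
- by rewrite !mulr_gt0.
- by rewrite !mulr_gt0.
move=> n p gp; have [h [s [_ _ _ _ gr]]] := shadow gp.
have [Gp st _] := gp.
have S3 t : (t <= n)%N -> SL3 (rho (blk (p t))) by move=> /Gp; exact: (rho_SL3 rho_rep).
have s0 := S3 0%N (leq0n _); have sn := S3 n (leqnn _).
have un := SL3_unit sn.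
have [f fE] : exists f, f = fro (invmx (rho (blk (p 0%N))) *m rho (blk (p n))) by eexists.
have up t : (t <= n)%N ->
    fro (invmx (rho (blk (p 0%N))) *m rho (blk (p t))) <= 2 * (Lam + 4) ^+ t.
  elim: t => [|t IH] le.
    by rewrite expr0 mulr1 mulVmx ?SL3_unit //; exact: fro_scalar1.
  have Gt := Gp _ (ltnW le); have Gt1 := Gp _ le.
  have ut := SL3_unit (S3 _ (ltnW le)).
  have -> : invmx (rho (blk (p 0%N))) *m rho (blk (p t.+1)) =
     (invmx (rho (blk (p 0%N))) *m rho (blk (p t))) *m
     (invmx (rho (blk (p t))) *m rho (blk (p t.+1))) by rewrite mulmxA mulmxK.
  apply: le_trans (fro_mul _ _) _; rewrite exprSr mulrA.
  apply: ler_pM; rewrite ?fro_ge0 ?IH ?(ltnW le) //.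
  rewrite -(rho_inv_mul lambda_gt1 lambdaE rho_rep) //.
  have GG : G (invmx (p t) *m p t.+1) by apply: GamM => //; exact: GamV.
  have g1 := st _ le; have LK : Lam <= K by rewrite KE expr2 ler_peMl //; lra.
  have h1 := pert GG (le_trans g1 LK).
  have h2 := fro_blk_le (invmx (p t) *m p t.+1).
  have := fro_add (rho (blk (invmx (p t) *m p t.+1)) - blk (invmx (p t) *m p t.+1))
    (blk (invmx (p t) *m p t.+1)).
  by rewrite subrK; lra.
have lo : 50 ^+ n./2 <= 2 * (f * (Lam + 4)).
  apply: le_trans gr _; rewrite ler_pM2l //.
  have -> : invmx (rho (blk (p 0%N))) *m rho (blk (p n./2.*2)) =
     (invmx (rho (blk (p 0%N))) *m rho (blk (p n))) *m
     (invmx (rho (blk (p n))) *m rho (blk (p n./2.*2))) by rewrite mulmxA mulmxK.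
  apply: le_trans (fro_mul _ _) _; rewrite -fE.
  by apply: ler_wpM2l (near gp (leqnn n)); rewrite fE fro_ge0.
have f0 : 0 < f.
  have p50 : 0 < 50 ^+ n./2 :> R by apply: exprn_gt0; lra.
  have : 0 < 2 * (f * (Lam + 4)) by apply: lt_le_trans lo.
  by rewrite pmulr_rgt0 // pmulr_lgt0.
have lf : ln 50 * (n./2)%:R <= ln 2 + ln f + ln (Lam + 4).
  have p50 : 0 < 50 :> R by lra.
  have : ln (50 ^+ n./2) <= ln (2 * (f * (Lam + 4))).
    by rewrite ler_ln ?posrE ?exprn_gt0 ?mulr_gt0.
  by rewrite lnXn // lnM ?posrE ?mulr_gt0 // lnM ?posrE // -mulr_natr; lra.
have n2 : n%:R <= 2 * (n./2)%:R + 1 :> R.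
  rewrite -natrM -(natrD _ _ 1) ler_nat -{1}(odd_double_half n) mul2n addnC.
  by rewrite leq_add2l; case: (odd n).
have low : a * (ln 50 / 2) * n%:R - a * (ln 50 / 2 + 2 * ln 2 + ln (Lam + 4)) <=
    a * (ln f - ln 2).
  have -> : a * (ln 50 / 2) * n%:R - a * (ln 50 / 2 + 2 * ln 2 + ln (Lam + 4)) =
    a * (ln 50 / 2 * n%:R - (ln 50 / 2 + 2 * ln 2 + ln (Lam + 4))) by ring.
  apply: ale.
  have : (ln 50 : R) / 2 * n%:R <= ln 50 / 2 * (2 * (n./2)%:R + 1).
    by rewrite ler_pM2l // divr_gt0.
  lra.
have M1 : 1 <= 2 * (Lam + 4) ^+ n.
  have : 1 <= (Lam + 4) ^+ n by apply: exprn_ege1; lra.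
  lra.
have hi : b * (2 * ln (2 * (Lam + 4) ^+ n)) = b * 2 * ln (Lam + 4) * n%:R + b * 2 * ln 2.
  by rewrite lnM ?posrE ?exprn_gt0 // lnXn // -mulr_natr; ring.
rewrite invrK; have [d1 _] := dist_ge s0 sn; have [_ d2] := dist_ge sn s0.
rewrite -fE -aE in d1 d2.
split; apply/andP; split.
- exact: le_trans low d1.
- by rewrite -hi bE; apply: dist_le_one_sided => //; left; exact: up.
- exact: le_trans low d2.
- by rewrite -hi bE; apply: dist_le_one_sided => //; right; exact: up.
Qed.

Lemma addz_dist (n i : int) : n <= i -> n + `|(i - n)%R|%N%:Z = i.
Proof. by lia. Qed.

Lemma cayley_path I c (n m : int) : cayley_geodesic S (Gamma2 lambda) I c ->
  I n -> I m -> n <= m ->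
  exists2 p, path `|m - n|%N p &
    forall t : nat, (t <= `|m - n|)%N -> c (n + t%:Z) = blk (p t).
Proof.
move=> [Iint cG cd] In Im nm.
have [k kE] : exists k, k = `|m - n|%N by eexists.
rewrite -kE.
have It (t : nat) : (t <= k)%N -> I (n + t%:Z).
  by move=> le; apply: (Iint n _ m) => //; apply/andP; split; lia.
(* Beyond [k] the identity is a filler that makes the choice total. *)
have ex (t : nat) : exists g, (t <= k)%N -> G g /\ c (n + t%:Z) = blk g.
  have [le|lt] := leqP t k; last by exists 1%:M.
  by have [g Gg e] := Gamma2_blk lambda_gt1 lambdaE (cG _ (It _ le)); exists g.
have [p pP] := choice ex.
have wd (i j : nat) : (i <= j <= k)%N ->
    word_length S (blk (invmx (p i) *m p j)) (j - i)%N.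
  move=> /andP [ij jk]; have [Gi ei] := pP i (leq_trans ij jk).
  have [Gj ej] := pP j jk.
  have := cd _ _ (It _ (leq_trans ij jk)) (It _ jk); rewrite /word_dist.
  rewrite (blk_inv_mul lambda_gt1 lambdaE) // -ei -ej.
  by have -> : `|(n + i%:Z - (n + j%:Z))%R|%N = (j - i)%N by lia.
exists p; last by move=> t le; case: (pP t le).
split.
- by move=> i le; case: (pP i le).
- move=> i lt; have [|[w [hw e] sz] _] := wd i i.+1; first by rewrite leqnSn.
  move: hw e sz; rewrite subSnn; case: w => [|x []] //= hw + _.
  have [|g [Gg xE gL]] := @letterP R lambda Lam S lambda_gt1 lambdaE SE x.
    by apply: hw; rewrite inE eqxx.
  by rewrite big_cons big_nil mulmx1 xE => /blk_inj ->.
by move=> i j w ij hw; have [_ h] := wd i j ij; exact: h.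
Qed.

Lemma orbit_morse : exists c1 c2 c3 c4 D alpha0 : R,
  [/\ 0 < c1, 0 < c2, 0 < c3 & 0 < c4] /\ 0 < D /\ 0 < alpha0 /\
  forall I c, cayley_geodesic S (Gamma2 lambda) I c ->
    morse_quasigeodesic c1 c2 c3 c4 D alpha0 I
      (fun n => act (rho (c n)) (basept R)).
Proof.
have [D [al [D0 al0 mo]]] := path_morse.
have [c1 [c2 [c3 [c4 [p1 p2 p3 p4 qi]]]]] := path_quasi_isometric.
exists c1, c2, c3, c4, D, al; do 3!split=> //; move=> I c cg; split.
  move=> n N In InN; have [N0|N0] := lerP 0 N.
    have [|p gp pE] := cayley_path cg In InN; first by rewrite lerDl.
    have [k kE] : exists k : nat, N = k%:Z by exists `|N|%N; clear -N0; lia.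
    have e : `|(n + N - n)%R|%N = k by clear -kE; lia.
    rewrite e in gp pE; have [q1 _] := qi _ _ gp.
    have := pE 0%N (leq0n _); have := pE k (leqnn _).
    rewrite addr0 -kE => -> ->.
    by have -> : `|N|%:~R = k%:R :> R by rewrite kE.
  have [|p gp pE] := cayley_path cg InN In; first by clear -N0; lia.
  have [k kE] : exists k : nat, N = - k%:Z by exists `|N|%N; clear -N0; lia.
  have e : `|(n - (n + N))%R|%N = k by clear -kE; lia.
  rewrite e in gp pE; have [_ q2] := qi _ _ gp.
  have := pE 0%N (leq0n _); have := pE k (leqnn _).
  rewrite addr0 {1}kE subrK => -> ->.
  by have -> : `|N|%:~R = k%:R :> R by rewrite kE normrN.
move=> n m In Im nm; have [p gp pE] := cayley_path cg In Im nm.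
have [a [b [sa sb da db dm]]] := mo _ _ gp.
have e0 := pE 0%N (leq0n _); have e1 := pE _ (leqnn `|(m - n)%R|%N).
rewrite addr0 in e0; rewrite (addz_dist nm) in e1.
exists a, b; rewrite /= e0 e1; split; [exact: sa|exact: sb|exact: da|exact: db|].
move=> i /andP [ni im]; have le : (`|(i - n)%R| <= `|(m - n)%R|)%N.
  by clear -ni im; lia.
have [q dq hq] := dm _ le; exists q; first exact: dq.
have ci := pE _ le; rewrite (addz_dist ni) in ci.
by rewrite /= ci; exact: hq.
Qed.

End Morse.

(** * Numerical budget *)

Section Numerals.
Variable R : realType.

Lemma of_uint_acc_ge u acc : (acc <= Nat.of_uint_acc u acc)%N.
Proof.
have tm a : (a <= Nat.tail_mul 10 a)%N.
  have ta n m : Nat.tail_add n m = (n + m)%N.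
    by elim: n m => //= n IH m; rewrite IH addnS.
  by rewrite /Nat.tail_mul /= !ta leq_addr.
elim: u acc => //= u IH acc; apply: leq_trans (IH _); have := tm acc; lia.
Qed.

(* The literal is too large to be evaluated in unary: four digits suffice for the
   bound, and reading a further digit only increases the value. *)
Lemma exponent_large : (1 + 3 + 7 * 2 + 7 * 2 + 2 * (14 * (4 * (7 * 2 * 2))) <= 3698433)%N.
Proof.
have step3 u acc : Nat.of_uint_acc (Decimal.D3 u) acc =
  Nat.of_uint_acc u (3 + Nat.tail_mul 10 acc) by [].
have step6 u acc : Nat.of_uint_acc (Decimal.D6 u) acc =
  Nat.of_uint_acc u (6 + Nat.tail_mul 10 acc) by [].
have step9 u acc : Nat.of_uint_acc (Decimal.D9 u) acc =
  Nat.of_uint_acc u (9 + Nat.tail_mul 10 acc) by [].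
have step8 u acc : Nat.of_uint_acc (Decimal.D8 u) acc =
  Nat.of_uint_acc u (8 + Nat.tail_mul 10 acc) by [].
rewrite /Nat.of_num_uint /Nat.of_uint step3 step6 step9 step8.
by apply: leq_trans (of_uint_acc_ge _ _); vm_compute.
Qed.

Lemma two_le_pow14 : 2 <= (20 / 19 : R) ^+ 14.
Proof.
have [x xE] : exists x : R, x = 20 / 19 by eexists.
rewrite -xE; have x2 : 1108 / 1000 <= x ^+ 2 by rewrite xE; lra.
have x4 : 1227 / 1000 <= x ^+ 4.
  have -> : x ^+ 4 = x ^+ 2 * x ^+ 2 by ring.
  by move: (x ^+ 2) x2 => y y2; nra.
have x8 : 1505 / 1000 <= x ^+ 8.
  have -> : x ^+ 8 = x ^+ 4 * x ^+ 4 by ring.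
  by move: (x ^+ 4) x4 => y y2; nra.
have -> : x ^+ 14 = x ^+ 8 * (x ^+ 4 * x ^+ 2) by ring.
move: (x ^+ 8) (x ^+ 4) (x ^+ 2) x8 x4 x2 => a b c a8 b4 c2.
have bc : 1359 / 1000 <= b * c by nra.
nra.
Qed.

End Numerals.

Section Generators.
Variables (R : realType) (lambda Lam : R) (S : seq 'M[R]_3).
Hypotheses (lambda_gt1 : 1 < lambda) (lambdaE : ln lambda = acosh (cot (pi / 8))).
Hypothesis LamE : 140 * 140 * 400 <= Lam.
Hypothesis SE : [set` S] =
  [set blk g | g in [set g | Gam lambda g /\ fro g <= Lam]].

Lemma ball_generates : generates S (Gamma2 lambda).
Proof.
have S_SL3 : [set` S] `<=` SL3.
  rewrite SE => _ [g [Gg _] <-]; have dg := Gam_det lambda_gt1 lambdaE Gg.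
  by rewrite /SL3 /= det_blk.
split=> //; apply/seteqP; split.
  apply: generated_min; first exact: Gamma2_subgroup.
  by rewrite SE => _ [g [Gg _] <-].
apply: generated_min; first exact: generated_subgroup.
move=> _ [t ht <-]; apply: generated_sub; rewrite SE.
have Gt : Gamma2 lambda (gen_mx lambda t) by apply: generated_sub; exists t.
move: Gt; rewrite (gen_mxE lambda_gt1 lambdaE) => Gt.
exists (oct lambda (cos t ^+ 2 - sin t ^+ 2) (- (2 * (sin t * cos t)))) => //.
split=> //.
have cs : (cos t ^+ 2 - sin t ^+ 2) ^+ 2 + (- (2 * (sin t * cos t))) ^+ 2 = 1.
  have := cos2Dsin2 t; move: (cos t) (sin t) => x y xy.
  rewrite (_ : _ + _ = (x ^+ 2 + y ^+ 2) ^+ 2); last by ring.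
  by rewrite xy expr1n.
have h := fro_oct lambda_gt1 lambdaE cs.
have L1 := Lam_gt1 LamE; have LL := LamE.
apply: (@le_trans _ _ 8); last by lra.
by rewrite -ler_sqr ?nnegrE ?fro_ge0 //; apply: le_trans h _; lra.
Qed.

End Generators.

(** The factors are spent separately: a A on K + 2, b A on d K, and q on the growth c. *)
Lemma budget_product (R : realType) (e0 K c A q a b d : R) :
  0 <= e0 -> 1 <= K -> 0 <= c -> K <= A -> c <= q -> 1 <= q -> 3 <= a ->
  0 < d -> d <= b -> e0 <= (a * b * A * A * q)^-1 ->
  e0 * (K + 2) * c <= (d * K)^-1.
Proof.
move=> e00 K1 c0 KA cq q1 a3 d0 db e0le.
have K0 : 0 < K by lra.
have [A0 q0] : 0 < A /\ 0 < q by lra.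
have [a0 b0] : 0 < a /\ 0 < b by lra.
have D0 : 0 < a * b * A * A * q by rewrite !mulr_gt0.
rewrite -div1r ler_pdivlMr // in e0le.
rewrite -[X in _ <= X]div1r ler_pdivlMr ?mulr_gt0 //; apply: le_trans e0le.
rewrite -!mulrA; apply: ler_wpM2l => //.
have -> : a * (b * (A * (A * q))) = a * A * (q * (b * A)) by ring.
have h1 : d * K <= b * A by apply: ler_pM => //; exact: ltW.
have h2 : K + 2 <= a * A.
  have : 3 * A <= a * A by rewrite ler_pM2r.
  lra.
have h : c * (d * K) <= q * (b * A).
  by apply: ler_pM => //; rewrite mulr_ge0 // ltW.
apply: ler_pM h => //; last by rewrite !mulr_ge0 // ltW.
by lra.
Qed.

(* n = 14 * 112 = 1568, since (20/19)^14 >= 2, and the error bound is split as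
   10 * 10^3 * A^2 * (10^2)^n with A = 10^14 >= K and 10^2 >= 20. *)
Lemma perturbation_budget (R : realType) (L K e0 : R) :
  L = 140 * 140 * 400 -> K = L ^+ 2 -> 0 <= e0 ->
  e0 <= 10 ^- (1 + 3 + 7 * 2 + 7 * 2 + 2 * (14 * (4 * (7 * 2 * 2)))) ->
  exists n, K ^+ 2 <= 60 * (20 / 19) ^+ n /\ e0 * (K + 2) * 20 ^+ n <= (400 * K)^-1.
Proof.
move=> LE KE e00; have two := two_le_pow14 R.
rewrite !exprD (exprM _ 7 2) (exprM _ 2 (14 * _)) => e0le.
exists (14 * (4 * (7 * 2 * 2)))%N; move: {-2}(14 * _)%N (erefl (14 * (4 * (7 * 2 * 2)))%N) e0le.
move=> n nE; have p10 : 1 <= 10 :> R by lra.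
have b4 : 400 <= 10 ^+ 3 :> R by rewrite (_ : 10 ^+ 3 = 1000); [lra | ring].
have p2 : 20 <= 10 ^+ 2 :> R by rewrite (_ : 10 ^+ 2 = 100); [lra | ring].
have L7 : L <= 10 ^+ 7.
  have -> : 10 ^+ 7 = 100 * 100 * 1000 :> R by ring.
  by rewrite LE; lra.
have L0 : 1 <= L by rewrite LE; lra.
have KA : K <= (10 ^+ 7) ^+ 2 by rewrite KE lerXn2r // nnegrE; lra.
have K1 : 1 <= K by rewrite KE exprn_ege1.
move=> e0le; split.
  have [x xE] : exists x : R, x = 20 / 19 by eexists.
  have x0 : 0 <= x by rewrite xE; lra.
  rewrite -xE in two *; rewrite nE !exprM.
  have y10 : 10 <= (x ^+ 14) ^+ 4.
    have y0 : 16 <= (x ^+ 14) ^+ 4; last by lra.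
    rewrite (_ : 16 = 2 ^+ 4); last by ring.
    by rewrite lerXn2r // nnegrE; lra.
  move: ((x ^+ 14) ^+ 4) y10 => y y10.
  have Ky : K <= (y ^+ 7) ^+ 2.
    apply: le_trans KA _; have y7 : 10 ^+ 7 <= y ^+ 7 by rewrite lerXn2r ?nnegrE; lra.
    by rewrite lerXn2r ?nnegrE ?exprn_ge0 //; lra.
  have : K ^+ 2 <= ((y ^+ 7) ^+ 2) ^+ 2 by rewrite lerXn2r // nnegrE; lra.
  have := sqr_ge0 ((y ^+ 7) ^+ 2).
  by move: (_ ^+ 2) (K ^+ 2) => a b; lra.
apply: (budget_product e00 K1 _ KA _ _ _ _ b4 e0le).
- by rewrite exprn_ge0; lra.
- by rewrite lerXn2r ?nnegrE; lra.
- by rewrite !exprn_ege1.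
- by rewrite expr1; clear; lra.
by clear; lra.
Qed.

(** The value eps = 1 / (400 K) serves both as the perturbation bound and as the slope of the
    cones. *)
Lemma uniform_perturbation (R : realType) (lambda : R) (rho : 'M[R]_3 -> 'M[R]_3)
  (lambda_gt1 : 1 < lambda)
  (lambdaE : ln lambda = acosh (cot (pi / 8)))
  (rho_rep : representation (Gamma2 lambda) rho)
  (rho_close : forall s : 'M[R]_3, S' lambda s ->
     frobenius (rho s - s) <= 10 ^- 3698433) :
  exists K L eps : R, [/\ 140 * 140 * 400 <= L, K = L ^+ 2, cone_constants K eps eps
    & forall g, Gam lambda g -> fro g <= K -> fro (rho (blk g) - blk g) <= eps].
Proof.
have [L LE] : exists L : R, L = 140 * 140 * 400 by eexists.
have [K KE] : exists K, K = L ^+ 2 by eexists.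
have L1 : 1 <= L by rewrite LE; clear; lra.
have K1 : 1 <= K by rewrite KE exprn_ege1.
have [e0 [n [e00 b1 b2 close]]] : exists (e0 : R) n, [/\ 0 <= e0,
    K ^+ 2 <= 60 * (20 / 19) ^+ n, e0 * (K + 2) * 20 ^+ n <= (400 * K)^-1 &
    forall s, S' lambda s -> frobenius (rho s - s) <= e0].
  (* The exponent is abstracted to an [N] known only to be large, so that the power is never
     computed. *)
  have : exists N, (1 + 3 + 7 * 2 + 7 * 2 + 2 * (14 * (4 * (7 * 2 * 2))) <= N)%N /\
      forall s, S' lambda s -> frobenius (rho s - s) <= 10 ^- N.
    exact (ex_intro _ _ (conj exponent_large rho_close)).
  clear rho_close => -[N [N_large closeN]].
  have [||n [b1 b2]] := perturbation_budget (e0 := 10 ^- N) LE KE.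
  - by rewrite invr_ge0 exprn_ge0.
  - by rewrite lef_pV2 ?posrE ?exprn_gt0 // ler_weXn2l ?ler1n.
  by exists (10 ^- N), n; split=> //; rewrite invr_ge0 exprn_ge0.
clear rho_close; have nz : 400 * K != 0 by rewrite gt_eqF; lra.
have i1 : (400 * K)^-1 <= 1 by rewrite invf_le1; lra.
have i0 : 0 <= (400 * K)^-1 by rewrite invr_ge0; lra.
have i2 : 400 * ((400 * K)^-1 * K) <= 1 by rewrite mulrCA mulVf ?lexx.
move: ((400 * K)^-1) i1 i0 i2 b2 {nz} => eps i1 i0 i2 b2.
have e01 : e0 <= 1.
  apply: le_trans (le_trans b2 i1); rewrite -mulrA ler_peMr //.
  have : 1 <= (20 : R) ^+ n by rewrite exprn_ege1 //; lra.
  by move: (20 ^+ n) => a a1; nra.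
exists K, L, eps; split; [by rewrite LE | exact: KE | |].
  by split; [exact: K1 | exact: i0 | exact: lexx | exact: i2].
move=> g Gg gK; apply: le_trans b2.
apply: (perturbation lambda_gt1 lambdaE rho_rep close e00 e01 K1 Gg gK).
by apply: le_trans b1; rewrite lerXn2r // nnegrE ?fro_ge0 //; lra.
Qed.

Lemma ball_generators (R : realType) (lambda L : R) : 1 < lambda ->
  ln lambda = acosh (cot (pi / 8)) ->
  exists S : seq 'M[R]_3,
    [set` S] = [set blk g | g in [set g | Gam lambda g /\ fro g <= L]].
Proof.
move=> l1 lE; have /finite_seqP [S SE] := finite_image (@blk R) (finite_ball l1 lE L).
by exists S.
Qed.

Unset Implicit Arguments.

Theorem theorem1p3 (R : realType) (lambda : R) (rho : 'M[R]_3 -> 'M[R]_3)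
  (lambda_gt1 : 1 < lambda)
  (lambdaE : ln lambda = acosh (cot (pi / 8)))
  (rho_rep : representation (Gamma2 lambda) rho)
  (rho_close : forall s : 'M[R]_3, S' lambda s ->
     frobenius (rho s - s) <= 10 ^- 3698433) :
  anosov (Gamma2 lambda) rho.
Proof.
have [K [L [eps [LE KE cst pert]]]] :=
  uniform_perturbation lambda_gt1 lambdaE rho_rep rho_close.
have [S SE] := ball_generators L lambda_gt1 lambdaE.
have gen := ball_generates lambda_gt1 lambdaE LE SE.
split; exists S; [exact: gen | | exact: gen |].
  exact: Gamma2_gromov lambda_gt1 lambdaE LE SE.
exact: orbit_morse lambda_gt1 lambdaE rho_rep LE SE KE cst pert.
Qed.
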